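(* Assume $\Phi_\Lambda$ is a stationary Poisson point process on $\mathbb R^2$ with intensity $\lambda>0$ (so $\Lambda(A)=\lambda\,\mathrm{area}(A)$), and let $I_\lambda=\sum_{k\ge1}PH_kG(T(\mathbf X_k))$ be the interference at a fixed point as described in the context. Then for all $x\in\mathbb R$, \[ \left|\Pr\!\left(\frac{I_\lambda-E[I_\lambda]}{\sqrt{\operatorname{Var}(I_\lambda)}}\le x\right)-\Psi(x)\right|\le\frac{c(x)}{\sqrt\lambda}, \] where $\Psi$ is the standard normal CDF and \[ c(x)=\frac{1}{\sqrt{2\pi}}\,\frac{m_{H^3}}{(m_{H^2})^{3/2}}\,\frac{\int_0^\infty G^3(t)\,t\,dt}{\left(\int_0^\infty G^2(t)\,t\,dt\right)^{3/2}}\,\min\!\left(0.4785,\ \frac{31.935}{1+|x|^3}\right). \]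
   Context: $\Phi_\Lambda=\sum_{k\ge1}\delta_{\mathbf X_k}$ is the transmitter location process; a test receiver is at a fixed point $\mathbf X_o\in\mathbb R^2$ and $T(\mathbf x)=\|\mathbf x-\mathbf X_o\|_2$. The path-loss function $G:[0,\infty)\to[0,\infty)$ is bounded, monotone non-increasing, and $G(t)=O(t^{-\alpha})$ as $t\to\infty$ for some $\alpha>2$. The fading coefficients $H_k\ge0$ (one per transmitter) are i.i.d. with common density $q$, independent of $\Phi_\Lambda$, with finite moments $m_H=E[H_1]$, $m_{H^2}=E[H_1^2]$, $m_{H^3}=E[H_1^3]$. All transmitters use power $P>0$. *)

(* Defs.v *)
From HB Require Import structures.
From mathcomp Require Import all_boot all_order all_algebra.
From mathcomp Require Import all_classical all_reals all_analysis.
Set Implicit Arguments. Unset Strict Implicit. Unset Printing Implicit Defensive.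
Import Order.TTheory GRing.Theory Num.Theory.
Import numFieldNormedType.Exports.
Local Open Scope classical_set_scope.
Local Open Scope ring_scope.

Section defs.
Context {R : realType}.

Definition area : set (R * R) -> \bar R :=
  (@lebesgue_measure R \x @lebesgue_measure R)%E.

Definition dist2 (xo x : R * R) : R :=
  Num.sqrt ((x.1 - xo.1) ^+ 2 + (x.2 - xo.2) ^+ 2).

Definition bounded2 (A : set (R * R)) : Prop :=
  exists r : R, A `<=` [set p | `|p.1| <= r /\ `|p.2| <= r].

Definition poisson_mass (mu : R) (k : nat) : R :=
  mu ^+ k / k`!%:R * expR (- mu).

Definition count_pts {T : Type} (X : nat -> T -> R * R) (A : set (R * R))
  (w : T) : \bar R :=
  (\sum_(0 <= k <oo) ((\1_A (X k w))%:E))%E.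

(* Phi = sum_k delta_{X_k} is a stationary Poisson point process with
   intensity lam: the counts in finitely many pairwise disjoint bounded Borel
   sets are independent Poisson variables with means lam * area. *)
Definition is_PPP {d : measure_display} {T : measurableType d}
  (P : probability T R) (X : nat -> T -> R * R) (lam : R) : Prop :=
  forall (n : nat) (A : nat -> set (R * R)) (m : nat -> nat),
    (forall i, (i < n)%N -> measurable (A i) /\ bounded2 (A i)) ->
    (forall i j, (i < n)%N -> (j < n)%N -> i <> j -> A i `&` A j = set0) ->
    P (\bigcap_(i in [set i | (i < n)%N]) [set w | count_pts X (A i) w = (m i)%:R%:E])
    = (\prod_(i < n) (poisson_mass (lam * fine (area (A i))) (m i))%:E)%E.

Definition dens_prob (q : R -> R) (B : set R) : \bar R :=
  (\int[lebesgue_measure]_(h in B) (q h)%:E)%E.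

Definition iid_marks_indep {d : measure_display} {T : measurableType d}
  (P : probability T R) (X : nat -> T -> R * R) (H : nat -> T -> R)
  (q : R -> R) : Prop :=
  forall (n : nat) (A : nat -> set (R * R)) (B : nat -> set R),
    (forall k, measurable (A k)) -> (forall k, measurable (B k)) ->
    P (\bigcap_(k in [set k | (k < n)%N]) [set w | A k (X k w) /\ B k (H k w)])
    = (P (\bigcap_(k in [set k | (k < n)%N]) [set w | A k (X k w)])
       * \prod_(k < n) dens_prob q (B k))%E.

Definition mark_moment (q : R -> R) (j : nat) : R :=
  fine (\int[lebesgue_measure]_(h in [set: R]) (h ^+ j * q h)%:E)%E.

Definition interference {T : Type} (Pw : R) (G : R -> R) (xo : R * R)
  (X : nat -> T -> R * R) (H : nat -> T -> R) (w : T) : \bar R :=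
  (\sum_(0 <= k <oo) ((Pw * H k w * G (dist2 xo (X k w)))%:E))%E.

Definition Psi (x : R) : R := fine (normal_prob 0 1 `]-oo, x]).

Definition Gmoment (G : R -> R) (j : nat) : R :=
  fine (\int[lebesgue_measure]_(t in `[0%R, +oo[%classic) ((G t) ^+ j * t)%:E)%E.

Definition cconst (q : R -> R) (G : R -> R) (x : R) : R :=
  (Num.sqrt (2 * pi))^-1
  * (mark_moment q 3 / Num.sqrt (mark_moment q 2 ^+ 3))
  * (Gmoment G 3 / Num.sqrt (Gmoment G 2 ^+ 3))
  * Num.min ((47 * 100 + 85) / (100 * 100))
      ((319 * 100 + 35) / (10 * 100) / (1 + `|x| ^+ 3)).

End defs.

(* Main.v *)
Require Import Defs.
From HB Require Import structures.
From mathcomp Require Import all_boot all_order all_algebra.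
From mathcomp Require Import all_classical all_reals all_analysis.
From mathcomp Require Import measurable_realfun ring lra.
Import Order.TTheory GRing.Theory Num.Theory.
Import numFieldNormedType.Exports.
Local Open Scope classical_set_scope.
Local Open Scope ring_scope.

Set Implicit Arguments. Unset Strict Implicit. Unset Printing Implicit Defensive.

(* Rounding the fading coefficients and the path gains down to multiples of 2^-n
   turns the interference into a multiple of a lattice compound Poisson variable.
   Its law obeys Panjer's recursion, which for the normalised variable Y with
   jump sizes a_i of rates mu_i is the Stein identity
     E[Y f(Y)] = sum_i mu_i a_i E[f(Y + a_i) - f(Y)].
   Inserting the solution of Stein's equation for 1(y <= z), the error becomes
   the expected gap between a monotone function g and its average over a random
   part of a jump.  Shifted averages of g grow slowly, by the Stein identity once
   more, and Lorden's renewal inequality turns this growth bound into a bound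
   of the gap by the Lyapunov ratio L = sum_i mu_i a_i^3: 0.4785 L because
   E max(Y, 0) <= 0.4785, and O(L / |z|^3) after truncating g at a multiple of |z|.
   As n grows the discretised interference increases to the interference; its
   first two moments converge monotonically, L converges to the constant of the
   theorem because the rings T(x) in S have area int_S 2 pi t dt, and continuity
   of both sides in x closes the limit in law. *)

(** * Lorden's inequality for lattice steps *)

(** The obstacle is that Stein's solution for an indicator is not smooth: expanding the jump terms
    would call for a concentration inequality, at a loss that the constant 0.4785 does not allow.
    Monotonicity replaces smoothness. Infinite divisibility makes the Stein identity exact, so the
    whole error is E[g(Y + part of a jump) - g(Y)] with g nondecreasing and of range at most 1. For
    H(k) = E[g(Y + k delta)] the identity reads sum_i mu_i a_i (H(k + m_i) - H(k)) =
    E[Y g(Y + k delta)]: a bound, uniform in the starting point k, on the mean growth over one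
    renewal step, which is just what Lorden's inequality asks for. As g has range 1, that bound is E
    max(Y, 0). Cauchy-Schwarz gives only 1/2 for it; the same identity, tested on (y - w)_+, brings
    it down to 0.4785. The lattice makes ages and the renewal function finite sums, open to
    induction. For large |z| the function g is split so that outside an exponentially small
    remainder only the tails E[Y; Y > u] or E[-Y; Y <= -u] enter, and fourth powers bound these. *)

Section lorden.
Context {R : realFieldType} {I : finType}.
Variables (c : I -> R) (m : I -> nat).
Hypotheses (c_ge0 : forall i, 0 <= c i) (c_sum1 : \sum_i c i = 1).
Hypothesis m_gt0 : forall i, (0 < m i)%N.

Local Notation rate := (\sum_i c i / (m i)%:R).

(* Average of [h] over the stationary age: uniform on [0, m i) with
   probability [c i]. *)
Definition age_avg (h : nat -> R) : R :=
  \sum_i c i / (m i)%:R * \sum_(0 <= r < m i) h r.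

Let mR_gt0 i : 0 < (m i)%:R :> R. Proof. by rewrite ltr0n. Qed.
Let cm_ge0 i : 0 <= c i / (m i)%:R. Proof. by rewrite divr_ge0 // ltW. Qed.

Let rate_gt0 : 0 < rate.
Proof.
rewrite lt_neqAle sumr_ge0 // andbT eq_sym; apply/eqP => r0.
have : \sum_i c i = 0.
  apply: big1 => i _; apply/eqP.
  have := psumr_eq0P (fun i _ => cm_ge0 i) r0 (i := i) isT.
  by move/eqP; rewrite mulf_eq0 invr_eq0 (gt_eqF (mR_gt0 i)) orbF.
by rewrite c_sum1 => /eqP; rewrite oner_eq0.
Qed.

Lemma age_avg_cst (a : R) : age_avg (fun=> a) = a.
Proof.
transitivity ((\sum_i c i) * a); last by rewrite c_sum1 mul1r.
rewrite mulr_suml; apply: eq_bigr => i _.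
by rewrite sumr_const_nat subn0 -[a *+ _]mulr_natr; field; rewrite gt_eqF.
Qed.

Lemma age_avgD (g h : nat -> R) :
  age_avg (fun r => g r + h r) = age_avg g + age_avg h.
Proof. by rewrite -big_split /=; apply: eq_bigr => i _; rewrite big_split mulrDr. Qed.

Lemma age_avgB (g h : nat -> R) :
  age_avg (fun r => g r - h r) = age_avg g - age_avg h.
Proof. by rewrite -sumrB /=; apply: eq_bigr => i _; rewrite sumrB mulrBr. Qed.

Lemma age_avgZ (a : R) (h : nat -> R) :
  age_avg (fun r => a * h r) = a * age_avg h.
Proof.
rewrite /age_avg mulr_sumr; apply: eq_bigr => i _.
by rewrite -mulr_sumr mulrCA.
Qed.

Lemma ler_age_avg (g h : nat -> R) : (forall r, g r <= h r) ->
  age_avg g <= age_avg h.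
Proof. by move=> gh; apply: ler_sum => i _; rewrite ler_wpM2l // ler_sum. Qed.

(** Given the step, the age is uniform, so a discrete derivative telescopes: age averages become the
    one-step differences that the hypothesis of [lorden] controls. *)
Lemma age_avg_diff (h : nat -> R) :
  age_avg (fun r => h r.+1 - h r) = \sum_i c i / (m i)%:R * (h (m i) - h 0%N).
Proof. by apply: eq_bigr => i _; rewrite telescope_sumr. Qed.

Lemma age_avg_id : age_avg (fun r => r%:R) = (\sum_i c i * (m i)%:R - 1) / 2.
Proof.
transitivity ((\sum_i c i * (m i)%:R - \sum_i c i) / 2); last by rewrite c_sum1.
rewrite -sumrB mulr_suml; apply: eq_bigr => i _.
have -> : \sum_(0 <= r < m i) r%:R = (m i)%:R * ((m i)%:R - 1) / 2 :> R.
  elim: (m i) => [|k IH]; first by rewrite big_geq // !mul0r.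
  by rewrite big_nat_recr //= IH -natr1; field.
by field; rewrite gt_eqF.
Qed.

(* Renewal function of the step law with weights [c i / (m i * rate)],
   computed with recursion depth at most [n]. *)
Fixpoint renewal_rec (n h : nat) : R :=
  if n is n'.+1 then
    if h is _.+1 then
      rate^-1 + \sum_i c i / (m i)%:R / rate * renewal_rec n' (h - m i)
    else 0
  else 0.

(** The mean step [rate^-1] times the expected number of steps needed to reach level [h]; depth [h]
    suffices because every step is at least 1. *)
Definition renewal h := renewal_rec h h.

Lemma renewal_rec_ge (n h : nat) : (h <= n)%N -> renewal_rec n h = renewal h.
Proof.
elim/ltn_ind: n h => -[|n] IH [|h] //= hn.
rewrite /renewal /=; congr (_ + _); apply: eq_bigr => i _; congr (_ * _).
have hm : (h.+1 - m i <= h)%N by have := m_gt0 i; case: (m i) => // k _; rewrite subSS leq_subr.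
by rewrite (IH n) ?(IH h) // (leq_trans hm).
Qed.

Lemma renewalS h : renewal h.+1 =
  rate^-1 + \sum_i c i / (m i)%:R / rate * renewal (h.+1 - m i).
Proof.
rewrite {1}/renewal /=; congr (_ + _); apply: eq_bigr => i _; congr (_ * _).
by rewrite renewal_rec_ge //; have := m_gt0 i; case: (m i) => // k _; rewrite subSS leq_subr.
Qed.

(** A renewal process delayed by its stationary age has stationary increments, so its renewal
    function is exactly linear. In the induction, the increment in [t] is an age average of
    differences, which telescopes to the renewal equation. *)
Lemma age_avg_renewal t : age_avg (fun r => renewal (t - r)) = t%:R.
Proof.
elim: t => [|t IH].
  by rewrite (_ : (fun=> _) = fun=> 0) ?age_avg_cst.
apply/eqP; rewrite -natr1 -IH addrC -subr_eq -age_avgB.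
have -> : age_avg (fun r => renewal (t.+1 - r) - renewal (t - r)) =
    - age_avg (fun r => renewal (t.+1 - r.+1) - renewal (t.+1 - r)).
  by rewrite -mulN1r -age_avgZ; apply: eq_bigr => i _; congr (_ * _);
    apply: eq_bigr => r _; rewrite subSS mulN1r opprB.
rewrite (age_avg_diff (fun r => renewal (t.+1 - r))) -sumrN subn0.
under eq_bigr do rewrite -mulrN opprB mulrBr.
have E : rate * renewal t.+1 = 1 + \sum_i c i / (m i)%:R * renewal (t.+1 - m i).
  rewrite renewalS mulrDr divff ?gt_eqF //; congr (_ + _).
  rewrite mulr_sumr; apply: eq_bigr => i _.
  by field; rewrite !gt_eqF.
by rewrite sumrB -mulr_suml E addrK.
Qed.

(** Compare two independent stationary ages [r] and [r']. The mean of [H (r' - r)] is at least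
    [V 0 - Q (E r + 1)], since the average over [r'] loses at most [Q] per unit of shift, and at
    most [H 0 + Q E r'], by the renewal bound. Together they give [Q (2 E r + 1)], which is the
    right side by [age_avg_id]. *)
Lemma lorden (H : nat -> R) (Q : R) :
  {homo H : j k / (j <= k)%N >-> j <= k} ->
  (forall k, \sum_i c i / (m i)%:R * (H (k + m i)%N - H k) <= Q) ->
  age_avg (fun r => H r.+1 - H 0%N) <= Q * \sum_i c i * (m i)%:R.
Proof.
move=> Hmono HQ.
have Q_ge0 : 0 <= Q.
  apply: le_trans (HQ 0%N); apply: sumr_ge0 => i _.
  by rewrite mulr_ge0 // subr_ge0 Hmono.
(* Strong induction on [h]: by monotonicity a step past [h] may be shortened to end at [h], so the
   growth over [h] obeys the renewal inequality. *)
have incr k h : H (k + h)%N - H k <= Q * renewal h.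
  elim/ltn_ind: h k => -[|h] IH k; first by rewrite addn0 subrr mulr0.
  rewrite renewalS lerBlDr -lerBlDl.
  have step : \sum_i c i / (m i)%:R * (H (k + h.+1)%N - Q * renewal (h.+1 - m i))
      <= Q + rate * H k.
    rewrite mulr_suml -lerBlDr -sumrB.
    apply: le_trans (HQ k); apply: ler_sum => i _.
    rewrite -mulrBr ler_wpM2l // lerB //.
    case: (leqP h.+1 (m i)) => hm.
      have -> : (h.+1 - m i = 0)%N by apply/eqP.
      by rewrite mulr0 subr0 Hmono // leq_add2l.
    have lt : (h.+1 - m i < h.+1)%N by rewrite ltn_subrL m_gt0.
    have := IH _ lt (k + m i)%N.
    by rewrite -addnA subnKC 1?ltnW // lerBlDr addrC -lerBlDr.
  move: step; under eq_bigr do rewrite mulrBr.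
  rewrite sumrB -mulr_suml => step.
  rewrite mulrDr lerBlDr.
  rewrite -(ler_pM2l rate_gt0) !mulrDr [rate * (Q / _)]mulrCA divff ?gt_eqF // mulr1.
  suff <- : \sum_i c i / (m i)%:R * (Q * renewal (h.+1 - m i)) =
     rate * (Q * \sum_i c i / (m i)%:R / rate * renewal (h.+1 - m i)) by lra.
  rewrite mulrCA !mulr_sumr; apply: eq_bigr => i _.
  by field; rewrite !gt_eqF.
(* Subtraction is truncated, so [H] is never taken below 0; [V r.+1] is the mean of [H (r' - r)]
   over [r']. *)
pose V k := age_avg (fun r => H (r.+1 - k)%N).
have V_dec k : V k - V k.+1 <= Q.
  rewrite -age_avgB.
  have -> : age_avg (fun r => H (r.+1 - k)%N - H (r.+1 - k.+1)%N) =
            age_avg (fun r => H (r.+1 - k)%N - H (r - k)%N).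
    by rewrite /age_avg; under eq_bigr do under eq_bigr do rewrite subSS.
  rewrite (age_avg_diff (fun r => H (r - k)%N)).
  apply: le_trans (HQ 0%N); apply: ler_sum => i _.
  by rewrite ler_wpM2l // sub0n add0n lerB // Hmono // leq_subr.
have V_lb r : V 0%N - Q * (r%:R + 1) <= age_avg (fun r' => H (r' - r)%N).
  have -> : age_avg (fun r' => H (r' - r)%N) = V r.+1 by [].
  elim: r => [|r IH]; first by have := V_dec 0%N; lra.
  by have := V_dec r.+1; rewrite -natr1; lra.
have lb : age_avg (fun r => age_avg (fun r' => H (r' - r)%N - Q * renewal (r' - r)))
    <= H 0%N.
  rewrite -[leRHS]age_avg_cst; apply: ler_age_avg => r.
  rewrite -[leRHS]age_avg_cst; apply: ler_age_avg => r'.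
  by have := incr 0%N (r' - r)%N; rewrite add0n; lra.
have swap (h : nat -> nat -> R) :
    age_avg (fun r => age_avg (h r)) = age_avg (fun r' => age_avg (h ^~ r')).
  rewrite /age_avg.
  under eq_bigr do rewrite exchange_big mulr_sumr /=.
  rewrite exchange_big /=; apply: eq_bigr => i _.
  rewrite exchange_big [RHS]mulr_sumr /=; apply: eq_bigr => j _.
  by rewrite -!mulr_sumr mulrCA exchange_big.
have ub : V 0%N - Q * (age_avg (fun r => r%:R) + 1) - Q * age_avg (fun r => r%:R) <= H 0%N.
  apply: le_trans lb.
  have -> : V 0%N - Q * (age_avg (fun r => r%:R) + 1) - Q * age_avg (fun r => r%:R)
     = age_avg (fun r => (V 0%N - Q * (r%:R + 1))) - Q * age_avg (fun r => r%:R).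
    by rewrite age_avgB age_avg_cst age_avgZ age_avgD age_avg_cst.
  have -> : age_avg (fun r => age_avg (fun r' => H (r' - r)%N - Q * renewal (r' - r))) =
    age_avg (fun r => age_avg (fun r' => H (r' - r)%N)) -
    Q * age_avg (fun r => age_avg (fun r' => renewal (r' - r))).
    rewrite -age_avgZ -age_avgB; apply: eq_bigr => i _; congr (_ * _).
    by apply: eq_bigr => r _; rewrite age_avgB age_avgZ.
  apply: lerB; first exact: ler_age_avg.
  rewrite swap; rewrite le_eqVlt; apply/orP; left; apply/eqP; congr (_ * _).
  by apply: eq_bigr => i _; congr (_ * _); apply: eq_bigr => r _; rewrite age_avg_renewal.
rewrite age_avgB age_avg_cst; rewrite -/(V 0%N).
move: ub; rewrite age_avg_id; lra.
Qed.
End lorden.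

(** * Panjer's recursion and Stein's identity *)

Section panjer.
Context {R : realType} {I : finType}.
Variables (b : nat -> R) (mu : I -> R) (m : I -> nat).

(* Panjer's recursion characterises the law of sum_i m_i N_i with independent
   Poisson N_i of means mu_i. *)
Definition panjer_law :=
  [/\ forall n, 0 <= b n, series b @ \oo --> (1 : R), forall i, 0 <= mu i,
      forall i, (0 < m i)%N &
      forall n, n%:R * b n =
        \sum_i mu i * (m i)%:R * (if (m i <= n)%N then b (n - m i)%N else 0)].

Definition lin_growth (f : nat -> R) :=
  exists C, forall n, `|f n| <= C * (1 + n%:R).
Definition quad_growth (f : nat -> R) :=
  exists C, forall n, `|f n| <= C * (1 + n%:R) ^+ 2.

(** Expectation of [f] under [b]. The limit of a divergent series has a default value; [lmean_cvg]
    ensures convergence under [quad_growth]. *)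
Definition lmean (f : nat -> R) : R := limn (series (fun n => f n * b n)).

Lemma quad_growthD f g : quad_growth f -> quad_growth g ->
  quad_growth (fun n => f n + g n).
Proof.
move=> [C Cf] [D Dg]; exists (C + D) => n.
by rewrite mulrDl (le_trans (ler_normD _ _)) // lerD.
Qed.

Lemma quad_growthZ a f : quad_growth f -> quad_growth (fun n => a * f n).
Proof.
by move=> [C Cf]; exists (`|a| * C) => n; rewrite normrM -mulrA ler_wpM2l.
Qed.

Lemma quad_growthB f g : quad_growth f -> quad_growth g ->
  quad_growth (fun n => f n - g n).
Proof.
move=> fq /(quad_growthZ (-1)) gq; have [C H] := quad_growthD fq gq.
by exists C => n; have := H n; rewrite mulN1r.
Qed.

Lemma quad_growth_sum (J : Type) (s : seq J) (F : J -> nat -> R) :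
  (forall j, quad_growth (F j)) -> quad_growth (fun n => \sum_(j <- s) F j n).
Proof.
move=> qF; elim: s => [|j s IH].
  by exists 0 => n; rewrite big_nil normr0 mul0r.
by under eq_fun do rewrite big_cons; exact: quad_growthD.
Qed.

Lemma lin_growth_quad f : lin_growth f -> quad_growth f.
Proof.
move=> [C Cf]; exists (C) => n; apply: le_trans (Cf n) _.
have C0 : 0 <= C by have := le_trans (normr_ge0 _) (Cf 0%N); rewrite addr0 mulr1.
by rewrite ler_wpM2l // expr2 ler_peMr ?addr_ge0 // lerDl.
Qed.

Lemma lin_growthM_nat f : lin_growth f -> quad_growth (fun n => n%:R * f n).
Proof.
move=> [C Cf]; exists C => n.
rewrite normrM normr_nat (le_trans (ler_wpM2l _ (Cf n))) // mulrCA.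
have C0 : 0 <= C by have := le_trans (normr_ge0 _) (Cf 0%N); rewrite addr0 mulr1.
by rewrite ler_wpM2l // expr2 ler_wpM2r ?addr_ge0 // lerDr.
Qed.

Lemma quad_growth_shift f k : quad_growth f -> quad_growth (fun n => f (n + k)%N).
Proof.
move=> [C Cf]; exists (C * (1 + k%:R) ^+ 2) => n; apply: le_trans (Cf _) _.
have C0 : 0 <= C by have := le_trans (normr_ge0 _) (Cf 0%N); rewrite addr0 expr1n mulr1.
rewrite -mulrA ler_wpM2l // -exprMn lerXn2r ?nnegrE ?mulr_ge0 ?addr_ge0 //.
have : 0 <= n%:R * k%:R :> R by rewrite mulr_ge0.
by rewrite natrD; lra.
Qed.

Lemma lin_growth_shift f k : lin_growth f -> lin_growth (fun n => f (n + k)%N).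
Proof.
move=> [C Cf]; exists (C * (1 + k%:R)) => n; apply: le_trans (Cf _) _.
have C0 : 0 <= C by have := le_trans (normr_ge0 _) (Cf 0%N); rewrite addr0 mulr1.
rewrite -mulrA ler_wpM2l //.
have : 0 <= n%:R * k%:R :> R by rewrite mulr_ge0.
by rewrite natrD; lra.
Qed.

Lemma bounded_lin_growth f C : (forall n, `|f n| <= C) -> lin_growth f.
Proof.
move=> fC; exists C => n; apply: le_trans (fC n) _.
by rewrite ler_peMr ?lerDl // (le_trans _ (fC 0%N)).
Qed.

Hypothesis law : panjer_law.

Let b_ge0 n : 0 <= b n. Proof. by case: law. Qed.
Let mu_ge0 i : 0 <= mu i. Proof. by case: law. Qed.
Let m_gt0 i : (0 < m i)%N. Proof. by case: law. Qed.
Let b1 : series b @ \oo --> (1 : R). Proof. by case: law. Qed.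

(** Stated for partial sums so that it can bound the moments of [b] before any convergence is known;
    the cutoff [N - m i] comes from the shift of index. *)
Lemma panjer_psum (f : nat -> R) N :
  \sum_(0 <= n < N) n%:R * f n * b n =
  \sum_i mu i * (m i)%:R * \sum_(0 <= n < N - m i) f (n + m i)%N * b n.
Proof.
case: law => _ _ _ _ rec.
under eq_bigr => n _ do rewrite mulrAC rec mulr_suml.
rewrite exchange_big /=; apply: eq_bigr => i _.
rewrite mulr_sumr.
have [mN|Nm] := leqP (m i) N; last first.
  rewrite (_ : (N - m i = 0)%N) ?[RHS]big_geq //; last by apply/eqP; rewrite subn_eq0 ltnW.
  rewrite big_nat big1 // => n /= nN; rewrite leqNgt (leq_trans nN) 1?ltnW //=.
  by rewrite mulr0 mul0r.
rewrite (big_cat_nat _ mN) //= big_nat big1 ?add0r; last first.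
  by move=> n /= nm; rewrite leqNgt nm /= mulr0 mul0r.
rewrite -{1}[m i]add0n big_addn big_nat [RHS]big_nat; apply: eq_bigr => n _.
by rewrite leq_addl addnK -!mulrA [b n * _]mulrC.
Qed.

Let psum_b_le1 N : \sum_(0 <= n < N) b n <= 1.
Proof.
have cb := cvgP _ b1; rewrite -(cvg_lim _ b1) //.
apply: (@nondecreasing_cvgn_le _ (series b)) => //.
by apply/nondecreasing_seqP => n; rewrite /series /= big_nat_recr //= lerDl.
Qed.

(** The moments bootstrap: [panjer_psum] with f = 1 bounds the first by the mass, and with f = n the
    second by the first. Two rounds suffice for test functions of quadratic growth. *)
Let psum1_bnd : exists K : R, forall N, \sum_(0 <= n < N) n%:R * b n <= K.
Proof.
exists (\sum_i mu i * (m i)%:R) => N.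
have := panjer_psum (fun=> 1) N.
under eq_bigr do rewrite mulr1.
move=> ->; apply: ler_sum => i _.
rewrite -[leRHS]mulr1 ler_wpM2l ?mulr_ge0 //.
by under eq_bigr do rewrite mul1r.
Qed.

Let psum2_bnd : exists K : R, forall N, \sum_(0 <= n < N) n%:R ^+ 2 * b n <= K.
Proof.
have [K1 HK1] := psum1_bnd.
exists (\sum_i mu i * (m i)%:R * (K1 + (m i)%:R)) => N.
have := panjer_psum (fun n => n%:R) N.
under eq_bigr do rewrite -expr2.
move=> ->; apply: ler_sum => i _.
rewrite ler_wpM2l ?mulr_ge0 //.
under eq_bigr do rewrite natrD mulrDl.
rewrite big_split /= lerD // -mulr_sumr -[leRHS]mulr1.
by rewrite ler_wpM2l.
Qed.

Lemma lmean_cvg f : quad_growth f -> cvgn (series (fun n => f n * b n)).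
Proof.
move=> [C Cf].
have C0 : 0 <= C by have := le_trans (normr_ge0 _) (Cf 0%N); rewrite addr0 expr1n mulr1.
apply: (@normed_cvg _ R^o); rewrite /=.
apply: (@series_le_cvg _ _ (fun n => C * ((1 + n%:R) ^+ 2 * b n))) => //.
- by move=> n /=.
- by move=> n; rewrite !mulr_ge0 ?exprn_ge0 ?addr_ge0.
- by move=> n /=; rewrite normrM (ger0_norm (b_ge0 n)) mulrA ler_wpM2r.
apply: nondecreasing_is_cvgn.
  apply/nondecreasing_seqP => n; rewrite /series /= big_nat_recr //= lerDl.
  by rewrite !mulr_ge0 ?exprn_ge0 ?addr_ge0.
have [K1 HK1] := psum1_bnd; have [K2 HK2] := psum2_bnd.
exists (C * (1 + 2 * K1 + K2)) => _ [N _ <-]; rewrite /series /= -mulr_sumr.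
rewrite ler_wpM2l //.
rewrite (eq_bigr (fun n => b n + 2 * (n%:R * b n) + n%:R ^+ 2 * b n)); last first.
  by move=> n _; ring.
rewrite !big_split /= -mulr_sumr.
have := psum_b_le1 N; have := HK1 N; have := HK2 N; lra.
Qed.

Lemma lmeanD f g : quad_growth f -> quad_growth g ->
  lmean (fun n => f n + g n) = lmean f + lmean g.
Proof.
move=> fq gq; rewrite /lmean -lim_seriesD; [|exact: lmean_cvg..].
by congr (limn (series _)); apply/funext => n /=; rewrite mulrDl.
Qed.

Lemma lmeanZ a f : quad_growth f -> lmean (fun n => a * f n) = a * lmean f.
Proof.
move=> fq; apply/cvg_lim => //.
rewrite (_ : series _ = fun N => a * series (fun n => f n * b n) N).
  by apply: cvgMl_tmp; exact: lmean_cvg.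
apply/funext => N; rewrite /series /= mulr_sumr.
by apply: eq_bigr => n _; rewrite mulrA.
Qed.

Lemma lmeanB f g : quad_growth f -> quad_growth g ->
  lmean (fun n => f n - g n) = lmean f - lmean g.
Proof.
move=> fq gq.
rewrite (_ : (fun n => f n - g n) = fun n => f n + (-1) * g n).
  by rewrite lmeanD ?lmeanZ ?mulN1r //; exact: quad_growthZ.
by apply/funext => n; rewrite mulN1r.
Qed.

Lemma lmean_cst a : lmean (fun=> a) = a.
Proof.
rewrite (_ : (fun=> a) = fun n => a * ((fun=> 1 : R) n)); last first.
  by apply/funext => n; rewrite mulr1.
rewrite lmeanZ; last first.
  by exists 1 => n; rewrite mul1r normr1 expr_ge1 // ?addr_ge0 // lerDl.
rewrite -[RHS]mulr1; congr (_ * _); apply/cvg_lim => //.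
by under eq_fun do rewrite mul1r.
Qed.

Lemma lmean_sum (J : Type) (s : seq J) (F : J -> nat -> R) :
  (forall j, quad_growth (F j)) ->
  lmean (fun n => \sum_(j <- s) F j n) = \sum_(j <- s) lmean (F j).
Proof.
move=> qF; elim: s => [|j s IH].
  by under eq_fun do rewrite big_nil; rewrite big_nil lmean_cst.
rewrite big_cons -IH -lmeanD //; last exact: quad_growth_sum.
by under eq_fun do rewrite big_cons.
Qed.

Lemma ler_lmean f g : quad_growth f -> quad_growth g ->
  (forall n, f n <= g n) -> lmean f <= lmean g.
Proof.
move=> fq gq fg; apply: lim_series_le; [exact: lmean_cvg..|].
by move=> n; rewrite ler_wpM2r.
Qed.

Lemma panjer_stein f : lin_growth f ->
  lmean (fun n => n%:R * f n) = \sum_i mu i * (m i)%:R * lmean (fun n => f (n + m i)%N).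
Proof.
move=> fl; apply/cvg_lim => //.
rewrite (_ : series _ = fun N =>
  \sum_i mu i * (m i)%:R * \sum_(0 <= n < N - m i) f (n + m i)%N * b n).
  apply: cvg_big => [|i _]; first exact: add_continuous.
  apply: cvgMl_tmp.
  rewrite (@cvg_centern _ _ (series (fun n => f (n + m i)%N * b n))).
  by apply: lmean_cvg; apply/lin_growth_quad/lin_growth_shift.
by apply/funext => N; rewrite -panjer_psum.
Qed.

End panjer.

(** * The centred and scaled variable and its Stein identity *)

Section normalized.
Context {R : realType} {I : finType}.
Variables (b : nat -> R) (mu : I -> R) (m : I -> nat) (delta : R).

Definition jump i : R := delta * (m i)%:R.
Definition ypos n : R := delta * n%:R - \sum_i mu i * jump i.
Definition gener (f : nat -> R) n :=
  \sum_i mu i * jump i * (f (n + m i)%N - f n).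
(** Average of [f] after a random part of a jump: the jump is chosen with weights
    [mu i * jump i ^+ 2], which sum to 1 under unit variance, and its part is uniform on 1, ...,
    [m i]. The successor selects the right end of each lattice cell. *)
Definition jump_avg (f : nat -> R) n :=
  age_avg (fun i => mu i * jump i ^+ 2) m (fun r => f (n + r.+1)%N).
Definition lyapunov := \sum_i mu i * jump i ^+ 3.

Definition bounded_on_nat (f : nat -> R) := exists C, forall n, `|f n| <= C.

Local Notation E := (lmean b).

Lemma bounded_quad_growth f : bounded_on_nat f -> quad_growth f.
Proof. by move=> [C] /bounded_lin_growth/lin_growth_quad. Qed.

Lemma bounded_onM f g : bounded_on_nat f -> bounded_on_nat g ->
  bounded_on_nat (fun n => f n * g n).
Proof.
move=> [C Cf] [D Dg]; exists (C * D) => n.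
by rewrite normrM ler_pM.
Qed.

Lemma bounded_on_shift f k : bounded_on_nat f -> bounded_on_nat (fun n => f (n + k)%N).
Proof. by move=> [C Cf]; exists C. Qed.

Lemma lin_growthM_ypos f : lin_growth f -> quad_growth (fun n => ypos n * f n).
Proof.
move=> lf; rewrite (_ : (fun n => _) = fun n => delta * (n%:R * f n) -
    (\sum_i mu i * jump i) * f n); last by apply/funext => n; rewrite /ypos; ring.
apply: quad_growthB; apply: quad_growthZ; last exact: lin_growth_quad.
exact: lin_growthM_nat.
Qed.

Lemma ypos_shift n k : ypos (n + k) = ypos n + delta * k%:R.
Proof. by rewrite /ypos natrD; ring. Qed.

Lemma ypos_lin_growth : lin_growth ypos.
Proof.
exists (`|delta| + `|\sum_i mu i * jump i|) => n; rewrite /ypos.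
apply: le_trans (ler_normB _ _) _; rewrite normrM normr_nat.
have := normr_ge0 delta; have := normr_ge0 (\sum_i mu i * jump i).
set x := `|_|; set y := `|_| => x0 y0.
have : 0 <= n%:R * x by rewrite mulr_ge0.
by lra.
Qed.

Lemma quad_growth_gener f : quad_growth f -> quad_growth (gener f).
Proof.
move=> qf; apply: quad_growth_sum => i; apply: quad_growthZ.
by apply: quad_growthB => //; exact: quad_growth_shift.
Qed.

Lemma quad_growth_jump_avg f : quad_growth f -> quad_growth (jump_avg f).
Proof.
move=> qf; apply: quad_growth_sum => i; apply: quad_growthZ.
by apply: quad_growth_sum => r; exact: quad_growth_shift.
Qed.

Hypothesis law : panjer_law b mu m.
Hypothesis delta_gt0 : 0 < delta.
Hypothesis var1 : \sum_i mu i * jump i ^+ 2 = 1.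

Let mu_ge0 i : 0 <= mu i. Proof. by case: law. Qed.
Let m_gt0 i : (0 < m i)%N. Proof. by case: law. Qed.
Let jump_gt0 i : 0 < jump i. Proof. by rewrite mulr_gt0 // ltr0n. Qed.

(** Centring by the mean turns the shifted values of [panjer_stein] into increments. *)
Lemma stein_identity f : lin_growth f ->
  E (fun n => ypos n * f n) = E (gener f).
Proof.
move=> lf; have qf := lin_growth_quad lf.
have qs i : quad_growth (fun n => f (n + m i)%N) by exact: quad_growth_shift.
rewrite (lmean_sum law); last first.
  by move=> i; apply: quad_growthZ; exact: quad_growthB.
rewrite (_ : (fun n => _) = fun n => delta * (n%:R * f n) -
    (\sum_i mu i * jump i) * f n); last by apply/funext => n; rewrite /ypos; ring.
rewrite (lmeanB law) ?(lmeanZ law) //; try apply: quad_growthZ => //; try exact: lin_growthM_nat.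
rewrite (panjer_stein law) // mulr_suml mulr_sumr -sumrB.
apply: eq_bigr => i _; rewrite (lmeanZ law); last exact: quad_growthB.
by rewrite (lmeanB law) // /jump; ring.
Qed.

Lemma lmean_ypos : E ypos = 0.
Proof.
have := @stein_identity (fun=> 1).
rewrite (_ : gener _ = fun=> 0); last first.
  by apply/funext => n; apply: big1 => i _; rewrite subrr mulr0.
rewrite (lmean_cst law) => <-; last first.
  by apply: (@bounded_lin_growth _ _ 1) => n; rewrite normr1.
by congr lmean; apply/funext => n; rewrite mulr1.
Qed.

Lemma lmean_ypos2 : E (fun n => ypos n ^+ 2) = 1.
Proof.
rewrite (_ : (fun n => _) = fun n => ypos n * ypos n) //.
rewrite stein_identity; last exact: ypos_lin_growth.
rewrite (_ : gener _ = fun=> 1) ?(lmean_cst law) //.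
apply/funext => n; rewrite /gener -[RHS]var1; apply: eq_bigr => i _.
by rewrite ypos_shift -/(jump i); ring.
Qed.

Lemma lyapunov_ge0 : 0 <= lyapunov.
Proof. by apply: sumr_ge0 => i _; rewrite mulr_ge0 // exprn_ge0 // ltW. Qed.

(* Lorden's inequality applied to the shift k |-> E[w g(. + k)]. *)
Lemma lmean_jump_avg_le (w g : nat -> R) (P : R) :
  {homo g : j k / (j <= k)%N >-> j <= k} -> bounded_on_nat g ->
  (forall n, 0 <= w n) -> bounded_on_nat w ->
  (forall n h k, 0 <= (w (n + h)%N - w n) * g (n + h + k)%N) ->
  (forall k, E (fun n => ypos n * (w n * g (n + k)%N)) <= P) ->
  E (fun n => w n * (jump_avg g n - g n)) <= P * lyapunov.
Proof.
move=> gmono gbnd w0 wbnd wg HP.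
pose c i := mu i * jump i ^+ 2.
have c0 i : 0 <= c i by rewrite mulr_ge0 // exprn_ge0 // ltW.
pose H k := E (fun n => w n * g (n + k)%N).
have bwg k : bounded_on_nat (fun n => w n * g (n + k)%N).
  by apply: bounded_onM => //; exact: bounded_on_shift.
have qwg k := bounded_quad_growth (bwg k).
have Hmono : {homo H : j k / (j <= k)%N >-> j <= k}.
  move=> j k jk; apply: (ler_lmean law) => // n.
  by rewrite ler_wpM2l // gmono // leq_add2l.
(* Up to the factor [delta], the left side is the mean of [w] times the generator of the shifted
   [g]. The sign condition on the increments of [w] allows [w] to be moved inside the generator,
   where the Stein identity applies. *)
have HQ k : \sum_i c i / (m i)%:R * (H (k + m i)%N - H k) <= delta * P.
  have -> : \sum_i c i / (m i)%:R * (H (k + m i)%N - H k) =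
      delta * E (fun n => w n * gener (fun n' => g (n' + k)%N) n).
    have -> : (fun n => w n * gener (fun n' => g (n' + k)%N) n) =
       fun n => \sum_i mu i * jump i * (w n * g (n + (k + m i))%N - w n * g (n + k)%N).
      apply/funext => n; rewrite mulr_sumr; apply: eq_bigr => i _.
      by rewrite addnAC addnA; ring.
    rewrite (lmean_sum law); last by move=> i; apply: quad_growthZ; exact: quad_growthB.
    rewrite mulr_sumr; apply: eq_bigr => i _.
    rewrite (lmeanZ law); last exact: quad_growthB.
    rewrite (lmeanB law) // -/(H _) -/(H k) /c /jump.
    by field; rewrite pnatr_eq0 -lt0n.
  rewrite ler_pM2l //; apply: le_trans (HP k).
  rewrite stein_identity; last by have [C HC] := bwg k; exact: bounded_lin_growth HC.
  apply: (ler_lmean law).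
  - rewrite (_ : (fun n => w n * gener (fun n' => g (n' + k)%N) n) =
       fun n => \sum_i mu i * jump i * (w n * g (n + (k + m i))%N - w n * g (n + k)%N)).
      by apply: quad_growth_sum => i; apply: quad_growthZ; exact: quad_growthB.
    apply/funext => n; rewrite mulr_sumr; apply: eq_bigr => i _.
    by rewrite addnAC addnA; ring.
  - exact: quad_growth_gener.
  - move=> n; rewrite mulr_sumr; apply: ler_sum => i _.
    rewrite mulrCA ler_wpM2l //; first by rewrite mulr_ge0 // ltW.
    by have := wg n (m i) k; lra.
have := lorden c0 var1 m_gt0 Hmono HQ.
have -> : delta * P * \sum_i c i * (m i)%:R = P * lyapunov.
  by rewrite !mulr_sumr; apply: eq_bigr => i _; rewrite /c /jump; ring.
congr (_ <= _); rewrite age_avgB (age_avg_cst var1 m_gt0).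
rewrite (_ : (fun n => w n * _) = fun n => w n * jump_avg g n - w n * g (n + 0)%N); last first.
  by apply/funext => n; rewrite addn0 mulrBr.
have E1 : (fun n => w n * jump_avg g n) =
    fun n => \sum_i c i / (m i)%:R * \sum_(0 <= r < m i) w n * g (n + r.+1)%N.
  apply/funext => n; rewrite mulr_sumr; apply: eq_bigr => i _.
  by rewrite mulrCA; congr (_ * _); rewrite mulr_sumr.
have qs i : quad_growth (fun n => \sum_(0 <= r < m i) w n * g (n + r.+1)%N).
  by apply: quad_growth_sum => r; exact: qwg.
rewrite (lmeanB law) //; last first.
  by rewrite E1; apply: quad_growth_sum => i; exact: quad_growthZ.
congr (_ - _); rewrite E1 (lmean_sum law); last by move=> i; exact: quad_growthZ.
apply: eq_bigr => i _; rewrite (lmeanZ law) //; congr (_ * _).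
by rewrite (lmean_sum law) // => r; exact: qwg.
Qed.

End normalized.

(** * Gaussian tails *)

Section real_derivatives.
Context {R : realType}.
Implicit Types (f g : R -> R) (x a b c : R).

(* Unlike [is_derive], not a class, so that [apply:] leaves it as a subgoal. *)
Definition deriv_at f x a := is_derive x 1 f a.

Lemma deriv_at_eq f x a b : deriv_at f x a -> a = b -> deriv_at f x b.
Proof. by move=> + <-. Qed.

Lemma deriv_atM f g x a b : deriv_at f x a -> deriv_at g x b ->
  deriv_at (fun t => f t * g t) x (a * g x + f x * b).
Proof.
move=> fa gb; apply: (@deriv_at_eq (f * g) _ _ _ (is_deriveM fa gb)).
by rewrite addrC /GRing.scale /= [g x * a]mulrC.
Qed.

Lemma deriv_atD f g x a b : deriv_at f x a -> deriv_at g x b ->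
  deriv_at (fun t => f t + g t) x (a + b).
Proof. exact: is_deriveD. Qed.

Lemma deriv_atN f x a : deriv_at f x a -> deriv_at (fun t => - f t) x (- a).
Proof. exact: is_deriveN. Qed.

Lemma deriv_atB f g x a b : deriv_at f x a -> deriv_at g x b ->
  deriv_at (fun t => f t - g t) x (a - b).
Proof. exact: is_deriveB. Qed.

Lemma deriv_atV f x a : f x != 0 -> deriv_at f x a ->
  deriv_at (fun t => (f t)^-1) x (- a / f x ^+ 2).
Proof.
move=> fx fa; apply: deriv_at_eq (is_deriveV fx fa) _.
by rewrite /GRing.scale /= mulNr mulrC mulNr.
Qed.

Lemma deriv_at_comp f g x a b : deriv_at f (g x) a -> deriv_at g x b ->
  deriv_at (fun t => f (g t)) x (a * b).
Proof. exact: is_derive1_comp. Qed.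

Lemma deriv_at_var x : deriv_at (fun t : R => t) x 1.
Proof. exact: is_derive_id. Qed.

Lemma deriv_at_const x c : deriv_at (fun=> c) x (0 : R).
Proof. exact: is_derive_cst. Qed.

Lemma derive_segment_continuous f (df : R -> R) a b :
  (forall x, a <= x <= b -> deriv_at f x (df x)) ->
  {within `[a, b], continuous f}.
Proof.
move=> fd; apply: derivable_within_continuous => x.
by rewrite in_itv /= => /fd [].
Qed.

Lemma slope_exists f (df : R -> R) a b : a <= b ->
  (forall x, a <= x <= b -> deriv_at f x (df x)) ->
  exists2 c, a <= c <= b & f b - f a = df c * (b - a).
Proof.
move=> ab fd.
have [|c] := @MVT_segment R f df a b ab _ (derive_segment_continuous fd).
  by move=> x; rewrite in_itv /= => /andP[/ltW ax /ltW xb]; apply: fd; rewrite ax.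
by rewrite in_itv /=; exists c.
Qed.

Lemma slope_le f (df : R -> R) a b c : a <= b ->
  (forall x, a <= x <= b -> deriv_at f x (df x)) ->
  (forall x, a <= x <= b -> df x <= c) -> f b - f a <= c * (b - a).
Proof.
move=> ab fd dc; have [t tab ->] := slope_exists ab fd.
by rewrite ler_wpM2r ?subr_ge0 // dc.
Qed.

Lemma slope_ge f (df : R -> R) a b c : a <= b ->
  (forall x, a <= x <= b -> deriv_at f x (df x)) ->
  (forall x, a <= x <= b -> c <= df x) -> c * (b - a) <= f b - f a.
Proof.
move=> ab fd dc; have [t tab ->] := slope_exists ab fd.
by rewrite ler_wpM2r ?subr_ge0 // dc.
Qed.

Lemma derive_ge0_le f (df : R -> R) a b : a <= b ->
  (forall x, a <= x <= b -> deriv_at f x (df x)) ->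
  (forall x, a <= x <= b -> 0 <= df x) -> f a <= f b.
Proof.
by move=> ab fd /(slope_ge ab fd); rewrite mul0r subr_ge0.
Qed.

End real_derivatives.

Section gaussian.
Context {R : realType}.
Implicit Types x y z : R.

Definition phi (y : R) : R := normal_pdf 0 1 y.

Let phiE y : phi y = normal_peak 1 * expR (- y ^+ 2 / 2).
Proof.
by rewrite /phi normal_pdfE ?oner_neq0 // /normal_fun subr0 expr1n.
Qed.

Lemma phi_gt0 y : 0 < phi y.
Proof. by rewrite phiE mulr_gt0 ?expR_gt0 ?normal_peak_gt0 ?oner_neq0. Qed.

Lemma phi_le1 y : phi y <= 1.
Proof.
have s1 : 1 <= Num.sqrt (1 ^+ 2 * pi *+ 2 : R).
  rewrite -[leLHS]sqrtr1 ler_sqrt ?mulrn_wge0 ?mulr_ge0 ?pi_ge0 //.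
  by have := @pi_ge2 R; rewrite expr1n mul1r; lra.
rewrite (le_trans (normal_pdf_ub _ _ (oner_neq0 _))) // /normal_peak.
by rewrite invf_le1 // (lt_le_trans _ s1).
Qed.

Lemma phiN y : phi (- y) = phi y.
Proof. by rewrite !phiE sqrrN. Qed.

Lemma is_derive_phi y : deriv_at phi y (- y * phi y).
Proof.
rewrite (_ : phi = fun t => normal_peak 1 * expR (- (t * t) / 2)); last first.
  by apply/funext => t; rewrite phiE expr2.
have h : deriv_at (fun t => - (t * t) / 2) y (- y).
  apply: deriv_at_eq.
    apply: deriv_atM; last exact: deriv_at_const.
    by apply: deriv_atN; apply: deriv_atM; exact: deriv_at_var.
  by rewrite /=; field.
apply: deriv_at_eq.
  apply: deriv_atM; first exact: deriv_at_const.
  exact: (deriv_at_comp (is_derive_expR _) h).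
by rewrite mul0r add0r /=; ring.
Qed.

Lemma phi_ratio x y : phi x = phi y * expR ((y ^+ 2 - x ^+ 2) / 2).
Proof.
rewrite !phiE -mulrA -expRD; by congr (_ * expR _); field.
Qed.

Let int_phi : lebesgue_measure.-integrable [set: R] (EFin \o phi).
Proof. exact: integrable_normal_pdf. Qed.

Lemma is_derive_Psi y : deriv_at Psi y (phi y).
Proof.
have y1 : y < y + 1 by rewrite ltrDl.
have i1 : lebesgue_measure.-integrable `]-oo, y + 1] (EFin \o phi).
  exact: integrableS int_phi.
have c1 : {for y, continuous phi} by apply: continuous_normal_pdf; rewrite oner_neq0.
have [df dE] := @continuous_FTC1 R phi -oo%O y (y + 1) y1 i1 (ltNyr _) c1.
apply: DeriveDef; first exact: df.
by rewrite -derive1E; exact: dE.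
Qed.

Lemma Psi_ge0 y : 0 <= Psi y.
Proof. by rewrite fine_ge0 // measure_ge0. Qed.

Lemma Psi_le1 y : Psi y <= 1.
Proof.
rewrite -lee_fin fineK ?probability_le1 //.
exact: fin_num_measure.
Qed.

(** The identity as a random variable under the normal law: the limits of its cdf are those of
    [Psi]. *)
Let idTR : measurableTypeR R -> R := idfun.

#[local] HB.instance Definition _ :=
  @isMeasurableFun.Build _ _ _ _ idTR (@measurable_id _ _ setT).

Let idRV := idTR : {RV normal_prob (0 : R) 1 >-> R}.

Let cdf_Psi y : cdf idRV y = (Psi y)%:E.
Proof. by rewrite /Psi fineK // fin_num_measure. Qed.

Lemma Psi_cvgNy0 : Psi x @[x --> -oo] --> (0 : R).
Proof.
have := cvg_cdfNy0 idRV.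
by rewrite (_ : cdf idRV = EFin \o Psi) ?funeqE // => /fine_cvg.
Qed.

Lemma Psi_cvgy1 : Psi x @[x --> +oo] --> (1 : R).
Proof.
have := cvg_cdfy1 idRV.
by rewrite (_ : cdf idRV = EFin \o Psi) ?funeqE // => /fine_cvg.
Qed.

Lemma Psi_small (e : R) : 0 < e -> exists A, forall x, x <= A -> Psi x <= e.
Proof.
move=> e0; have := Psi_cvgNy0 => /cvgrPdist_le /(_ _ e0) [A [_ HA]].
exists (A - 1) => x xA; have : x < A by lra.
by move=> /HA; rewrite sub0r normrN ger0_norm ?Psi_ge0.
Qed.

Lemma Psi_big (e : R) : 0 < e -> exists A, forall x, A <= x -> 1 - e <= Psi x.
Proof.
move=> e0; have := Psi_cvgy1 => /cvgrPdist_le /(_ _ e0) [A [_ HA]].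
exists (A + 1) => x xA; have : A < x by lra.
by move=> /HA; rewrite ler_norml => /andP[_]; lra.
Qed.

(** [Psi t + Psi (- t)] has derivative 0, hence is constant, and it tends to 1 at infinity. *)
Lemma PsiN y : Psi (- y) = 1 - Psi y.
Proof.
have cst x x' : Psi x + Psi (- x) = Psi x' + Psi (- x').
  apply: (@is_derive_0_is_cst R (fun t => Psi t + Psi (- t))) => t.
  apply: deriv_at_eq.
    apply: deriv_atD; first exact: is_derive_Psi.
    apply: (@deriv_at_comp R Psi (fun t => - t)); first exact: is_derive_Psi.
    by apply: deriv_atN; exact: deriv_at_var.
  by rewrite phiN; ring.
suff : `|Psi y + Psi (- y) - 1| <= 0.
  by rewrite normr_le0 subr_eq0 => /eqP <-; ring.
apply/ler_addgt0Pr => e e0; rewrite add0r.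
have [A HA] := Psi_small e0; have [B HB] := Psi_big e0.
pose x := Num.max B (- A).
have xB : B <= x by rewrite le_max lexx.
have xA : - x <= A by rewrite lerNl le_max lexx orbT.
rewrite (cst y x) ler_norml.
have := HB _ xB; have := HA _ xA; have := Psi_ge0 (- x); have := Psi_le1 x.
by move=> *; apply/andP; split; lra.
Qed.

(** [phi t / (- t) - Psi t] has the nonnegative derivative [phi t / t ^+ 2], and far to the left it
    is at least [- e]. *)
Lemma Psi_ltN y : y < 0 -> Psi y <= phi y / (- y).
Proof.
move=> y0; apply/ler_addgt0Pr => e e0; have [A HA] := Psi_small e0.
pose x := Num.min A y; have xy : x <= y by rewrite ge_min lexx orbT.
have := @derive_ge0_le R (fun t => phi t * (- t)^-1 - Psi t)
  (fun t => phi t / t ^+ 2) x y xy.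
have xA : x <= A by rewrite ge_min lexx.
have : 0 <= phi x * (- x)^-1.
  by rewrite mulr_ge0 ?invr_ge0 ?(ltW (phi_gt0 _)) // oppr_ge0 (le_trans xy) // ltW.
have := HA _ xA; move=> h1 h2 h3.
suff : phi x / - x - Psi x <= phi y / - y - Psi y by lra.
apply: h3 => t /andP[_ ty].
  have t0 : t < 0 by exact: le_lt_trans y0.
  apply: deriv_at_eq.
    apply: deriv_atB; last exact: is_derive_Psi.
    apply: deriv_atM; first exact: is_derive_phi.
    apply: deriv_atV; first by rewrite oppr_eq0 lt_eqF.
    by apply: deriv_atN; exact: deriv_at_var.
  by rewrite /=; field; rewrite lt_eqF.
by rewrite divr_ge0 ?sqr_ge0 // ltW // phi_gt0.
Qed.

(** [Psi t + t phi t / (1 + t^2)] vanishes at minus infinity and has derivative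
    [2 phi t / (1 + t^2)^2]. The inequality amounts to the convexity of [mills]. *)
Lemma Psi_lower y : - y * phi y <= (1 + y ^+ 2) * Psi y.
Proof.
have den t : 0 < 1 + t * t :> R by rewrite -expr2 ltr_wpDr ?sqr_ge0.
suff : - (y * phi y / (1 + y * y)) <= Psi y.
  rewrite -mulNr -mulNr ler_pdivrMr //.
  by rewrite expr2 [_ * Psi y]mulrC.
apply/ler_addgt0Pr => e e0.
(* Far enough to the left for [x <= -1] and [e * - x >= 1], which bound [x phi x / (1 + x^2)] below
   by [- e]. *)
pose x := Num.min y (- Num.max 1 (e^-1)).
have xy : x <= y by rewrite ge_min lexx.
have M1 : 1 <= Num.max 1 (e^-1) by rewrite le_max lexx.
have xM : x <= - Num.max 1 (e^-1) by rewrite ge_min lexx orbT.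
have x1 : x <= -1 by apply: le_trans xM _; rewrite lerN2.
have xe : 1 <= e * - x.
  rewrite -ler_pdivrMl // mulr1 lerNr (le_trans xM) // lerN2.
  by rewrite le_max lexx orbT.
have := @derive_ge0_le R (fun t => Psi t + t * phi t * (1 + t * t)^-1)
  (fun t => 2 * phi t / (1 + t * t) ^+ 2) x y xy.
have lb : - e <= x * phi x / (1 + x * x).
  rewrite ler_pdivlMr //.
  have p1 := phi_le1 x; have p0 := phi_gt0 x.
  have : 0 <= (- x) * (1 - phi x) by rewrite mulr_ge0 //; lra.
  have : 0 <= (- x) * (e * - x - 1) by rewrite mulr_ge0 //; lra.
  by lra.
move=> h3; suff : Psi x + x * phi x / (1 + x * x) <= Psi y + y * phi y / (1 + y * y).
  have := Psi_ge0 x; lra.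
apply: h3 => t _.
  apply: deriv_at_eq.
    apply: deriv_atD; first exact: is_derive_Psi.
    apply: deriv_atM.
      by apply: deriv_atM; [exact: deriv_at_var|exact: is_derive_phi].
    apply: deriv_atV; first by rewrite gt_eqF.
    apply: deriv_atD; first exact: deriv_at_const.
    by apply: deriv_atM; exact: deriv_at_var.
  by rewrite /=; field; rewrite gt_eqF.
by rewrite divr_ge0 ?sqr_ge0 // mulr_ge0 // ltW // phi_gt0.
Qed.

(* Mills ratio of the left tail. *)
Definition mills y := Psi y / phi y.


Let phi_neq0 y : phi y != 0. Proof. by rewrite gt_eqF // phi_gt0. Qed.

Lemma mills_ge0 y : 0 <= mills y.
Proof. by rewrite divr_ge0 ?Psi_ge0 // ltW // phi_gt0. Qed.

Lemma is_derive_mills y : deriv_at mills y (1 + y * mills y).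
Proof.
apply: deriv_at_eq.
  apply: deriv_atM; first exact: is_derive_Psi.
  by apply: deriv_atV => //; exact: is_derive_phi.
by rewrite /mills /=; field.
Qed.

Lemma mills_leN y : y < 0 -> mills y <= (- y)^-1.
Proof.
by move=> /Psi_ltN; rewrite /mills ler_pdivrMr ?phi_gt0 // mulrC.
Qed.

Lemma mills_deriv_ge0 y : 0 <= 1 + y * mills y.
Proof.
have [y0|y0] := leP 0 y; first by rewrite addr_ge0 // mulr_ge0 ?mills_ge0.
have := mills_leN y0; rewrite -(ler_pM2l (x := - y)) ?oppr_gt0 //.
by rewrite divff ?oppr_eq0 ?lt_eqF //; lra.
Qed.

(** The expression is at once the second derivative of [mills] and the first derivative of
    [y * mills y]. *)
Lemma mills_deriv2_ge0 y : 0 <= y + (1 + y ^+ 2) * mills y.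
Proof.
have := Psi_lower y; rewrite -(ler_pM2r (x := (phi y)^-1)) ?invr_gt0 ?phi_gt0 //.
by rewrite mulfK // -mulrA -/(mills y); lra.
Qed.

Lemma mills_mono x y : x <= y -> mills x <= mills y.
Proof.
move=> xy; apply: (@derive_ge0_le _ _ (fun t => 1 + t * mills t)) => // t _.
  exact: is_derive_mills.
exact: mills_deriv_ge0.
Qed.

Lemma is_derive_Mmills y :
  deriv_at (fun t => t * mills t) y (y + (1 + y ^+ 2) * mills y).
Proof.
apply: deriv_at_eq.
  by apply: deriv_atM; [exact: deriv_at_var|exact: is_derive_mills].
by rewrite /=; ring.
Qed.

Lemma Mmills_mono x y : x <= y -> x * mills x <= y * mills y.
Proof.
move=> xy; apply: (@derive_ge0_le _ (fun t => t * mills t)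
  (fun t => t + (1 + t ^+ 2) * mills t)) => // t _.
  exact: is_derive_Mmills.
exact: mills_deriv2_ge0.
Qed.

End gaussian.

(** * The uniform bound *)

Section stein_function.
Context {R : realType}.
Variable z : R.
Implicit Types x y : R.

(* Bounded solution of f' y - y * f y = (y <= z) - Psi z. *)
Definition stein_sol y : R :=
  if y <= z then Psi (- z) * mills y else Psi z * mills (- y).
(** The derivative of the solution is this nondecreasing term plus the nonincreasing
    [(y <= z) - Psi z]. Its values fill at most an interval of length [Psi z + Psi (- z)], that is
    1. *)
Definition stein_drift y := y * stein_sol y.

Let PsiNz : Psi (- z) = 1 - Psi z. Proof. exact: PsiN. Qed.

Lemma stein_solE_ge y : z <= y -> stein_sol y = Psi z * mills (- y).
Proof.
move=> zy; rewrite /stein_sol; case: ifP => // yz.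
have -> : y = z by apply/eqP; rewrite eq_le yz.
by rewrite /mills phiN; ring.
Qed.

Lemma stein_sol_ge0 y : 0 <= stein_sol y.
Proof. by rewrite /stein_sol; case: ifP => _; rewrite mulr_ge0 ?Psi_ge0 ?mills_ge0. Qed.

Lemma stein_sol_incr x y : x <= y -> y <= z -> stein_sol x <= stein_sol y.
Proof.
move=> xy yz; rewrite /stein_sol yz (le_trans xy yz).
by rewrite ler_wpM2l ?Psi_ge0 // mills_mono.
Qed.

Lemma stein_sol_decr x y : z <= x -> x <= y -> stein_sol y <= stein_sol x.
Proof.
move=> zx xy; rewrite !stein_solE_ge // ?(le_trans zx) //.
by rewrite ler_wpM2l ?Psi_ge0 // mills_mono // lerN2.
Qed.

Lemma stein_sol_max y : stein_sol y <= stein_sol z.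
Proof.
by have [yz|/ltW zy] := leP y z; [exact: stein_sol_incr|exact: stein_sol_decr].
Qed.

(** On each side of [z] this is the monotonicity of [y * mills y], reflected on the right, and the
    two branches agree at [z]. *)
Lemma stein_drift_mono x y : x <= y -> stein_drift x <= stein_drift y.
Proof.
have low u v : u <= v -> v <= z -> stein_drift u <= stein_drift v.
  move=> uv vz; rewrite /stein_drift /stein_sol vz (le_trans uv vz).
  by rewrite mulrCA [leRHS]mulrCA ler_wpM2l ?Psi_ge0 // Mmills_mono.
have high u v : z <= u -> u <= v -> stein_drift u <= stein_drift v.
  move=> zu uv; rewrite /stein_drift !stein_solE_ge // ?(le_trans zu) //.
  rewrite mulrCA [leRHS]mulrCA ler_wpM2l ?Psi_ge0 //.
  by have := @Mmills_mono R (- v) (- u); rewrite lerN2 !mulNr lerN2 => ->.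
move=> xy; have [yz|/ltW zy] := leP y z; first exact: low.
have [xz|/ltW zx] := leP x z; last exact: high.
by apply: (@le_trans _ _ (stein_drift z)); [exact: low|exact: high].
Qed.

Lemma stein_drift_ge y : - Psi (- z) <= stein_drift y.
Proof.
have low u : u <= z -> - Psi (- z) <= stein_drift u.
  move=> uz; rewrite /stein_drift /stein_sol uz mulrCA -subr_ge0.
  rewrite (_ : _ - _ = Psi (- z) * (1 + u * mills u)); last by ring.
  by rewrite mulr_ge0 ?Psi_ge0 ?mills_deriv_ge0.
have [/low//|/ltW zy] := leP y z.
exact: le_trans (low z (lexx _)) (stein_drift_mono zy).
Qed.

Lemma stein_drift_le y : stein_drift y <= Psi z.
Proof.
have high u : z <= u -> stein_drift u <= Psi z.
  move=> zu; rewrite /stein_drift stein_solE_ge // -subr_ge0.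
  rewrite (_ : _ - _ = Psi z * (1 + (- u) * mills (- u))); last by ring.
  by rewrite mulr_ge0 ?Psi_ge0 ?mills_deriv_ge0.
have [yz|/ltW/high//] := leP y z.
exact: le_trans (stein_drift_mono yz) (high z (lexx _)).
Qed.

Lemma stein_sol_slope_low x y : x <= y -> y <= z ->
  exists2 c, x <= c <= y &
    stein_sol y - stein_sol x = (stein_drift c + 1 - Psi z) * (y - x).
Proof.
move=> xy yz.
have [|c cxy E] := @slope_exists R (fun t => Psi (- z) * mills t)
   (fun t => 0 * mills t + Psi (- z) * (1 + t * mills t)) x y xy.
  move=> t _; apply: deriv_atM; [exact: deriv_at_const|exact: is_derive_mills].
exists c => //; have /andP[_ cy] := cxy.
rewrite /stein_drift /stein_sol yz (le_trans xy yz) (le_trans cy yz) E PsiNz; ring.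
Qed.

Lemma stein_sol_slope_high x y : z <= x -> x <= y ->
  exists2 c, x <= c <= y &
    stein_sol y - stein_sol x = (stein_drift c - Psi z) * (y - x).
Proof.
move=> zx xy.
have [|c cxy E] := @slope_exists R (fun t => Psi z * mills (- t))
   (fun t => 0 * mills (- t) + Psi z * ((1 + (- t) * mills (- t)) * -1)) x y xy.
  move=> t _; apply: deriv_atM; first exact: deriv_at_const.
  apply: (@deriv_at_comp R mills); first exact: is_derive_mills.
  by apply: deriv_atN; exact: deriv_at_var.
exists c => //; have /andP[xc _] := cxy.
rewrite /stein_drift !stein_solE_ge ?(le_trans zx) // E; ring.
Qed.

(** The derivative over [[x, y]] is bounded by its increasing part at [y] and its decreasing part at
    [x]. The interval is split at [z], where the solution has a kink. *)
Lemma stein_sol_slope_le x y : x <= y ->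
  stein_sol y - stein_sol x <= (y - x) * (stein_drift y + (x <= z)%R%:R - Psi z).
Proof.
move=> xy; have [yz|/ltW zy] := leP y z.
  have [c /andP[_ cy] ->] := stein_sol_slope_low xy yz.
  rewrite (le_trans xy yz) /= mulrC ler_wpM2l ?subr_ge0 //.
  by have := stein_drift_mono cy; lra.
have [xz|zx] := leP x z; last first.
  have [c /andP[_ cy] ->] := stein_sol_slope_high (ltW zx) xy.
  rewrite /= mulrC ler_wpM2l ?subr_ge0 //.
  by have := stein_drift_mono cy; lra.
have [c /andP[_ cz] E1] := stein_sol_slope_low xz (lexx z).
have [c' /andP[_ cy] E2] := stein_sol_slope_high (lexx z) zy.
have h1 : 0 <= (z - x) * (stein_drift y - stein_drift c).
  by rewrite mulr_ge0 ?subr_ge0 // stein_drift_mono // (le_trans cz).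
have h2 : 0 <= (y - z) * (1 + stein_drift y - stein_drift c').
  by rewrite mulr_ge0 ?subr_ge0 //; have := stein_drift_mono cy; lra.
by rewrite /=; lra.
Qed.

Lemma stein_sol_slope_ge x y : x <= y ->
  (y - x) * (stein_drift x + (y <= z)%R%:R - Psi z) <= stein_sol y - stein_sol x.
Proof.
move=> xy; have [yz|/ltW zy] := leP y z.
  have [c /andP[xc _] ->] := stein_sol_slope_low xy yz.
  rewrite /= [leRHS]mulrC ler_wpM2l ?subr_ge0 //.
  by have := stein_drift_mono xc; lra.
have [xz|zx] := leP x z; last first.
  have [c /andP[xc _] ->] := stein_sol_slope_high (ltW zx) xy.
  rewrite /= [leRHS]mulrC ler_wpM2l ?subr_ge0 //.
  by have := stein_drift_mono xc; lra.
have [c /andP[xc _] E1] := stein_sol_slope_low xz (lexx z).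
have [c' /andP[zc _] E2] := stein_sol_slope_high (lexx z) zy.
have h1 : 0 <= (z - x) * (stein_drift c + 1 - stein_drift x).
  by rewrite mulr_ge0 ?subr_ge0 //; have := stein_drift_mono xc; lra.
have h2 : 0 <= (y - z) * (stein_drift c' - stein_drift x).
  by rewrite mulr_ge0 ?subr_ge0 // stein_drift_mono // (le_trans xz).
by rewrite /=; lra.
Qed.

End stein_function.

(** * Stein's method for the normalised variable, uniformly in z *)

Section uniform_bound.
Context {R : realType} {I : finType}.
Variables (b : nat -> R) (mu : I -> R) (m : I -> nat) (delta : R).
Hypothesis law : panjer_law b mu m.
Hypothesis delta_gt0 : 0 < delta.
Hypothesis var1 : \sum_i mu i * jump m delta i ^+ 2 = 1.

Local Notation E := (lmean b).
Local Notation Y := (ypos mu m delta).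
Local Notation a := (jump m delta).
Local Notation L := (lyapunov mu m delta).
Local Notation T := (gener mu m delta).
Local Notation A := (jump_avg mu m delta).

Let mu_ge0 i : 0 <= mu i. Proof. by case: law. Qed.
Let m_gt0 i : (0 < m i)%N. Proof. by case: law. Qed.
Let jump_gt0 i : 0 < a i. Proof. by rewrite mulr_gt0 // ltr0n. Qed.

Lemma bounded_comp (f : R -> R) C : (forall y, `|f y| <= C) ->
  bounded_on_nat (fun n => f (Y n)).
Proof. by move=> fC; exists C => n. Qed.

Lemma bounded_bool (P : nat -> bool) : bounded_on_nat (fun n => (P n)%:R : R).
Proof. by exists 1 => n; case: (P n); rewrite ?normr1 ?normr0. Qed.

Lemma jump_avgD (f g : nat -> R) n : A (fun k => f k + g k) n = A f n + A g n.
Proof. exact: age_avgD. Qed.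

Lemma jump_avgB (f g : nat -> R) n : A (fun k => f k - g k) n = A f n - A g n.
Proof. exact: age_avgB. Qed.

Lemma jump_avg_cst c n : A (fun=> c) n = c.
Proof. exact: age_avg_cst. Qed.

Lemma bounded_stein_drift z : bounded_on_nat (fun n => stein_drift z (Y n)).
Proof.
apply: (@bounded_comp _ 1) => y; rewrite ler_norml.
have := stein_drift_ge z y; have := stein_drift_le z y.
by have := Psi_le1 z; have := Psi_le1 (- z); move=> *; apply/andP; split; lra.
Qed.

Lemma bounded_stein_sol z : bounded_on_nat (fun n => stein_sol z (Y n)).
Proof.
apply: (@bounded_comp _ (stein_sol z z)) => y.
by rewrite ger0_norm ?stein_sol_ge0 // stein_sol_max.
Qed.

Lemma ypos_mono j k : (j <= k)%N -> Y j <= Y k.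
Proof.
move=> jk; rewrite -(subnKC jk) ypos_shift lerDl mulr_ge0 // ltW //.
Qed.

(** Zero-bias form of the generator: the mean difference quotient of [f] over a uniform lattice cell
    of a jump chosen with weight [mu i * a i ^+ 2]. The slope bounds then apply cell by cell. *)
Lemma gener_cells (f : nat -> R) n : T f n =
  \sum_i mu i * a i ^+ 2 / (m i)%:R *
    \sum_(0 <= r < m i) (f (n + r.+1)%N - f (n + r)%N) / delta.
Proof.
apply: eq_bigr => i _; rewrite -mulr_suml.
rewrite (@telescope_sumr _ 0 (m i) (fun r => f (n + r)%N)) // addn0.
by rewrite /jump; field; rewrite gt_eqF // pnatr_eq0 -lt0n m_gt0.
Qed.

(** In each cell the drift is taken at the right end, which produces [jump_avg], and the indicator
    is moved back to [Y n]. The lower bound does the opposite. *)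
Lemma gener_stein_le z n :
  T (fun k => stein_sol z (Y k)) n <=
  A (fun k => stein_drift z (Y k)) n + (Y n <= z)%R%:R - Psi z.
Proof.
rewrite -addrA -[X in _ <= _ + X](jump_avg_cst _ n) -jump_avgD gener_cells.
apply: ler_sum => i _; rewrite ler_wpM2l //; first by rewrite divr_ge0 ?mulr_ge0 ?exprn_ge0 // ltW.
apply: ler_sum => r _; rewrite ler_pdivrMr // mulrC.
have le1 : Y (n + r)%N <= Y (n + r.+1)%N by apply: ypos_mono; rewrite addnS leqnSn.
apply: le_trans (stein_sol_slope_le z le1) _.
rewrite !ypos_shift -natr1 (_ : _ - _ = delta) ?ler_pM2l //; last by ring.
rewrite -addrA lerD2l lerD2r ler_nat.
have : Y n <= Y n + delta * r%:R by rewrite lerDl mulr_ge0 // ltW.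
by move=> h3; case: (leP (Y n + delta * r%:R) z) => // h; rewrite (le_trans h3 h).
Qed.

Lemma gener_stein_ge z n :
  stein_drift z (Y n) + A (fun k => (Y k <= z)%R%:R) n - Psi z <=
  T (fun k => stein_sol z (Y k)) n.
Proof.
rewrite addrAC addrC -[X in _ + X <= _](jump_avg_cst _ n) -jump_avgD gener_cells.
apply: ler_sum => i _; rewrite ler_wpM2l //; first by rewrite divr_ge0 ?mulr_ge0 ?exprn_ge0 // ltW.
apply: ler_sum => r _; rewrite ler_pdivlMr // mulrC.
have le1 : Y (n + r)%N <= Y (n + r.+1)%N by apply: ypos_mono; rewrite addnS leqnSn.
apply: le_trans (stein_sol_slope_ge z le1).
rewrite [X in _ <= X * _](_ : _ = delta) ?ler_pM2l //; last first.
  by rewrite !ypos_shift -natr1; ring.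
rewrite addrA [leLHS]addrC -addrA addrCA [leRHS]addrC -!addrA.
have := @stein_drift_mono R z _ _ (ypos_mono (leq_addr r n)); lra.
Qed.

Definition ldist z := E (fun n => (Y n <= z)%R%:R).

(** Drift and generator have the same mean, so in [gener_stein_le] only the gap between the drift
    and its average fails to cancel. *)
Lemma ldist_ge z :
  Psi z - ldist z <= E (fun n => A (fun k => stein_drift z (Y k)) n - stein_drift z (Y n)).
Proof.
have bd := bounded_stein_drift z; have qd := bounded_quad_growth bd.
have qb := bounded_quad_growth (bounded_bool (fun n => Y n <= z)).
have [C HC] := bounded_stein_sol z; have ls := bounded_lin_growth HC.
have qA := quad_growth_jump_avg mu m delta qd.
have qc : quad_growth (fun=> Psi z).
  by apply: bounded_quad_growth; exists `|Psi z| => n.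
have st : E (fun n => stein_drift z (Y n)) = E (T (fun k => stein_sol z (Y k))) :=
  stein_identity delta law ls.
rewrite (lmeanB law) //.
have : E (T (fun k => stein_sol z (Y k))) <=
   E (fun n => A (fun k => stein_drift z (Y k)) n + (Y n <= z)%R%:R - Psi z).
  apply: (ler_lmean law) => //; last by move=> n; exact: gener_stein_le.
    exact/quad_growth_gener/lin_growth_quad.
  by apply: quad_growthB => //; exact: quad_growthD.
rewrite (lmeanB law) // ?(lmeanD law) // ?(lmean_cst law) /ldist; last exact: quad_growthD.
by rewrite st; lra.
Qed.

(** Here the drift cancels and the gap is that of the indicator, written for [z < Y] to have a
    nondecreasing function. *)
Lemma ldist_le z :
  ldist z - Psi z <= E (fun n => A (fun k => (z < Y k)%R%:R) n - (z < Y n)%R%:R).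
Proof.
have bd := bounded_stein_drift z; have qd := bounded_quad_growth bd.
have qb := bounded_quad_growth (bounded_bool (fun n => Y n <= z)).
have [C HC] := bounded_stein_sol z; have ls := bounded_lin_growth HC.
have qA := quad_growth_jump_avg mu m delta qb.
have qc : quad_growth (fun=> Psi z).
  by apply: bounded_quad_growth; exists `|Psi z| => n.
have st : E (fun n => stein_drift z (Y n)) = E (T (fun k => stein_sol z (Y k))) :=
  stein_identity delta law ls.
have -> : (fun n => A (fun k => (z < Y k)%R%:R) n - (z < Y n)%R%:R) =
   fun n => (Y n <= z)%R%:R - A (fun k => (Y k <= z)%R%:R) n.
  apply/funext => n.
  have E1 : (fun k => (z < Y k)%R%:R : R) = fun k => 1 - (Y k <= z)%R%:R.
    by apply/funext => k; rewrite ltNge; case: (Y k <= z); rewrite ?subrr ?subr0.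
  rewrite E1 jump_avgB jump_avg_cst ltNge.
  by case: (Y n <= z) => /=; ring.
rewrite (lmeanB law) //.
have : E (fun n => stein_drift z (Y n) + A (fun k => (Y k <= z)%R%:R) n - Psi z) <=
   E (T (fun k => stein_sol z (Y k))).
  apply: (ler_lmean law) => //; last by move=> n; exact: gener_stein_ge.
    by apply: quad_growthB => //; exact: quad_growthD.
  exact/quad_growth_gener/lin_growth_quad.
rewrite (lmeanB law) // ?(lmeanD law) // ?(lmean_cst law); last exact: quad_growthD.
by rewrite st /ldist; lra.
Qed.

(** Stein identity for [max (y - w) 0], whose increment over a jump is the whole jump when [w < y]
    and nonnegative otherwise. It serves as a linear constraint on the law when E|Y| is bounded. *)
Lemma lmean_pos_part_moment w : quad_growth (fun n => Y n * Num.max (Y n - w) 0) /\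
  E (fun n => (w < Y n)%R%:R) <= E (fun n => Y n * Num.max (Y n - w) 0).
Proof.
have lin : lin_growth (fun n => Num.max (Y n - w) 0).
  have [C HC] := ypos_lin_growth mu m delta.
  exists (C + `|w|) => n.
  have : `|Num.max (Y n - w) 0| <= `|Y n| + `|w|.
    rewrite ger0_norm ?le_max ?lexx ?orbT // ge_max addr_ge0 // andbT.
    by rewrite (le_trans (ler_norm _)) // ler_normB.
  have := HC n; have : 0 <= n%:R * `|w| by rewrite mulr_ge0.
  by lra.
have ql := lin_growth_quad lin.
split; first exact: lin_growthM_ypos.
rewrite (stein_identity delta law lin).
apply: (ler_lmean law) => //; first exact/bounded_quad_growth/bounded_bool.
  exact: quad_growth_gener.
move=> n; case: (ltP w (Y n)) => wY /=; last first.
  apply: sumr_ge0 => i _; apply: mulr_ge0; first by rewrite mulr_ge0 // ltW.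
  rewrite subr_ge0 ypos_shift -/(a i) ge_max !le_max lexx orbT andbT.
  by apply/orP; left; rewrite lerD2r lerDl ltW.
rewrite -var1; apply: ler_sum => i _.
rewrite expr2 mulrA ler_wpM2l //; first by rewrite mulr_ge0 // ltW.
rewrite ypos_shift -/(a i).
have -> : Num.max (Y n - w) 0 = Y n - w by apply: max_l; rewrite subr_ge0 ltW.
have : Y n + a i - w <= Num.max (Y n + a i - w) 0 by rewrite le_max lexx.
by lra.
Qed.

(** Mean 0 and variance 1 alone give E|Y| <= 1. The two subtracted brackets have nonnegative mean by
    [lmean_pos_part_moment], so the expectation of the right side is at most 0.413 + 0.5435. The
    majorant is nearly tight at y = -0.87, 0.54, 0.84 and 1.51. *)
Let abs_majorant (y : R) : `|y| <= 413/1000 - 55/1000 * y + 5435/10000 * (y ^+ 2)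
  - 122/1000 * (y * Num.max (y - 54/100) 0 - (54/100 < y)%R%:R)
  - 1295/10000 * (y * Num.max (y - 84/100) 0 - (84/100 < y)%R%:R).
Proof.
have [y0|y0] := ltP y 0.
  rewrite ltr0_norm // !max_r; [|lra..].
  rewrite ltNge (_ : y <= 54/100) /=; last by lra.
  rewrite ltNge (_ : y <= 84/100) /=; last by lra.
  by have := sqr_ge0 (y + 8694/10000); lra.
rewrite ger0_norm //; have [y1|y1] := leP y (54/100).
  rewrite !max_r; [|lra..].
  rewrite ltNge (_ : y <= 84/100) /=; last by lra.
  by have := sqr_ge0 (y - 54/100); lra.
rewrite (max_l (x := y - 54/100)); last by lra.
have [y2|y2] := leP y (84/100).
  rewrite max_r /=; last by lra.
  by have := sqr_ge0 (y - 84/100); lra.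
rewrite max_l /=; last by lra.
by have := sqr_ge0 (y - 1507/1000); have := sqr_ge0 (y - 1508/1000); lra.
Qed.

Lemma quad_growth_norm_ypos : quad_growth (fun n => `|Y n|).
Proof.
apply: lin_growth_quad; have [C HC] := ypos_lin_growth mu m delta.
by exists C => n; rewrite normr_id.
Qed.

Lemma quad_growth_ypos2 : quad_growth (fun n => Y n ^+ 2).
Proof.
rewrite (_ : (fun n => _) = fun n => Y n * Y n) //.
by apply: lin_growthM_ypos; exact: ypos_lin_growth.
Qed.

Lemma lmean_norm_ypos : E (fun n => `|Y n|) <= 957 / 1000.
Proof.
have [q1 h1] := lmean_pos_part_moment (54/100).
have [q2 h2] := lmean_pos_part_moment (84/100).
have qb w := bounded_quad_growth (bounded_bool (fun n => w < Y n)).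
have qY := lin_growth_quad (ypos_lin_growth mu m delta).
have qY2 := quad_growth_ypos2.
have qc : quad_growth (fun _ : nat => 413/1000 : R).
  by apply: bounded_quad_growth; exists `|413/1000| => n.
have Q1 := quad_growthB q1 (qb (54/100)).
have Q2 := quad_growthB q2 (qb (84/100)).
apply: le_trans (ler_lmean law quad_growth_norm_ypos _ (fun n => abs_majorant (Y n))) _.
  by repeat first [assumption | apply: quad_growthB | apply: quad_growthD | apply: quad_growthZ].
rewrite (lmeanB law); [|by repeat first [assumption | apply: quad_growthB | apply: quad_growthD | apply: quad_growthZ]..].
rewrite (lmeanB law); [|by repeat first [assumption | apply: quad_growthB | apply: quad_growthD | apply: quad_growthZ]..].
rewrite (lmeanD law); [|by repeat first [assumption | apply: quad_growthB | apply: quad_growthD | apply: quad_growthZ]..].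
rewrite (lmeanB law); [|by repeat first [assumption | apply: quad_growthB | apply: quad_growthD | apply: quad_growthZ]..].
rewrite (lmean_cst law) !(lmeanZ law) // (lmean_ypos delta law) (lmean_ypos2 law var1).
rewrite !(lmeanB law) //; lra.
Qed.

(** As [Y] has mean 0, its positive part has half the mean of [|Y|]: this is the origin of
    0.4785. *)
Lemma lmean_ypos_pos : E (fun n => Num.max (Y n) 0) <= 4785 / 10000.
Proof.
have -> : (fun n => Num.max (Y n) 0) = fun n => (1/2) * (`|Y n| + Y n).
  apply/funext => n; have [y0|y0] := leP 0 (Y n).
    by rewrite ger0_norm //; lra.
  by rewrite ltr0_norm //; lra.
have qY := lin_growth_quad (ypos_lin_growth mu m delta).
have qn := quad_growth_norm_ypos.
have qs : quad_growth (fun n => `|Y n| + Y n) by exact: quad_growthD.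
rewrite (lmeanZ law _ qs) (lmeanD law qn qY) (lmean_ypos delta law).
by have := lmean_norm_ypos; lra.
Qed.

(** Take weight 1 in [lmean_jump_avg_le]: as [g - c] lies in [0, 1], also after a shift,
    E[Y (g - c)] is at most E[max(Y, 0)]. *)
Lemma jump_avg_excess_le (g : nat -> R) (c : R) :
  {homo g : j k / (j <= k)%N >-> j <= k} -> (forall n, c <= g n <= c + 1) ->
  E (fun n => A g n - g n) <= 4785 / 10000 * L.
Proof.
move=> gm gc.
have bg : bounded_on_nat (fun n => g n - c).
  exists 1 => n; have /andP[h1 h2] := gc n.
  by rewrite ger0_norm; lra.
have := @lmean_jump_avg_le R I b mu m delta law delta_gt0 var1 (fun=> 1)
  (fun n => g n - c) (4785/10000) _ bg.
rewrite (_ : (fun n => 1 * _) = fun n => A g n - g n); last first.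
  by apply/funext => n; rewrite jump_avgB jump_avg_cst; ring.
apply => //.
- by move=> j k /gm; rewrite lerD2r.
- by exists 1 => n; rewrite normr1.
- by move=> n h k; rewrite subrr mul0r.
move=> k; apply: le_trans lmean_ypos_pos.
have qY := lin_growth_quad (ypos_lin_growth mu m delta).
have [C HC] := bg.
apply: (ler_lmean law).
- by apply: lin_growthM_ypos; apply: (@bounded_lin_growth _ _ C) => n; rewrite mul1r.
- have qn := quad_growth_norm_ypos.
  rewrite (_ : (fun n => _) = fun n => (1/2) * (`|Y n| + Y n)).
    by apply: quad_growthZ; exact: quad_growthD.
  apply/funext => n; have [y0|y0] := leP 0 (Y n).
    by rewrite ger0_norm //; lra.
  by rewrite ltr0_norm //; lra.
move=> n; rewrite mul1r; have /andP[h1 h2] := gc (n + k)%N.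
have [y0|y0] := leP 0 (Y n); first by rewrite ler_piMr //; lra.
by rewrite nmulr_rle0 //; lra.
Qed.

Lemma uniform_berry_esseen z : `|ldist z - Psi z| <= 4785 / 10000 * L.
Proof.
rewrite ler_norml; apply/andP; split.
  rewrite lerNl opprB; apply: le_trans (ldist_ge z) _.
  apply: (@jump_avg_excess_le _ (- Psi (- z))).
    by move=> j k /ypos_mono jk; exact: stein_drift_mono.
  move=> n; rewrite stein_drift_ge; have := stein_drift_le z (Y n).
  by rewrite PsiN; lra.
apply: le_trans (ldist_le z) _.
apply: (@jump_avg_excess_le _ 0).
  move=> j k /ypos_mono jk; rewrite ler_nat.
  by case: (ltP z (Y j)) => // h; rewrite (lt_le_trans h jk).
by move=> n; rewrite add0r; case: (z < Y n); rewrite ?lexx ?ler01.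
Qed.

End uniform_bound.

(** * The non-uniform bound *)

Section tails.
Context {R : realType} {I : finType}.
Variables (b : nat -> R) (mu : I -> R) (m : I -> nat) (delta : R).
Hypothesis law : panjer_law b mu m.
Hypothesis delta_gt0 : 0 < delta.
Hypothesis var1 : \sum_i mu i * jump m delta i ^+ 2 = 1.

Local Notation E := (lmean b).
Local Notation Y := (ypos mu m delta).
Local Notation a := (jump m delta).
Local Notation L := (lyapunov mu m delta).
Local Notation T := (gener mu m delta).
Local Notation A := (jump_avg mu m delta).

Let mu_ge0 i : 0 <= mu i. Proof. by case: law. Qed.
Let m_gt0 i : (0 < m i)%N. Proof. by case: law. Qed.
Let jump_gt0 i : 0 < a i. Proof. by rewrite mulr_gt0 // ltr0n. Qed.

Lemma bounded_onX (f : nat -> R) k : bounded_on_nat f -> bounded_on_nat (fun n => f n ^+ k).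
Proof.
move=> [C HC]; exists (C ^+ k) => n.
by rewrite normrX lerXn2r ?nnegrE // (le_trans (normr_ge0 _) (HC n)).
Qed.

Lemma bounded_onN (f : nat -> R) : bounded_on_nat f -> bounded_on_nat (fun n => - f n).
Proof. by move=> [C HC]; exists C => n; rewrite normrN. Qed.

Lemma bounded_lin (f : nat -> R) : bounded_on_nat f -> lin_growth f.
Proof. by move=> [C]; exact: bounded_lin_growth. Qed.

(** An increment linear in the jump costs [c], by unit variance; a quadratic one costs [d * L]. *)
Lemma gener_le (f : nat -> R) n c d :
  (forall i, f (n + m i)%N - f n <= c * a i + d * a i ^+ 2) ->
  T f n <= c + d * L.
Proof.
move=> fc; rewrite -[c]mulr1 -var1 /lyapunov !mulr_sumr -big_split /=.
apply: ler_sum => i _.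
have := ler_wpM2l (mulr_ge0 (mu_ge0 i) (ltW (jump_gt0 i))) (fc i).
move=> /le_trans; apply; rewrite le_eqVlt; apply/orP; left; apply/eqP; ring.
Qed.

(** With N the negative part of Y, E[N^4] = E[Y (- N^3)] is at most 3 E[Y^2] = 3 by the Stein
    identity. Jumps go up and only shrink N, so no term in [L] appears. Markov's inequality with
    fourth powers concludes. *)
Lemma left_tail u : 0 < u -> E (fun n => - Y n * (Y n <= - u)%R%:R) <= 3 / u ^+ 3.
Proof.
move=> u0; pose N n := Num.max (- Y n) 0.
have N0 n : 0 <= N n by rewrite le_max lexx orbT.
(* The lattice starts at 0, so [Y] is bounded below. *)
have bN : bounded_on_nat N.
  exists (N 0%N) => n; rewrite ger0_norm // /N ge_max !le_max lexx orbT andbT.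
  by rewrite lerN2 (ypos_mono mu m delta_gt0).
have E4 : E (fun n => N n ^+ 4) <= 3.
  have -> : (fun n => N n ^+ 4) = fun n => Y n * (- N n ^+ 3).
    apply/funext => n; rewrite /N; have [y0|y0] := leP (- Y n) 0; last by ring.
    by rewrite !expr0n /= oppr0 mulr0.
  have b3 := bounded_onN (bounded_onX 3 bN).
  rewrite (stein_identity delta law (bounded_lin b3)).
  have <- : E (fun n => 3 * Y n ^+ 2) = 3.
    by rewrite (lmeanZ law) ?(lmean_ypos2 law var1) ?mulr1 //; exact: quad_growth_ypos2.
  apply: (ler_lmean law); first exact/quad_growth_gener/bounded_quad_growth.
    by apply: quad_growthZ; exact: quad_growth_ypos2.
  move=> n; rewrite -[leRHS]addr0 -(mul0r L); apply: gener_le => i.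
  have : N (n + m i)%N <= N n.
    rewrite /N ge_max !le_max lexx orbT andbT lerN2.
    by rewrite (ypos_mono mu m delta_gt0) // leq_addr.
  have : N n - a i <= N (n + m i)%N.
    rewrite /N lerBlDr ge_max ypos_shift -/(a i); apply/andP; split.
      by rewrite -lerBlDr le_max; apply/orP; left; lra.
    by rewrite addr_ge0 ?le_max ?lexx ?orbT ?ltW.
  have : N n ^+ 2 <= Y n ^+ 2.
    rewrite /N; have [y0|y0] := leP (- Y n) 0; last by rewrite sqrrN.
    by rewrite expr0n sqr_ge0.
  have := N0 n; have := N0 (n + m i)%N; have a0 := jump_gt0 i.
  move: (N n) (N (n + m i)%N) => x x' x'0 x0 xY h1 h2.
  have : x ^+ 3 - x' ^+ 3 <= 3 * x ^+ 2 * a i.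
    have -> : x ^+ 3 - x' ^+ 3 = (x - x') * (x ^+ 2 + x * x' + x' ^+ 2) by ring.
    rewrite mulrC ler_pM ?subr_ge0 ?addr_ge0 ?mulr_ge0 ?exprn_ge0 //; last by lra.
    have : x * x' <= x * x by rewrite ler_wpM2l.
    have : x' * x' <= x * x by rewrite ler_pM.
    by lra.
  have : 3 * x ^+ 2 * a i <= 3 * Y n ^+ 2 * a i by apply: ler_wpM2r; [exact: ltW|rewrite ler_pM2l].
  by lra.
rewrite ler_pdivlMr ?exprn_gt0 // mulrC.
have bI := bounded_bool (fun n => Y n <= - u).
have q1 : quad_growth (fun n => - Y n * (Y n <= - u)%R%:R).
  rewrite (_ : (fun n => _) = fun n => Y n * (- (Y n <= - u)%R%:R)).
    by apply: lin_growthM_ypos; exact/bounded_lin/bounded_onN.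
  by apply/funext => n; ring.
rewrite -(lmeanZ law) //; apply: le_trans E4.
apply: (ler_lmean law); first exact: quad_growthZ.
  exact/bounded_quad_growth/bounded_onX.
move=> n; case: (leP (Y n) (- u)) => /= h; last by rewrite !mulr0 exprn_ge0.
have -> : N n = - Y n by apply: max_l; lra.
rewrite mulr1 [leRHS]exprSr ler_wpM2r; [by []|by lra|].
by rewrite lerXn2r ?nnegrE; lra.
Qed.

Lemma clip_bounds (y h u : R) : 0 <= h -> 0 <= u ->
  let c t := Num.min (Num.max t 0) u in
  [/\ 0 <= c y, c y <= c (y + h), c (y + h) <= u & c (y + h) <= c y + h].
Proof.
move=> h0 u0; rewrite /=; split.
- by rewrite le_min le_max lexx orbT.
- by rewrite le_min !ge_min lexx orbT andbT ge_max !le_max lexx !orbT andbT lerDl h0.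
- by rewrite ge_min lexx orbT.
rewrite -lerBlDr le_min !lerBlDr; apply/andP; split; rewrite ge_min; apply/orP.
  left; rewrite ge_max lerD2r le_max lexx /=.
  by rewrite addr_ge0 // le_max lexx orbT.
by right; rewrite lerDl.
Qed.

(** Fourth powers again, but jumps now enlarge the positive part. Clipping it at [u] keeps the test
    functions bounded and leaves only third moments of the jumps, at the cost [6 u^2 L]. E[Y c^2] <=
    2 E[max(Y, 0)] + L controls E[c^3], which enters E[Y c^4] <= 4 E[c^3] + 6 u^2 L. *)
Lemma right_tail u : 0 < u -> E (fun n => Y n * (u < Y n)%R%:R) <=
  (4 * (957 / 1000 + L) + 6 * u ^+ 2 * L) / u ^+ 4.
Proof.
move=> u0; pose c n := Num.min (Num.max (Y n) 0) u.
have c0 n : 0 <= c n by have [] := clip_bounds (Y n) (lexx 0) (ltW u0).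
have cu n : c n <= u by rewrite ge_min lexx orbT.
have bc : bounded_on_nat c by exists u => n; rewrite ger0_norm.
have qYc k : quad_growth (fun n => Y n * c n ^+ k).
  by apply: lin_growthM_ypos; exact/bounded_lin/bounded_onX.
have qc k := bounded_quad_growth (bounded_onX k bc).
have cs n i : [/\ c n <= c (n + m i)%N & c (n + m i)%N <= c n + a i].
  rewrite /c ypos_shift -/(a i).
  by have [] := clip_bounds (Y n) (ltW (jump_gt0 i)) (ltW u0).
have qpos : quad_growth (fun n => Num.max (Y n) 0).
  have qY := lin_growth_quad (ypos_lin_growth mu m delta).
  have qn := quad_growth_norm_ypos mu m delta.
  rewrite (_ : (fun n => _) = fun n => (1/2) * (`|Y n| + Y n)).
    by apply: quad_growthZ; exact: quad_growthD.
  apply/funext => n; have [y0|y0] := leP 0 (Y n).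
    by rewrite ger0_norm //; lra.
  by rewrite ltr0_norm //; lra.
have H2 : E (fun n => Y n * c n ^+ 2) <= 957 / 1000 + L.
  rewrite (stein_identity delta law (bounded_lin (bounded_onX 2 bc))).
  have : E (fun n => 2 * Num.max (Y n) 0 + L) <= 957 / 1000 + L.
    rewrite (lmeanD law) ?(lmeanZ law) ?(lmean_cst law) //; last 2 first.
    - exact: quad_growthZ.
    - by apply: bounded_quad_growth; exists `|L| => n.
    by have := lmean_ypos_pos law delta_gt0 var1; lra.
  apply: le_trans; apply: (ler_lmean law).
  - exact: quad_growth_gener.
  - apply: quad_growthD; first exact: quad_growthZ.
    by apply: bounded_quad_growth; exists `|L| => n.
  move=> n; rewrite -[X in _ + X]mul1r.
  apply: (@le_trans _ _ (2 * c n + 1 * L)); last first.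
    by rewrite lerD2r ler_pM2l // /c ge_min lexx.
  apply: gener_le => i; have [h1 h2] := cs n i; have := c0 n; have := jump_gt0 i.
  move: (c n) (c (n + m i)%N) h1 h2 => x x' h1 h2 a0 x0.
  have : (x' - x) * (x' + x) <= a i * (2 * x + a i) by apply: ler_pM; lra.
  by lra.
have H3 : E (fun n => c n ^+ 3) <= E (fun n => Y n * c n ^+ 2).
  apply: (ler_lmean law) => // n; rewrite exprS.
  have [y0|y0] := leP (Y n) 0.
    by rewrite /c (max_r y0) (min_l (ltW u0)) expr0n /= !mulr0.
  by rewrite ler_wpM2r ?sqr_ge0 // /c ge_min ge_max lexx (ltW y0).
have H4 : E (fun n => Y n * c n ^+ 4) <= 4 * E (fun n => c n ^+ 3) + 6 * u ^+ 2 * L.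
  rewrite (stein_identity delta law (bounded_lin (bounded_onX 4 bc))).
  rewrite -(lmeanZ law) // -[X in _ + X](lmean_cst law) -(lmeanD law); last 2 first.
  - exact: quad_growthZ.
  - by apply: bounded_quad_growth; exists `|6 * u ^+ 2 * L| => n.
  apply: (ler_lmean law).
  - exact: quad_growth_gener.
  - apply: quad_growthD; first exact: quad_growthZ.
    by apply: bounded_quad_growth; exists `|6 * u ^+ 2 * L| => n.
  move=> n; apply: gener_le => i.
  have [h1 h2] := cs n i; have := c0 n; have := jump_gt0 i; have := cu (n + m i)%N.
  move: (c n) (c (n + m i)%N) h1 h2 => x x' h1 h2 x'u a0 x0.
  pose h := x' - x.
  have h0 : 0 <= h by rewrite subr_ge0.
  have ha : h <= a i by rewrite /h; lra.
  have e1 : x' ^+ 4 - x ^+ 4 = 4 * x ^+ 3 * h + h ^+ 2 * (6 * x ^+ 2 + 4 * x * h + h ^+ 2).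
    by rewrite /h; ring.
  have e2 : 4 * x ^+ 3 * h <= 4 * x ^+ 3 * a i.
    by rewrite ler_wpM2l // mulr_ge0 // exprn_ge0.
  have e3 : 6 * x ^+ 2 + 4 * x * h + h ^+ 2 <= 6 * u ^+ 2.
    have : (x + h) ^+ 2 <= u ^+ 2.
      by apply: (lerXn2r 2); rewrite ?nnegrE /h; lra.
    have : 0 <= x * h by rewrite mulr_ge0.
    by have := sqr_ge0 h; lra.
  have e4 : h ^+ 2 * (6 * x ^+ 2 + 4 * x * h + h ^+ 2) <= a i ^+ 2 * (6 * u ^+ 2).
    rewrite ler_pM ?sqr_ge0 //.
      by rewrite !addr_ge0 ?mulr_ge0 ?sqr_ge0.
    by rewrite lerXn2r ?nnegrE // ltW.
  by rewrite e1; lra.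
rewrite ler_pdivlMr ?exprn_gt0 // mulrC.
have q1 : quad_growth (fun n => Y n * (u < Y n)%R%:R).
  by apply: lin_growthM_ypos; exact/bounded_lin/bounded_bool.
rewrite -(lmeanZ law) //.
apply: (@le_trans _ _ (E (fun n => Y n * c n ^+ 4))); last by lra.
apply: (ler_lmean law) => //; first exact: quad_growthZ.
move=> n; case: (ltP u (Y n)) => h /=; last first.
  rewrite !mulr0; have [y0|y0] := leP (Y n) 0; last by rewrite mulr_ge0 ?exprn_ge0 // ltW.
  by rewrite /c (max_r y0) (min_l (ltW u0)) expr0n /= mulr0.
by rewrite /c max_l ?min_r ?(ltW h) //; [lra|lra].
Qed.

(** A part of a jump is at most the whole jump, whose mean under the weights [mu i * a i ^+ 2] is
    [L]. *)
Lemma jump_avg_lip_le (h : nat -> R) n (K : R) :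
  0 <= K -> (forall r, h (n + r)%N - h n <= K * (delta * r%:R)) ->
  A h n - h n <= K * L.
Proof.
move=> K0 hK; rewrite -[X in _ - X](jump_avg_cst law var1 _ n) -jump_avgB.
rewrite /lyapunov mulr_sumr; apply: ler_sum => i _.
have -> : K * (mu i * a i ^+ 3) =
  mu i * a i ^+ 2 / (m i)%:R * \sum_(0 <= r < m i) K * a i.
  by rewrite sumr_const_nat subn0 -mulr_natr; field; rewrite pnatr_eq0 -lt0n m_gt0.
rewrite ler_wpM2l //; first by rewrite divr_ge0 ?mulr_ge0 ?exprn_ge0 // ltW.
rewrite big_nat [leRHS]big_nat; apply: ler_sum => r /= rm.
apply: le_trans (hK r.+1) _; rewrite ler_wpM2l // /jump ler_pM2l //.
by rewrite ler_nat.
Qed.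

(** [g - c] lies in [-1, 0] and vanishes above [- u], also after a shift to the right, so only the
    left tail enters E[Y (g - c)]. *)
Lemma jump_avg_left_le (g : nat -> R) (c u : R) : 0 < u ->
  {homo g : j k / (j <= k)%N >-> j <= k} -> (forall n, c - 1 <= g n <= c) ->
  (forall n, - u < Y n -> g n = c) ->
  E (fun n => A g n - g n) <= 3 / u ^+ 3 * L.
Proof.
move=> u0 gm gc gu.
have bg : bounded_on_nat (fun n => g n - c).
  exists 1 => n; have /andP[h1 h2] := gc n.
  by rewrite ler0_norm; lra.
have := @lmean_jump_avg_le R I b mu m delta law delta_gt0 var1 (fun=> 1)
  (fun n => g n - c) (3 / u ^+ 3) _ bg.
rewrite (_ : (fun n => 1 * _) = fun n => A g n - g n); last first.
  by apply/funext => n; rewrite jump_avgB (jump_avg_cst law var1); ring.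
apply => //.
- by move=> j k /gm; rewrite lerD2r.
- by exists 1 => n; rewrite normr1.
- by move=> n h k; rewrite subrr mul0r.
move=> k; apply: le_trans (left_tail u0).
apply: (ler_lmean law).
- apply: lin_growthM_ypos; have [C HC] := bg.
  by apply: (@bounded_lin_growth _ _ C) => n; rewrite mul1r.
- rewrite (_ : (fun n => _) = fun n => Y n * (- (Y n <= - u)%R%:R)).
    by apply: lin_growthM_ypos; exact/bounded_lin/bounded_onN/bounded_bool.
  by apply/funext => n; ring.
move=> n; rewrite mul1r; have /andP[h1 h2] := gc (n + k)%N.
case: (leP (Y n) (- u)) => /= yu.
  rewrite mulr1 -subr_ge0 (_ : _ - _ = - Y n * (1 + (g (n + k)%N - c))); last by ring.
  by apply: mulr_ge0; lra.
rewrite mulr0 gu ?subrr ?mulr0 //; apply: lt_le_trans yu _.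
by rewrite (ypos_mono mu m delta_gt0) // leq_addr.
Qed.

(** The weight [u < Y] is nondecreasing and [g - c] nonnegative, which is the sign condition of
    [lmean_jump_avg_le]; only the right tail enters. *)
Lemma jump_avg_right_le (g : nat -> R) (c u : R) : 0 < u ->
  {homo g : j k / (j <= k)%N >-> j <= k} -> (forall n, c <= g n <= c + 1) ->
  E (fun n => (u < Y n)%R%:R * (A g n - g n)) <=
  (4 * (957 / 1000 + L) + 6 * u ^+ 2 * L) / u ^+ 4 * L.
Proof.
move=> u0 gm gc.
have bg : bounded_on_nat (fun n => g n - c).
  exists 1 => n; have /andP[h1 h2] := gc n.
  by rewrite ger0_norm; lra.
have bI := bounded_bool (fun n => u < Y n).
have := @lmean_jump_avg_le R I b mu m delta law delta_gt0 var1
  (fun n => (u < Y n)%R%:R) (fun n => g n - c)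
  ((4 * (957 / 1000 + L) + 6 * u ^+ 2 * L) / u ^+ 4) _ bg.
rewrite (_ : (fun n => _ * (A (fun k => g k - c) n - _)) =
  fun n => (u < Y n)%R%:R * (A g n - g n)); last first.
  by apply/funext => n; rewrite jump_avgB (jump_avg_cst law var1); ring.
apply => //.
- by move=> j k /gm; rewrite lerD2r.
- move=> n h k; rewrite mulr_ge0 //; last by have := gc (n + h + k)%N; lra.
  rewrite subr_ge0 ler_nat; case: (ltP u (Y n)) => // un.
  by rewrite (lt_le_trans un) // (ypos_mono mu m delta_gt0) // leq_addr.
move=> k; apply: le_trans (right_tail u0).
apply: (ler_lmean law).
- by apply: lin_growthM_ypos; apply/bounded_lin/bounded_onM => //; exact: (bounded_on_shift k bg).
- by apply: lin_growthM_ypos; exact: bounded_lin.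
move=> n; case: (ltP u (Y n)) => /= uY; last by rewrite !mul0r mulr0.
by rewrite mul1r; apply: ler_wpM2l; have := gc (n + k)%N; lra.
Qed.

End tails.

(** * Explicit exponential and Gaussian estimates *)

Section gaussian_bounds.
Context {R : realType}.
Implicit Types u v x y z : R.

(** Repeated squaring of [1 + 1/8 <= expR (1/8)], rounded down at each stage. *)
Lemma expR1_ge : 5 / 2 <= expR 1 :> R.
Proof.
have -> : expR 1 = expR (8^-1) ^+ 8 :> R by rewrite -expRM_natl divff.
have h1 : 9 / 8 <= expR 8^-1 :> R by apply: le_trans (expR_ge1Dx _); lra.
have h2 : 1265 / 1000 <= expR 8^-1 ^+ 2 :> R by have := ler_pM _ _ h1 h1; lra.
have h4 : 8 / 5 <= expR 8^-1 ^+ 2 * expR 8^-1 ^+ 2 :> R by have := ler_pM _ _ h2 h2; lra.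
by have := ler_pM _ _ h4 h4; lra.
Qed.

Lemma expR_ge_linear x : 0 <= x -> 5 / 2 * x <= expR x.
Proof.
move=> x0; have -> : expR x = expR 1 * expR (x - 1) by rewrite -expRD; congr expR; ring.
by apply: ler_pM => //; [exact: expR1_ge|have := expR_ge1Dx (x - 1); lra].
Qed.

(** Trades the exponential factors below for powers; [x + x] lets the exponential split into two
    factors, each at least [5 / 2 * x]. *)
Lemma expRN_sqr_le x : 0 < x -> expR (- (x + x)) * (25 / 4 * x ^+ 2) <= 1.
Proof.
move=> x0; rewrite expRN mulrC ler_pdivrMr ?expR_gt0 // mul1r expRD.
rewrite (_ : _ * _ = 5 / 2 * x * (5 / 2 * x)); last by field.
have h := expR_ge_linear (ltW x0).
by apply: ler_pM => //; rewrite mulr_ge0 // ltW.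
Qed.

Lemma Psi_tail_le u v : 0 < v -> Psi (- v) <= phi u * expR ((u ^+ 2 - v ^+ 2) / 2) / v.
Proof.
move=> v0; have := @Psi_ltN R (- v); rewrite oppr_lt0 opprK phiN => /(_ v0).
by rewrite (phi_ratio v u).
Qed.

(** For [u <= v] the left side is the value at [u] of the Stein solution for [z = v], exponentially
    small when [u] is a fixed fraction of [v]. *)
Lemma Psi_tail_mills_le u v : 0 < v ->
  Psi (- v) * mills u <= expR ((u ^+ 2 - v ^+ 2) / 2) / v.
Proof.
move=> v0; apply: le_trans (ler_wpM2r (mills_ge0 u) (Psi_tail_le u v0)) _.
rewrite (_ : phi u * _ / v * mills u = expR ((u ^+ 2 - v ^+ 2) / 2) / v * Psi u); last first.
  by rewrite /mills; field; rewrite !gt_eqF ?phi_gt0.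
by rewrite ler_piMr ?Psi_le1 // divr_ge0 ?expR_ge0 // ltW.
Qed.

Lemma Psi_tail_le1 u v : 0 < v -> Psi (- v) <= expR ((u ^+ 2 - v ^+ 2) / 2) / v.
Proof.
move=> v0; apply: le_trans (Psi_tail_le u v0) _.
rewrite ler_wpM2r ?invr_ge0 ?(ltW v0) // ler_piMl ?expR_ge0 //.
exact: phi_le1.
Qed.

(** For [s <= -1] the left side is at most 1 by the tail bound on [mills]; otherwise
    [s ^+ 2 <= u ^+ 2], and the terms compare one by one. *)
Lemma mills_deriv2_le s u : s <= u -> 1 <= u ->
  s + (1 + s ^+ 2) * mills s <= u + (1 + u ^+ 2) * mills u.
Proof.
move=> su u1; have Msu := mills_mono su; have Ms0 := mills_ge0 s.
have u2 : 1 <= u ^+ 2 by rewrite expr_ge1 // ltW // (lt_le_trans ltr01).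
have [s1|s1] := leP s (-1).
  have s0 : s < 0 by lra.
  have : (- s) * mills s <= 1.
    rewrite -[leRHS](@divff _ (- s)) ?oppr_eq0 ?lt_eqF // ler_pM2l ?oppr_gt0 //.
    exact: mills_leN.
  have : 0 <= (1 + u ^+ 2) * mills u by rewrite mulr_ge0 ?mills_ge0 //; lra.
  have : mills s <= 1.
    by apply: le_trans (mills_leN s0) _; rewrite invf_le1; lra.
  move=> h1 h2 h3; have : (- s) * ((- s) * mills s) <= (- s) * 1 by rewrite ler_wpM2l //; lra.
  by lra.
have s2 : s ^+ 2 <= u ^+ 2.
  have : 0 <= (u - s) * (u + s) by apply: mulr_ge0; lra.
  by lra.
by apply: lerD => //; apply: ler_pM => //; [have := sqr_ge0 s; lra|lra].
Qed.

(** Derivative at [u] of the drift for [z = v], on its left branch; when [1 <= u <= v] it is a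
    Lipschitz constant of the drift on everything below [u]. *)
Definition drift_slope v u : R := Psi (- v) * (u + (1 + u ^+ 2) * mills u).

Lemma drift_slope_ge0 v u : 0 <= drift_slope v u.
Proof. by rewrite mulr_ge0 ?Psi_ge0 ?mills_deriv2_ge0. Qed.

Lemma drift_slope_le v u : 0 < v -> 0 <= u ->
  drift_slope v u <= (1 + u + u ^+ 2) * expR ((u ^+ 2 - v ^+ 2) / 2) / v.
Proof.
move=> v0 u0.
have h1 := ler_wpM2r u0 (Psi_tail_le1 u v0).
have h2 := ler_wpM2r (addr_ge0 ler01 (sqr_ge0 u)) (Psi_tail_mills_le u v0).
by rewrite /drift_slope; lra.
Qed.

Lemma stein_drift_lip_low z u x y : 1 <= u -> u <= z -> x <= y -> y <= u ->
  stein_drift z y - stein_drift z x <= drift_slope z u * (y - x).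
Proof.
move=> u1 uz xy yu.
rewrite /stein_drift /stein_sol (le_trans yu uz) (le_trans xy (le_trans yu uz)).
rewrite mulrCA [x * _]mulrCA -mulrBr /drift_slope -mulrA ler_wpM2l ?Psi_ge0 //.
apply: (@slope_le R (fun t => t * mills t) (fun t => t + (1 + t ^+ 2) * mills t)) => //.
  by move=> t _; exact: is_derive_Mmills.
by move=> t /andP[_ ty]; apply: mills_deriv2_le => //; exact: le_trans yu.
Qed.

Lemma stein_drift_lip_high v u x y : 1 <= u -> u <= v -> - u <= x -> x <= y ->
  stein_drift (- v) y - stein_drift (- v) x <= drift_slope v u * (y - x).
Proof.
move=> u1 uv ux xy.
have vx : - v <= x by lra.
rewrite /stein_drift !stein_solE_ge // ?(le_trans vx) //.
rewrite mulrCA [x * _]mulrCA -mulrBr /drift_slope -mulrA ler_wpM2l ?Psi_ge0 //.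
rewrite (_ : _ - _ = (- x) * mills (- x) - (- y) * mills (- y)); last by ring.
rewrite (_ : y - x = - x - - y); last by ring.
apply: (@slope_le R (fun t => t * mills t) (fun t => t + (1 + t ^+ 2) * mills t)).
- by rewrite lerN2.
- by move=> t _; exact: is_derive_Mmills.
by move=> t /andP[_ ty]; apply: mills_deriv2_le => //; lra.
Qed.

End gaussian_bounds.

(** * Stein's method at large |z| *)

Section nonuniform_bound.
Context {R : realType} {I : finType}.
Variables (b : nat -> R) (mu : I -> R) (m : I -> nat) (delta : R).
Hypothesis law : panjer_law b mu m.
Hypothesis delta_gt0 : 0 < delta.
Hypothesis var1 : \sum_i mu i * jump m delta i ^+ 2 = 1.

Local Notation E := (lmean b).
Local Notation Y := (ypos mu m delta).
Local Notation a := (jump m delta).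
Local Notation L := (lyapunov mu m delta).
Local Notation T := (gener mu m delta).
Local Notation A := (jump_avg mu m delta).
Local Notation F := (ldist b mu m delta).

Let mu_ge0 i : 0 <= mu i. Proof. by case: law. Qed.
Let m_gt0 i : (0 < m i)%N. Proof. by case: law. Qed.
Let jump_gt0 i : 0 < a i. Proof. by rewrite mulr_gt0 // ltr0n. Qed.
Let L_ge0 : 0 <= L. Proof. exact: (lyapunov_ge0 law delta_gt0). Qed.

Lemma left_le v : 0 < v -> F (- v) - Psi (- v) <= 3 / v ^+ 3 * L.
Proof.
move=> v0; apply: le_trans (ldist_le law delta_gt0 var1 _) _.
apply: (jump_avg_left_le law delta_gt0 var1 (c := 1) v0).
- move=> j k /(ypos_mono mu m delta_gt0) jk; rewrite ler_nat.
  by case: (ltP (- v) (Y j)) => // h; rewrite (lt_le_trans h jk).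
- by move=> n; rewrite subrr; case: (- v < Y n); rewrite ?lexx ?ler01.
by move=> n ->.
Qed.

(** The drift is cut at its value [k0] at [- u]. The lower part varies only in the left tail, and
    the upper part has the exponentially small Lipschitz constant [drift_slope v u]. *)
Lemma left_ge v u : 1 <= u -> u <= v ->
  Psi (- v) - F (- v) <= (3 / u ^+ 3 + drift_slope v u) * L.
Proof.
move=> u1 uv; have u0 : 0 < u by lra.
apply: le_trans (ldist_ge law delta_gt0 var1 _) _.
pose g n := stein_drift (- v) (Y n).
pose k0 := stein_drift (- v) (- u).
pose g1 n := Num.min (g n) k0; pose g2 n := Num.max (g n) k0.
have gm : {homo g : j k / (j <= k)%N >-> j <= k}.
  by move=> j k /(ypos_mono mu m delta_gt0); exact: stein_drift_mono.
have gE n : g n = g1 n + g2 n - k0.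
  by rewrite /g1 /g2; have [h|h] := leP (g n) k0; ring.
have rng y y' : stein_drift (- v) y <= stein_drift (- v) y' + 1.
  have := stein_drift_ge (- v) y'; have := stein_drift_le (- v) y.
  by rewrite (PsiN (- v)); lra.
have bg : bounded_on_nat g by exact: bounded_stein_drift.
have bg1 : bounded_on_nat g1.
  exists (`|k0| + 1) => n; have := rng (Y n) (- u); have := rng (- u) (Y n).
  rewrite -/(g n) -/k0 /g1 => h1 h2; have := ler_norm k0; have := ler_norm (- k0).
  by rewrite normrN ler_norml; have [h|h] := leP (g n) k0 => h3 h4; apply/andP; split; lra.
have bg2 : bounded_on_nat g2.
  exists (`|k0| + 1) => n; have := rng (Y n) (- u); have := rng (- u) (Y n).
  rewrite -/(g n) -/k0 /g2 => h1 h2; have := ler_norm k0; have := ler_norm (- k0).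
  by rewrite normrN ler_norml; have [h|h] := leP (g n) k0 => h3 h4; apply/andP; split; lra.
have qd (h : nat -> R) : bounded_on_nat h -> quad_growth (fun n => A h n - h n).
  by move=> /bounded_quad_growth qh; apply: quad_growthB => //; exact: quad_growth_jump_avg.
have -> : (fun n => A g n - g n) = fun n => (A g1 n - g1 n) + (A g2 n - g2 n).
  apply/funext => n; rewrite gE.
  rewrite (_ : g = fun n => g1 n + g2 n - k0); last by apply/funext.
  by rewrite jump_avgB jump_avgD (jump_avg_cst law var1); ring.
rewrite (lmeanD law); [|exact: qd..].
rewrite [leRHS]mulrDl.
apply: lerD.
  apply: (jump_avg_left_le law delta_gt0 var1 (c := k0) u0).
  - move=> j k /gm gjk; rewrite /g1 le_min !ge_min lexx orbT andbT.
    by apply/orP; left.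
  - move=> n; rewrite /g1 ge_min lexx orbT andbT le_min.
    by have := rng (- u) (Y n); rewrite -/(g n) -/k0 => h; apply/andP; split; lra.
  - by move=> n un; apply: min_r; apply: stein_drift_mono; exact: ltW.
rewrite -[leRHS](lmean_cst law); apply: (ler_lmean law).
- exact: qd.
- by apply: bounded_quad_growth; exists `|drift_slope v u * L| => n.
move=> n; apply: (@jump_avg_lip_le _ _ b mu m delta law delta_gt0 var1 g2 n _ (drift_slope_ge0 v u)) => r.
have s0 := drift_slope_ge0 v u.
have yy : Y n <= Y (n + r) by rewrite (ypos_mono mu m delta_gt0) // leq_addr.
have -> : delta * r%:R = Y (n + r) - Y n by rewrite ypos_shift; ring.
rewrite /g2 /g; have [h1|/ltW h1] := leP (Y (n + r)) (- u).
  have h2 := le_trans yy h1.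
  rewrite !max_r ?stein_drift_mono // subrr mulr_ge0 // subr_ge0 //.
rewrite [X in X - _]max_l ?stein_drift_mono //.
have [h2|/ltW h2] := leP (Y n) (- u).
  rewrite max_r ?stein_drift_mono //.
  have := stein_drift_lip_high u1 uv (lexx (- u)) h1 => h3.
  apply: le_trans h3 _; rewrite ler_wpM2l //; lra.
rewrite max_l ?stein_drift_mono //.
exact: stein_drift_lip_high.
Qed.

Lemma gener_ge (f : nat -> R) n c d :
  (forall i, c * a i + d * a i ^+ 2 <= f (n + m i)%N - f n) ->
  c + d * L <= T f n.
Proof.
move=> fc; rewrite -[c]mulr1 -var1 /lyapunov !mulr_sumr -big_split /=.
apply: ler_sum => i _.
have := ler_wpM2l (mulr_ge0 (mu_ge0 i) (ltW (jump_gt0 i))) (fc i).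
apply: le_trans; rewrite le_eqVlt; apply/orP; left; apply/eqP; ring.
Qed.

(** [D] differs from the indicator by a term of mean zero, and unlike the indicator it can be
    compared with [Psi z] pointwise, by separate arguments for [u < Y] and [Y <= u]. *)
Let stein_error z :
  let D n := (Y n <= z)%R%:R + stein_drift z (Y n) - T (fun k => stein_sol z (Y k)) n in
  quad_growth D /\ E D = F z.
Proof.
have qd := bounded_quad_growth (bounded_stein_drift mu m delta z).
have qb := bounded_quad_growth (bounded_bool (fun n => Y n <= z)) (R := R).
have ls := bounded_lin (bounded_stein_sol mu m delta z).
have qs := lin_growth_quad ls.
have qT := quad_growth_gener mu m delta qs.
have qD := quad_growthD qb qd.
split; first exact: quad_growthB.
rewrite (lmeanB law) // (lmeanD law) // /ldist.
have st : E (fun n => stein_drift z (Y n)) = E (T (fun k => stein_sol z (Y k))) :=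
  stein_identity delta law ls.
by rewrite st addrK.
Qed.

Let right_tail_const u := (4 * (957 / 1000 + L) + 6 * u ^+ 2 * L) / u ^+ 4.

(** Above [u], the gap of the indicator is bounded through the right tail. From below [u], a jump
    that stays below [v] is handled by the mean value theorem, and a jump across [v] exceeds
    [v - u], so that what it costs is absorbed in [e * a i ^+ 2]. *)
Lemma right_le v u : 0 < u -> u < v ->
  F v - Psi v <=
  (right_tail_const u +
   (Psi (- v) * (1 + u * mills u) + Psi (- v) * mills u / (v - u)) / (v - u)) * L.
Proof.
move=> u0 uv; have [qD <-] := stein_error v.
set D := (D in E D); set e := (X in (_ + X) * L).
have vu : 0 < v - u by rewrite subr_gt0.
have fu : Psi (- v) * mills u = stein_sol v u by rewrite /stein_sol ltW.
have f'u : Psi (- v) * (1 + u * mills u) = stein_drift v u + Psi (- v).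
  by rewrite /stein_drift -fu; ring.
have f'0 y : 0 <= stein_drift v y + Psi (- v) by have := stein_drift_ge v y; lra.
have e0 : 0 <= e.
  rewrite /e fu f'u divr_ge0 ?(ltW vu) // addr_ge0 // divr_ge0 ?(ltW vu) //.
  exact: stein_sol_ge0.
have bi := bounded_bool (fun n => v < Y n) (R := R).
have qw : quad_growth (fun n => (u < Y n)%R%:R * (A (fun k => (v < Y k)%R%:R) n - (v < Y n)%R%:R)).
  rewrite (_ : (fun n => _) = fun n =>
     (u < Y n)%R%:R * A (fun k => (v < Y k)%R%:R) n - (u < Y n)%R%:R * (v < Y n)%R%:R).
    apply: quad_growthB; last exact/bounded_quad_growth/bounded_onM/bi/bounded_bool.
    have [C HC] := quad_growth_jump_avg mu m delta (bounded_quad_growth bi).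
    exists C => n; apply: le_trans (HC n); rewrite normrM ler_piMl //.
    by case: (u < Y n); rewrite ?normr1 ?normr0.
  by apply/funext => n; ring.
have qc c : quad_growth (fun _ : nat => c : R).
  by apply: bounded_quad_growth; exists `|c| => n.
rewrite lerBlDr.
have key : E D <= E (fun n => (u < Y n)%R%:R * (A (fun k => (v < Y k)%R%:R) n - (v < Y n)%R%:R) + (Psi v + e * L)).
  apply: (ler_lmean law) => //; first exact: quad_growthD.
  move=> n; rewrite /D; case: (ltP u (Y n)) => yu /=.
    have := gener_stein_ge law delta_gt0 var1 v n.
    have -> : A (fun k => (v < Y k)%R%:R) n = 1 - A (fun k => (Y k <= v)%R%:R) n.
      rewrite -[X in X - _](jump_avg_cst law var1 _ n) -jump_avgB; congr (A _ n).
      by apply/funext => k; rewrite ltNge; case: (Y k <= v); rewrite /= ?subrr ?subr0.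
    have -> : (v < Y n)%R%:R = 1 - (Y n <= v)%R%:R :> R.
      by rewrite ltNge; case: (Y n <= v); rewrite /= ?subrr ?subr0.
    have : 0 <= e * L by rewrite mulr_ge0.
    by lra.
  have yv : Y n <= v by lra.
  rewrite yv /= mul0r add0r.
  have : (stein_drift v (Y n) + Psi (- v)) + (- e) * L <= T (fun k => stein_sol v (Y k)) n.
    apply: gener_ge => i; rewrite ypos_shift -/(a i).
    have a0 := jump_gt0 i.
    have ea0 : 0 <= e * a i ^+ 2 by rewrite mulr_ge0 ?sqr_ge0.
    have [h|h] := leP (Y n + a i) v.
      have yya : Y n <= Y n + a i by lra.
      have [c /andP[yc _] ->] := stein_sol_slope_low yya h.
      have -> : Y n + a i - Y n = a i by ring.
      have : 0 <= (stein_drift v c - stein_drift v (Y n)) * a i.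
        by rewrite mulr_ge0 ?subr_ge0 ?stein_drift_mono // ltW.
      by rewrite PsiN; lra.
    have av : v - u <= a i by lra.
    have := stein_sol_ge0 v (Y n + a i).
    have := stein_sol_incr yu (ltW uv).
    have : (stein_drift v (Y n) + Psi (- v)) * a i <= (stein_drift v u + Psi (- v)) * a i.
      by rewrite ler_wpM2r ?(ltW a0) // lerD2r stein_drift_mono.
    have : e * (v - u) * a i <= e * a i ^+ 2.
      by rewrite -mulrA ler_wpM2l // expr2 ler_wpM2r // ltW.
    rewrite {1}/e divfK ?gt_eqF // fu f'u mulrDl.
    have : stein_sol v u <= stein_sol v u / (v - u) * a i.
      rewrite mulrAC -mulrA ler_peMr ?stein_sol_ge0 //.
      by rewrite ler_pdivlMr // mul1r.
    by lra.
  by rewrite PsiN; lra.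
apply: le_trans key _.
rewrite (lmeanD law) // (lmean_cst law) mulrDl.
have := @jump_avg_right_le R I b mu m delta law delta_gt0 var1
  (fun k => (v < Y k)%R%:R) 0 u u0.
rewrite -/(right_tail_const u) => /(_ _ _); set lhs := E _; move=> h.
suff : lhs <= right_tail_const u * L by lra.
apply: h.
  move=> j k /(ypos_mono mu m delta_gt0) jk; rewrite ler_nat.
  by case: (ltP v (Y j)) => // h; rewrite (lt_le_trans h jk).
by move=> n; rewrite add0r; case: (v < Y n); rewrite ?lexx ?ler01.
Qed.

(** As for [right_le], with a second cut [u']: from below [u], a jump of length at most [u' - u]
    stays where the drift is [drift_slope v u']-Lipschitz, and a longer one costs at most the
    maximum [stein_sol v v]. *)
Lemma right_ge v u u' : 0 < u -> u < u' -> u' <= v -> 1 <= u' ->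
  Psi v - F v <= (right_tail_const u +
     Num.max (drift_slope v u') (stein_sol v v / (u' - u) ^+ 2)) * L.
Proof.
move=> u0 uu' u'v u'1; have [qD <-] := stein_error v.
set D := (D in E D); set e := (X in (_ + X) * L).
have e1 : drift_slope v u' <= e by rewrite le_max lexx.
have e2 : stein_sol v v / (u' - u) ^+ 2 <= e by rewrite le_max lexx orbT.
have d0 : 0 < u' - u by rewrite subr_gt0.
have e0 : 0 <= e by apply: le_trans e1; exact: drift_slope_ge0.
have bi : bounded_on_nat (fun n => stein_drift v (Y n)) by exact: bounded_stein_drift.
have qw : quad_growth (fun n => (u < Y n)%R%:R *
    (A (fun k => stein_drift v (Y k)) n - stein_drift v (Y n))).
  rewrite (_ : (fun n => _) = fun n => (u < Y n)%R%:R * A (fun k => stein_drift v (Y k)) n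
      - (u < Y n)%R%:R * stein_drift v (Y n)).
    apply: quad_growthB; last exact/bounded_quad_growth/bounded_onM/bi/bounded_bool.
    have [C HC] := quad_growth_jump_avg mu m delta (bounded_quad_growth bi).
    exists C => n; apply: le_trans (HC n); rewrite normrM ler_piMl //.
    by case: (u < Y n); rewrite ?normr1 ?normr0.
  by apply/funext => n; ring.
have qc c : quad_growth (fun _ : nat => c : R).
  by apply: bounded_quad_growth; exists `|c| => n.
have key : E (fun n => Psi v - D n) <= E (fun n => (u < Y n)%R%:R *
    (A (fun k => stein_drift v (Y k)) n - stein_drift v (Y n)) + e * L).
  apply: (ler_lmean law) => //; [exact: quad_growthB|exact: quad_growthD|].
  move=> n; rewrite /D; case: (ltP u (Y n)) => yu /=.
    have := gener_stein_le law delta_gt0 var1 v n.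
    have : 0 <= e * L by rewrite mulr_ge0.
    by lra.
  have yv : Y n <= v by lra.
  rewrite yv /= mul0r add0r.
  have : T (fun k => stein_sol v (Y k)) n <= (stein_drift v (Y n) + Psi (- v)) + e * L.
    apply: (gener_le law delta_gt0 var1) => i; rewrite ypos_shift -/(a i).
    have a0 := jump_gt0 i.
    have [h|h] := leP (a i) (u' - u).
      have yya : Y n <= Y n + a i by lra.
      have yav : Y n + a i <= v by lra.
      have [c /andP[yc cy] ->] := stein_sol_slope_low yya yav.
      have -> : Y n + a i - Y n = a i by ring.
      have cu' : c <= u' by lra.
      have lip := stein_drift_lip_low u'1 u'v yc cu'.
      have : drift_slope v u' * (c - Y n) <= e * a i.
        by apply: ler_pM => //; [exact: drift_slope_ge0|lra|lra].
      move=> h2; have : 0 <= (e * a i - (stein_drift v c - stein_drift v (Y n))) * a i.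
        by apply: mulr_ge0; [lra|exact: ltW].
      by rewrite PsiN; lra.
    have : 0 <= (stein_drift v (Y n) + Psi (- v)) * a i.
      by rewrite mulr_ge0 ?(ltW a0) //; have := stein_drift_ge v (Y n); lra.
    have : stein_sol v v <= e * a i ^+ 2.
      apply: (@le_trans _ _ (stein_sol v v / (u' - u) ^+ 2 * a i ^+ 2)); last first.
        by rewrite ler_wpM2r ?sqr_ge0.
      rewrite mulrAC -mulrA ler_peMr ?stein_sol_ge0 //.
      rewrite ler_pdivlMr ?exprn_gt0 // mul1r.
      by rewrite lerXn2r ?nnegrE ?(ltW d0) ?(ltW a0) // ltW.
    have := stein_sol_max v (Y n + a i).
    have := stein_sol_ge0 v (Y n); lra.
  by rewrite PsiN; lra.
have e3 : E (fun n => Psi v - D n) = Psi v - E D.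
  by rewrite (lmeanB law (qc (Psi v)) qD) (lmean_cst law).
rewrite -e3; apply: le_trans key _.
rewrite (lmeanD law qw (qc (e * L))) (lmean_cst law) mulrDl lerD2r.
apply: (jump_avg_right_le law delta_gt0 var1 (c := - Psi (- v)) u0).
  by move=> j k /(ypos_mono mu m delta_gt0); exact: stein_drift_mono.
move=> n; rewrite stein_drift_ge; have := stein_drift_le v (Y n).
by rewrite PsiN; lra.
Qed.

(** Markov's inequality, for the case where [v ^+ 2 * L] is not small. *)
Lemma right_tail_prob v : 0 < v -> Psi v - F v <= right_tail_const v / v.
Proof.
move=> v0.
have bI := bounded_bool (fun n => Y n <= v) (R := R).
have bJ := bounded_bool (fun n => v < Y n) (R := R).
have q1 := bounded_quad_growth bI; have q2 := bounded_quad_growth bJ.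
have : 1 - F v = E (fun n => (v < Y n)%R%:R).
  rewrite /ldist -[X in X - _](lmean_cst law) -(lmeanB law) //; last first.
    by apply: bounded_quad_growth; exists 1 => n; rewrite normr1.
  by congr lmean; apply/funext => n; rewrite ltNge; case: (Y n <= v); rewrite /= ?subrr ?subr0.
have : v * E (fun n => (v < Y n)%R%:R) <= right_tail_const v.
  apply: le_trans (right_tail law delta_gt0 var1 v0).
  rewrite -(lmeanZ law) //; apply: (ler_lmean law); first exact: quad_growthZ.
    by apply: lin_growthM_ypos; exact: bounded_lin.
  move=> n; case: (ltP v (Y n)) => h /=; last by rewrite !mulr0.
  by rewrite !mulr1 ltW.
move=> h1 h2; rewrite ler_pdivlMr // [leLHS]mulrC; apply: le_trans h1.
by rewrite ler_pM2l // -h2; have := Psi_le1 v; lra.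
Qed.

(** 31.44 = 16.44 + 15 is what [nonuniform_right_ge] yields; [31.44 / v^3 <= 31.935 / (1 + v^3)]
    holds once [v^3 >= 64]. *)
Let K : R := 3144 / 100.

Let sq16 (v : R) : 4 <= v -> 16 <= v ^+ 2.
Proof. by move=> v4; have := sqr_ge0 (v - 4); lra. Qed.

Lemma nonuniform_left v : 4 <= v -> `|F (- v) - Psi (- v)| <= K / v ^+ 3 * L.
Proof.
move=> v4; have v0 : 0 < v by lra.
have v3 : 0 < v ^+ 3 by rewrite exprn_gt0.
rewrite ler_norml; apply/andP; split; last first.
  apply: le_trans (left_le v0) _; rewrite ler_wpM2r // ler_wpM2r ?invr_ge0 ?(ltW v3) //.
  by rewrite /K; lra.
rewrite lerNl opprB.
(* The cut at [v / 2] turns the tail term into [24 / v^3]; the slope term is exponentially small. *)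
apply: le_trans (@left_ge v (v / 2) _ _) _; [lra|lra|].
rewrite ler_wpM2r // ler_pdivlMr // mulrDl.
have -> : 3 / (v / 2) ^+ 3 * v ^+ 3 = 24 by field; rewrite gt_eqF.
have x0 : 0 < 3 / 16 * v ^+ 2 by have := sq16 v4; lra.
have := expRN_sqr_le x0.
set e := expR _ => he.
have e0 : 0 <= e by exact: expR_ge0.
have v2 : 0 <= v / 2 by lra.
have := drift_slope_le v0 v2.
rewrite (_ : ((v / 2) ^+ 2 - v ^+ 2) / 2 = - (3 / 16 * v ^+ 2 + 3 / 16 * v ^+ 2)); last by field.
rewrite -/e -(ler_pM2r v3) => h.
apply: (@le_trans _ _ (24 + (1 + v / 2 + (v / 2) ^+ 2) * e / v * v ^+ 3)); first by rewrite lerD2l.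
rewrite (_ : _ / v * v ^+ 3 = e * ((1 + v / 2 + (v / 2) ^+ 2) * v ^+ 2)); last by field; rewrite gt_eqF.
have : e * ((1 + v / 2 + (v / 2) ^+ 2) * v ^+ 2) <= e * (7 / 16 * v ^+ 4).
  rewrite ler_wpM2l // (_ : v ^+ 4 = v ^+ 2 * v ^+ 2); last by ring.
  rewrite [leRHS]mulrA ler_wpM2r ?sqr_ge0 //.
  have := sq16 v4; have : 0 <= v * (v - 4) by apply: mulr_ge0; lra.
  by lra.
(* Written as a multiple of the quantity that [he] bounds. *)
have -> : 7 / 16 * v ^+ 4 = 1024 / 504 * (49 / 50 * (25 / 4 * (3 / 16 * v ^+ 2) ^+ 2)).
  by field.
by rewrite /K; lra.
Qed.

Let tau_half (v : R) : 4 <= v -> 16 <= v ^+ 2 -> right_tail_const (v / 2) * v ^+ 3 =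
   (64 * (957 / 1000 + L) + 24 * (v ^+ 2 * L)) / v.
Proof. by move=> v4 _; rewrite /right_tail_const; field; lra. Qed.

Lemma nonuniform_right_le v : 4 <= v -> F v - Psi v <= K / v ^+ 3 * L.
Proof.
move=> v4; have v0 : 0 < v by lra.
have v3 : 0 < v ^+ 3 by rewrite exprn_gt0.
(* If [2 v L > 1], then [F v <= 1] leaves the error [Psi (- v)], a Gaussian tail that the target
   exceeds. *)
have [Lv|Lv] := leP (2 * v * L) 1; last first.
  have F1 : F v <= 1.
    rewrite /ldist -[leRHS](lmean_cst law); apply: (ler_lmean law).
    - exact/bounded_quad_growth/bounded_bool.
    - by apply: bounded_quad_growth; exists 1 => n; rewrite normr1.
    by move=> n; case: (Y n <= v); rewrite ?lexx ?ler01.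
  apply: (@le_trans _ _ (Psi (- v))); first by rewrite PsiN; lra.
  apply: le_trans (Psi_tail_le1 0 v0) _.
  have x0 : 0 < v ^+ 2 / 4 by rewrite divr_gt0 // exprn_gt0.
  have := expRN_sqr_le x0.
  rewrite (_ : - _ = (0 ^+ 2 - v ^+ 2) / 2); last by field.
  set e := expR _ => he; have e0 : 0 <= e by exact: expR_ge0.
  rewrite (_ : K / v ^+ 3 * L = K * L / v ^+ 3); last by rewrite mulrAC.
  rewrite ler_pdivrMr // mulrAC ler_pdivlMr //.
  apply: (@le_trans _ _ (K * (1 / 2))); last by rewrite -(mulrA K L v) ler_pM2l; [lra|rewrite /K; lra].
  have : e * v ^+ 3 <= e * (v ^+ 4 / 4).
    rewrite ler_wpM2l // (_ : v ^+ 4 / 4 = v ^+ 3 * (v / 4)); last by field.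
    by rewrite ler_peMr ?(ltW v3) //; lra.
  by rewrite /K; lra.
apply: le_trans (@right_le v (v / 2) _ _) _; [lra|lra|].
rewrite ler_wpM2r // ler_pdivlMr // mulrDl (tau_half v4 (sq16 v4)).
have x0 : 0 < 3 / 16 * v ^+ 2 by have := sq16 v4; lra.
have := expRN_sqr_le x0.
have := Psi_tail_mills_le (v / 2) v0; have := Psi_tail_le1 (v / 2) v0.
rewrite (_ : ((v / 2) ^+ 2 - v ^+ 2) / 2 = - (3 / 16 * v ^+ 2 + 3 / 16 * v ^+ 2)); last by field.
set e := expR _ => h1 h2 he; have e0 : 0 <= e by exact: expR_ge0.
have H1 : Psi (- v) * v <= e by rewrite -ler_pdivlMr.
have H2 : Psi (- v) * mills (v / 2) * v <= e by rewrite -ler_pdivlMr.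
have T1 : (64 * (957 / 1000 + L) + 24 * (v ^+ 2 * L)) / v <= 294 / 10.
  rewrite ler_pdivrMr //.
  have : v * (2 * v * L) <= v * 1 by rewrite ler_pM2l.
  have : 4 * L <= v * L by rewrite ler_wpM2r.
  by lra.
rewrite (_ : (_ / _) * v ^+ 3 = 2 * v * (Psi (- v) * v) +
   (v ^+ 2 + 4) * (Psi (- v) * mills (v / 2) * v)); last by field; lra.
have h3 := ler_wpM2l (mulr_ge0 (ler0n _ 2) (ltW v0)) H1.
have h4 := ler_wpM2l (addr_ge0 (sqr_ge0 v) (ler0n _ 4)) H2.
have h5 : e * (v ^+ 2 + 2 * v + 4) <= e * (7 / 64 * v ^+ 4).
  rewrite ler_wpM2l //.
  have := sq16 v4; have : 0 <= v * (v - 4) by apply: mulr_ge0; lra.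
  have : 0 <= v ^+ 2 * (v ^+ 2 - 16) by apply: mulr_ge0; [exact: sqr_ge0|have := sq16 v4; lra].
  by lra.
by rewrite /K; lra.
Qed.

Lemma nonuniform_right_ge v : 4 <= v -> Psi v - F v <= K / v ^+ 3 * L.
Proof.
move=> v4; have v0 : 0 < v by lra.
have v3 : 0 < v ^+ 3 by rewrite exprn_gt0.
have s16 := sq16 v4.
(* Above this threshold the crude tail bound suffices: 3.828 + 6.25 v^2 L <= 31.44 v^2 L. *)
have [Lv|Lv] := leP (v ^+ 2 * L) (16 / 100); last first.
  apply: le_trans (right_tail_prob v0) _.
  rewrite ler_pdivrMr // /right_tail_const ler_pdivrMr ?exprn_gt0 //.
  rewrite (_ : _ / _ * L * v * v ^+ 4 = K * (v ^+ 2 * L)); last by field; rewrite gt_eqF.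
  have : 16 * L <= v ^+ 2 * L by rewrite ler_wpM2r.
  by rewrite /K; lra.
(* The cut at 0.78 v balances the two terms of the maximum: the slope grows with the cut, and the
   other term is at most [1 / 0.28^2], about 12.8, times [v^-3]. Both stay below [15 / v^3]. *)
apply: le_trans (@right_ge v (v / 2) (39 / 50 * v) _ _ _ _) _; [lra|lra|lra|lra|].
rewrite ler_wpM2r // ler_pdivlMr // mulrDl (tau_half v4 s16).
have T1 : (64 * (957 / 1000 + L) + 24 * (v ^+ 2 * L)) / v <= 1644 / 100.
  rewrite ler_pdivrMr //.
  have : 16 * L <= v ^+ 2 * L by rewrite ler_wpM2r.
  by lra.
suff : Num.max (drift_slope v (39 / 50 * v))
    (stein_sol v v / (39 / 50 * v - v / 2) ^+ 2) * v ^+ 3 <= 15 by rewrite /K; lra.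
rewrite -ler_pdivlMr // ge_max; apply/andP; split; rewrite ler_pdivlMr //.
  have u0 : 0 <= 39 / 50 * v by lra.
  have := drift_slope_le v0 u0.
  have x0 : 0 < 979 / 10000 * v ^+ 2 by lra.
  have := expRN_sqr_le x0.
  rewrite (_ : - _ = ((39 / 50 * v) ^+ 2 - v ^+ 2) / 2); last by field.
  set e := expR _ => he; have e0 : 0 <= e by exact: expR_ge0.
  rewrite -(ler_pM2r v3) => /le_trans; apply.
  rewrite (_ : _ / v * v ^+ 3 =
     e * ((1 + 39 / 50 * v + (39 / 50 * v) ^+ 2) * v ^+ 2)); last by field; rewrite gt_eqF.
  have : e * ((1 + 39 / 50 * v + (39 / 50 * v) ^+ 2) * v ^+ 2) <= e * (867 / 1000 * v ^+ 4).
    rewrite ler_wpM2l // (_ : v ^+ 4 = v ^+ 2 * v ^+ 2); last by ring.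
    rewrite [leRHS]mulrA ler_wpM2r ?sqr_ge0 //.
    have v44 : 0 <= v * (v - 4) by rewrite mulr_ge0 ?subr_ge0 // ltW.
    by clear he e0 x0 u0 T1 Lv v3 s16; lra.
  have : 0 <= e * v ^+ 4 by rewrite mulr_ge0 // exprn_ge0 // ltW.
  by clear u0 x0 T1 Lv v3 s16 v0 v4; lra.
have := Psi_tail_mills_le v v0; rewrite subrr mul0r expR0.
rewrite -/(stein_sol v v) {1}/stein_sol lexx.
rewrite ler_pdivlMr // => h.
rewrite (_ : _ / _ * v ^+ 3 = (Psi (- v) * mills v * v) * (10000 / 784)); last by field; lra.
by lra.
Qed.

Lemma berry_esseen z : `|F z - Psi z| <=
  L * Num.min ((47 * 100 + 85) / (100 * 100))
      ((319 * 100 + 35) / (10 * 100) / (1 + `|z| ^+ 3)).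
Proof.
have U := uniform_berry_esseen law delta_gt0 var1 z.
set c0 := (X in Num.min X _); set c1 := (X in Num.min _ X).
have [h|h] := leP c0 c1; first by apply: le_trans U _; rewrite /c0; lra.
have zp : 0 <= `|z| ^+ 3 by rewrite exprn_ge0.
(* The second term of the minimum is the smaller one only if [1 + |z|^3] exceeds 31.935 / 0.4785,
   about 66.7. *)
have z4 : 4 <= `|z|.
  rewrite leNgt; apply/negP => z4.
  have z3 : `|z| ^+ 3 <= 4 ^+ 3 by rewrite lerXn2r ?nnegrE // ltW.
  move: h; rewrite ltNge => /negP; apply; clear U.
  rewrite /c0 /c1 ler_pdivlMr; last by clear z3 z4; lra.
  by clear z4; lra.
have z3 : 64 <= `|z| ^+ 3.
  by rewrite (_ : 64 = 4 ^+ 3) ?lerXn2r ?nnegrE //; ring.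
apply: (@le_trans _ _ (K / `|z| ^+ 3 * L)); last first.
  rewrite mulrC ler_wpM2l // /c1 ler_pdivrMr; last by apply: lt_le_trans z3.
  clear U h z4; rewrite mulrAC ler_pdivlMr /K; last by clear z3; lra.
  by lra.
have [z0|z0] := leP 0 z.
  rewrite ger0_norm // in z4 *.
  rewrite ler_norml; apply/andP; split; last exact: nonuniform_right_le.
  by rewrite lerNl opprB; exact: nonuniform_right_ge.
rewrite [X in _ / X ^+ 3](ltr0_norm z0).
by rewrite -{1 2}[z]opprK; apply: nonuniform_left; rewrite -(ltr0_norm z0).
Qed.

End nonuniform_bound.

(** * From generating functions to Panjer's recursion *)

Section generating_function.
Context {R : realType}.

Lemma deriv_at_sum (J : Type) (s : seq J) (f : J -> R -> R) (x : R) (df : J -> R) :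
  (forall j, deriv_at (f j) x (df j)) ->
  deriv_at (fun t => \sum_(j <- s) f j t) x (\sum_(j <- s) df j).
Proof.
move=> fd; elim: s => [|j s IH].
  by rewrite big_nil; under eq_fun do rewrite big_nil; exact: deriv_at_const.
rewrite big_cons; under eq_fun do rewrite big_cons.
exact: deriv_atD.
Qed.

Lemma deriv_atX n (x : R) : deriv_at (fun t => t ^+ n) x (n%:R * x ^+ n.-1).
Proof.
elim: n => [|n IH].
  by rewrite mul0r; under eq_fun do rewrite expr0; exact: deriv_at_const.
under eq_fun do rewrite exprS.
apply: deriv_at_eq; first by apply: deriv_atM IH; exact: deriv_at_var.
case: n {IH} => [|n] /=; first by rewrite !expr0; ring.
by rewrite exprS -[n.+2]addn1 natrD; ring.
Qed.

Lemma deriv_at_near_eq (f g : R -> R) (x d d' : R) :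
  deriv_at f x d -> deriv_at g x d' -> (\forall t \near x, f t = g t) -> d = d'.
Proof.
move=> [_ <-] [_ <-] fg; exact: near_eq_derive fg.
Qed.

Lemma ltn_2X n : n.+1%:R <= 2 ^+ n :> R.
Proof. by rewrite -natrX ler_nat ltn_expl. Qed.

(** An identity theorem from the right of 0, the only side where the generating function is known.
    Once the lower coefficients vanish, a geometric tail bound gives [|c n| <= 4 D 2^n s] for all
    small [s]. *)
Lemma pseries_eq0_coef (c : nat -> R) (D e : R) : 0 < e ->
  (forall n, `|c n| <= D * 2 ^+ n) ->
  (forall s, 0 < s < e -> series (fun n => c n * s ^+ n) @ \oo --> (0 : R)) ->
  forall n, c n = 0.
Proof.
move=> e0 cD cs; elim/ltn_ind => n IH.
have D0 : 0 <= D by have := le_trans (normr_ge0 _) (cD 0%N); rewrite expr0 mulr1.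
have bnd s : 0 < s < e -> s <= 1 / 4 -> `|c n| <= 4 * D * 2 ^+ n * s.
  move=> /andP[s0 se] s4.
  have sn : 0 < s ^+ n by rewrite exprn_gt0.
  rewrite -(ler_pM2r sn).
  (* Geometric majorant in closed form: the last factor grows by [2 (2 s)^N (1 - 2 s)], which is at
     least [(2 s)^N] as [2 s <= 1 / 2]. *)
  have part N : `|series (fun k => c k * s ^+ k) (n.+1 + N)%N - c n * s ^+ n| <=
      D * (2 * s) ^+ n.+1 * (2 - 2 * (2 * s) ^+ N).
    elim: N => [|N IHN].
      rewrite addn0 /series /= big_nat_recr //= big_nat big1 => [|k /= kn].
        by rewrite add0r subrr normr0 expr0 mulr1 subrr mulr0.
      by rewrite IH // mul0r.
    have -> : series (fun k => c k * s ^+ k) (n.+1 + N.+1)%N =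
        series (fun k => c k * s ^+ k) (n.+1 + N)%N + c (n.+1 + N)%N * s ^+ (n.+1 + N).
      by rewrite addnS /series /= big_nat_recr.
    rewrite addrAC.
    apply: le_trans (ler_normD _ _) _.
    have h1 : `|c (n.+1 + N)%N * s ^+ (n.+1 + N)| <= D * (2 * s) ^+ n.+1 * (2 * s) ^+ N.
      rewrite normrM normrX (gtr0_norm s0) -mulrA -exprD exprMn mulrA.
      by rewrite ler_wpM2r // exprn_ge0 // ltW.
    have h2 : D * (2 * s) ^+ n.+1 * (2 * s) ^+ N.+1 <= D * (2 * s) ^+ n.+1 * (1 / 2 * (2 * s) ^+ N).
      rewrite ler_wpM2l //; first by rewrite mulr_ge0 // exprn_ge0 // mulr_ge0 // ltW.
      by rewrite exprS ler_wpM2r ?exprn_ge0 ?mulr_ge0 ?(ltW s0) //; lra.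
    have : 0 <= D * (2 * s) ^+ n.+1 * (2 * s) ^+ N.
      by rewrite !mulr_ge0 // exprn_ge0 // mulr_ge0 // ltW.
    move: IHN h1 h2; move: (D * _ ^+ n.+1) ((2 * s) ^+ N.+1) ((2 * s) ^+ N) => p q1 q0.
    move: `|_| `|_| => x1 x2 *; lra.
  have lim : `|series (fun k => c k * s ^+ k) (n.+1 + N)%N - c n * s ^+ n| @[N --> \oo] -->
     `|0 - c n * s ^+ n|.
    apply: cvg_norm; apply: cvgB; last exact: cvg_cst.
    have := cs s; rewrite s0 se => /(_ isT).
    rewrite -(@cvg_shiftn n.+1 _ (series (fun k => c k * s ^+ k))).
    by under eq_fun do rewrite addnC.
  have : `|0 - c n * s ^+ n| <= D * (2 * s) ^+ n.+1 * 2.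
    rewrite -(cvg_lim _ lim) //; apply: limr_le; first exact: cvgP lim.
    near=> N; apply: le_trans (part N) _.
    rewrite ler_wpM2l //; first by rewrite mulr_ge0 // exprn_ge0 // mulr_ge0 // ltW.
    by rewrite gerBl mulr_ge0 // exprn_ge0 // mulr_ge0 // ltW.
  rewrite sub0r normrN normrM normrX (gtr0_norm s0) exprMn !exprS => /le_trans; apply.
  by rewrite le_eqVlt; apply/orP; left; apply/eqP; ring.
apply/eqP; rewrite -normr_le0; apply/ler_addgt0Pr => d d0; rewrite add0r.
pose K := 4 * D * 2 ^+ n.
have K0 : 0 <= K by rewrite /K !mulr_ge0 // exprn_ge0.
pose s := Num.min (Num.min (e / 2) (1 / 4)) (d / (K + 1)).
have s0 : 0 < s by rewrite !lt_min !divr_gt0 //; lra.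
have se : s < e.
  by apply: (@le_lt_trans _ _ (e / 2)); [rewrite !ge_min lexx|lra].
have s4 : s <= 1 / 4 by rewrite !ge_min lexx orbT.
apply: le_trans (bnd s _ s4) _; first by rewrite s0.
have : s <= d / (K + 1) by rewrite !ge_min lexx orbT.
rewrite ler_pdivlMr -/K; last by lra.
have : 0 <= K * s by rewrite mulr_ge0 // ltW.
by lra.
Unshelve. all: by end_near. Qed.

Context {I : finType}.
Variables (b : nat -> R) (mu : I -> R) (m : I -> nat).
Hypotheses (b_ge0 : forall n, 0 <= b n) (b_sum1 : series b @ \oo --> (1 : R)).
Hypotheses (mu_ge0 : forall i, 0 <= mu i) (m_gt0 : forall i, (0 < m i)%N).

Let pgf s := expR (- \sum_i mu i * (1 - s ^+ m i)).

Hypothesis pgfE : forall s, 0 < s < 1 ->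
  series (fun n => b n * s ^+ n) @ \oo --> pgf s.

Let b_le1 n : b n <= 1.
Proof.
have cb := cvgP _ b_sum1; rewrite -(cvg_lim _ b_sum1) //.
have h := @nondecreasing_cvgn_le R (series b) _ cb n.+1.
apply: le_trans (h _); first by rewrite /series /= big_nat_recr //= lerDr sumr_ge0.
by apply/nondecreasing_seqP => k; rewrite /series /= big_nat_recr //= lerDl.
Qed.

(** The radius 1/8 is ample: [2 * 4^n] also bounds the coefficients of the second derived series, on
    which term-by-term differentiation relies. *)
Let geo_cvg (f : nat -> R) : (forall n, 0 <= f n <= 2 * 4 ^+ n) ->
  cvgn (pseries f 8^-1).
Proof.
move=> fb; apply: (@series_le_cvg _ _ (geometric 2 (2^-1))).
- by move=> n; rewrite mulr_ge0 ?exprn_ge0 ?invr_ge0 //; have /andP[] := fb n.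
- by move=> n; rewrite mulr_ge0 ?exprn_ge0 ?invr_ge0.
- move=> n /=; have /andP[_ h] := fb n.
  apply: le_trans (ler_wpM2r _ h) _; first by rewrite exprn_ge0 ?invr_ge0.
  rewrite -mulrA -exprMn (_ : 4 * 8^-1 = 2^-1) //; lra.
by apply: is_cvg_geometric_series; rewrite ger0_norm ?invr_ge0 //; lra.
Qed.

(** The generating function B satisfies B' = B Q' with Q(s) = sum_i mu_i s^(m_i), and Panjer's
    recursion compares coefficients: [c n] is that of s^n in B' - B Q'. *)
Lemma pgf_panjer : panjer_law b mu m.
Proof.
split => //.
pose c n := n.+1%:R * b n.+1 -
  \sum_i mu i * (m i)%:R * (if (m i <= n.+1)%N then b (n.+1 - m i)%N else 0).
suff c0 : forall n, c n = 0.
  case=> [|n]; last by apply/eqP; rewrite -subr_eq0; apply/eqP; exact: c0.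
  rewrite mul0r big1 // => i _.
  by rewrite leqNgt m_gt0 mulr0.
have C0 : cvgn (pseries b 8^-1).
  apply: geo_cvg => n; rewrite b_ge0 (le_trans (b_le1 n)) //.
  have : 1 <= 4 ^+ n :> R by rewrite exprn_ege1 //; lra.
  lra.
have C1 : cvgn (pseries (pseries_diffs b) 8^-1).
  apply: geo_cvg => n; rewrite /pseries_diffs mulr_ge0 //=.
  apply: (@le_trans _ _ (n.+1%:R)); first by rewrite ler_piMr.
  apply: le_trans (ltn_2X n) _.
  have : 2 ^+ n <= 4 ^+ n :> R by rewrite lerXn2r ?nnegrE //; lra.
  have : 0 <= 4 ^+ n :> R by rewrite exprn_ge0.
  lra.
have C2 : cvgn (pseries (pseries_diffs (pseries_diffs b)) 8^-1).
  apply: geo_cvg => n; rewrite /pseries_diffs !mulr_ge0 //=.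
  have h1 := ltn_2X n; have h2 := ltn_2X n.+1.
  have : n.+1%:R * n.+2%:R <= 2 ^+ n * 2 ^+ n.+1 :> R by apply: ler_pM.
  rewrite [2 ^+ n.+1]exprS mulrCA -exprMn (_ : 2 * 2 = 4 :> R); last by lra.
  apply: le_trans; rewrite ler_pM2l ?ltr0n // .
  by rewrite ler_piMr.
apply: (@pseries_eq0_coef c (2 + \sum_i mu i * (m i)%:R) 8^-1) => [|k|s /andP[s0 s8]].
- by rewrite invr_gt0.
- have t1 : 1 <= 2 ^+ k :> R by rewrite exprn_ege1 //; lra.
  apply: le_trans (ler_normB _ _) _; rewrite mulrDl lerD //.
    rewrite ger0_norm ?mulr_ge0 //.
    apply: (@le_trans _ _ k.+1%:R); first by rewrite ler_piMr.
    by apply: le_trans (ltn_2X k) _; lra.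
  apply: le_trans (ler_norm_sum _ _ _) _; rewrite mulr_suml; apply: ler_sum => i _.
  rewrite normrM ger0_norm ?mulr_ge0 // ler_wpM2l ?mulr_ge0 //.
  by case: ifP => _; rewrite ?normr0 ?ger0_norm ?(le_trans (b_le1 _)) //; lra.
have s1 : 0 < s < 1 by rewrite s0 /=; lra.
have sK : `|s| < `|8^-1 : R| by rewrite !gtr0_norm ?invr_gt0.
have D1 := pseries_snd_diffs C0 C1 C2 sK.
pose dQ := \sum_i mu i * ((m i)%:R * s ^+ (m i).-1).
have D2 : deriv_at pgf s (pgf s * dQ).
  apply: deriv_at_eq.
    apply: (@deriv_at_comp R (@expR R)); first exact: is_derive_expR.
    apply: deriv_atN; apply: deriv_at_sum => i; apply: deriv_atM.
      exact: deriv_at_const.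
    by apply: deriv_atB; [exact: deriv_at_const|exact: deriv_atX].
  congr (_ * _); rewrite -sumrN; apply: eq_bigr => i _; ring.
have dE : limn (pseries (pseries_diffs b) s) = pgf s * dQ.
  apply: (deriv_at_near_eq D1 D2); near=> t; apply/cvg_lim => //; apply: pgfE.
  have : t \in `]0, 1[%R by near: t; apply: near_in_itvoo; rewrite in_itv.
  by rewrite in_itv.
have L1 : series (fun n => n.+1%:R * b n.+1 * s ^+ n) @ \oo --> pgf s * dQ.
  by rewrite -dE; apply: is_cvg_pseries_inside C1 sK.
have L2 : series (fun n => (\sum_i mu i * (m i)%:R *
   (if (m i <= n.+1)%N then b (n.+1 - m i)%N else 0)) * s ^+ n) @ \oo --> pgf s * dQ.
  rewrite (_ : pgf s * dQ = \sum_i mu i * (m i)%:R * s ^+ (m i).-1 * pgf s); last first.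
    by rewrite mulr_sumr; apply: eq_bigr => i _; ring.
  rewrite (_ : series _ = fun N => \sum_i mu i * (m i)%:R * s ^+ (m i).-1 *
     series (fun n => b n * s ^+ n) (N - (m i).-1)%N).
    apply: cvg_big => [|i _]; first exact: add_continuous.
    apply: cvgMl_tmp.
    rewrite (@cvg_centern _ _ (series (fun n => b n * s ^+ n))).
    exact: pgfE.
  apply/funext => N; rewrite /series /=.
  under eq_bigr do rewrite mulr_suml.
  rewrite exchange_big /=; apply: eq_bigr => i _.
  have [k mk] : exists k, m i = k.+1 by case: (m i) (m_gt0 i) => // k _; exists k.
  rewrite mk /=; under eq_bigr do rewrite ltnS subSS.
  rewrite mulr_sumr; have [kN|Nk] := leqP k N; last first.
    rewrite (_ : (N - k = 0)%N) ?[RHS]big_geq //; last by apply/eqP; rewrite subn_eq0 ltnW.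
    rewrite big_nat big1 // => n /= nN; rewrite leqNgt (leq_trans nN) 1?ltnW //=.
    by rewrite mulr0 mul0r.
  rewrite (big_cat_nat _ kN) //= big_nat big1 ?add0r; last first.
    by move=> n /= nm; rewrite leqNgt nm /= mulr0 mul0r.
  rewrite -{1}[k]add0n big_addn big_nat [RHS]big_nat; apply: eq_bigr => n _.
  by rewrite leq_addl addnK exprD; ring.
move: L1 L2; set u := (u in series u); set v := (v in _ -> series v @ _ --> _ -> _).
move=> L1 L2; rewrite (_ : (fun n => c n * s ^+ n) = u - v); last first.
  by apply/funext => n; rewrite /c mulrBl.
have h := cvgB L1 L2. rewrite subrr in h. rewrite (_ : series (u - v) = series u - series v); first exact: h.
by apply/funext => N; rewrite /series /= !fctE -sumrB.
Unshelve. all: by end_near. Qed.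

End generating_function.

(** * Discretised marked Poisson processes *)

Section bounded_expectation.
Context {R : realType} {d : measure_display} {T : measurableType d}.
Variable P : probability T R.

Definition bounded_rv (f : T -> R) :=
  measurable_fun setT f /\ exists C, forall w, `|f w| <= C.
Definition expect (f : T -> R) : R := fine (\int[P]_w (f w)%:E)%E.

Lemma bounded_rv_integrable f : bounded_rv f -> P.-integrable setT (EFin \o f).
Proof.
move=> [mf [C fC]]; apply: measurable_bounded_integrable => //.
  exact: le_lt_trans (probability_le1 P measurableT) (ltry 1).
exists C; split; first exact: num_real.
by move=> M CM w _ /=; exact: le_trans (fC w) (ltW CM).
Qed.

Lemma expect_fin f : bounded_rv f -> ((expect f)%:E = \int[P]_w (f w)%:E)%E.
Proof.
by move=> /bounded_rv_integrable bf; rewrite fineK // integrable_fin_num.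
Qed.

Lemma bounded_rv_cst (c : R) : bounded_rv (fun=> c).
Proof. by split; [exact: measurable_cst|exists `|c|]. Qed.

Lemma bounded_rvD f g : bounded_rv f -> bounded_rv g -> bounded_rv (fun w => f w + g w).
Proof.
move=> [mf [C fC]] [mg [D gD]]; split; first exact: measurable_funD.
by exists (C + D) => w; rewrite (le_trans (ler_normD _ _)) // lerD.
Qed.

Lemma bounded_rvM f g : bounded_rv f -> bounded_rv g -> bounded_rv (fun w => f w * g w).
Proof.
move=> [mf [C fC]] [mg [D gD]]; split; first exact: measurable_funM.
by exists (C * D) => w; rewrite normrM ler_pM.
Qed.

Lemma bounded_rv_sum (J : Type) (s : seq J) (f : J -> T -> R) :
  (forall j, bounded_rv (f j)) -> bounded_rv (fun w => \sum_(j <- s) f j w).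
Proof.
move=> bf; elim: s => [|j s IH].
  by under eq_fun do rewrite big_nil; exact: bounded_rv_cst.
by under eq_fun do rewrite big_cons; exact: bounded_rvD.
Qed.

Lemma bounded_rv_prod (J : Type) (s : seq J) (f : J -> T -> R) :
  (forall j, bounded_rv (f j)) -> bounded_rv (fun w => \prod_(j <- s) f j w).
Proof.
move=> bf; elim: s => [|j s IH].
  by under eq_fun do rewrite big_nil; exact: bounded_rv_cst.
by under eq_fun do rewrite big_cons; exact: bounded_rvM.
Qed.

Lemma bounded_rv_indic A : measurable A -> bounded_rv (\1_A : T -> R).
Proof.
move=> mA; split; first exact: measurable_indic.
by exists 1 => w; rewrite indicE; case: (w \in A); rewrite ?normr1 ?normr0.
Qed.

Lemma expectD f g : bounded_rv f -> bounded_rv g ->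
  expect (fun w => f w + g w) = expect f + expect g.
Proof.
move=> bf bg; apply: RintegralD => //; exact: bounded_rv_integrable.
Qed.

Lemma expectZ c f : bounded_rv f -> expect (fun w => c * f w) = c * expect f.
Proof. by move=> bf; apply: RintegralZl => //; exact: bounded_rv_integrable. Qed.

Lemma expect_cst c : expect (fun=> c) = c.
Proof.
have := @integral_cst _ _ R P setT measurableT c%:E.
rewrite (_ : _ setT = 1%E) ?mule1; last exact: probability_setT.
by rewrite /expect => ->.
Qed.

Lemma expect_sum (J : Type) (s : seq J) (f : J -> T -> R) :
  (forall j, bounded_rv (f j)) ->
  expect (fun w => \sum_(j <- s) f j w) = \sum_(j <- s) expect (f j).
Proof.
move=> bf; elim: s => [|j s IH].
  by under eq_fun do rewrite big_nil; rewrite big_nil expect_cst.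
rewrite big_cons -IH -expectD //; last exact: bounded_rv_sum.
by under eq_fun do rewrite big_cons.
Qed.

Lemma expect_indic A : measurable A -> expect (\1_A : T -> R) = fine (P A).
Proof. by move=> mA; rewrite /expect integral_indic // setIT. Qed.

Lemma ler_expect f g : bounded_rv f -> bounded_rv g -> (forall w, f w <= g w) ->
  expect f <= expect g.
Proof. by move=> bf bg fg; apply: le_Rintegral => //; exact: bounded_rv_integrable. Qed.

Lemma expect_cvg (f_ : nat -> T -> R) (f : T -> R) (C : R) :
  (forall n, measurable_fun setT (f_ n)) -> (forall n w, `|f_ n w| <= C) ->
  bounded_rv f -> {ae P, forall w, f_ ^~ w @ \oo --> f w} ->
  expect (f_ n) @[n --> \oo] --> expect f.
Proof.
move=> mf_ fC bf ff.
have bf_ n : bounded_rv (f_ n) by split => //; exists C.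
have [|||||_ _] := @dominated_convergence _ T R P setT measurableT
  (fun n => EFin \o f_ n) (EFin \o f) (cst C%:E).
- by move=> n; exact/measurable_EFinP.
- by apply/measurable_EFinP; case: bf.
- by apply: filterS ff => w h _; apply: cvg_EFin => //; exact: nearW.
- exact: (bounded_rv_integrable (bounded_rv_cst C)).
- by apply: aeW => w n _; rewrite /= lee_fin.
by move=> h; apply: fine_cvg; rewrite -/(expect f) expect_fin.
Qed.

(** Expanding the products reduces the claim to joint cells, the events about which
    [iid_marks_indep] and [is_PPP] speak. *)
Lemma eq_expect_prod_sum (K C : finType) (f g : K -> C -> T -> R) :
  (forall k c, bounded_rv (f k c)) -> (forall k c, bounded_rv (g k c)) ->
  (forall c : {ffun K -> C},
    expect (fun w => \prod_k f k (c k) w) = expect (fun w => \prod_k g k (c k) w)) ->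
  expect (fun w => \prod_k \sum_c f k c w) = expect (fun w => \prod_k \sum_c g k c w).
Proof.
move=> bf bg fg.
have E (h : K -> C -> T -> R) : (forall k c, bounded_rv (h k c)) ->
    expect (fun w => \prod_k \sum_c h k c w) =
    \sum_(c : {ffun K -> C}) expect (fun w => \prod_k h k (c k) w).
  move=> bh; rewrite -expect_sum; last by move=> c; exact: bounded_rv_prod.
  by congr expect; apply/funext => w; rewrite bigA_distr_bigA.
by rewrite !E //; apply: eq_bigr.
Qed.

End bounded_expectation.

Section nat_series.
Context {R : realType}.

(** The partial sums are a nondecreasing sequence of naturals with supremum [n], so they reach
    it. *)
Lemma nat_eseries_eventually (x : nat -> nat) (n : nat) :
  (\sum_(0 <= k <oo) (x k)%:R%:E)%E = n%:R%:E :> \bar R ->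
  exists K, forall N, (K <= N)%N -> (\sum_(0 <= k < N) x k)%N = n.
Proof.
move=> xn; pose S N := (\sum_(0 <= k < N) x k)%N.
have Smono : {homo S : i j / (i <= j)%N}.
  move=> i j ij; rewrite /S (big_cat_nat _ ij) //=.
  exact: leq_addr.
have SE N : (\sum_(0 <= k < N) (x k)%:R%:E)%E = (S N)%:R%:E :> \bar R.
  by rewrite /S natr_sum sumEFin.
have Sle N : (S N <= n)%N.
  rewrite -(ler_nat R) -lee_fin -SE -xn.
  by apply: nneseries_lim_ge => k _; rewrite lee_fin.
have [K HK] : exists K, (n <= S K)%N.
  apply/not_existsP => H.
  have : (n%:R%:E <= (n.-1)%:R%:E :> \bar R)%E.
    rewrite -xn; apply: lime_le; first by apply: is_cvg_nneseries => k _; rewrite lee_fin.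
    apply: nearW => N; rewrite SE lee_fin ler_nat.
    have := H N; case: n {xn Sle H} => [|n] /=; first by case.
    by move=> /negP; rewrite -ltnNge.
  rewrite lee_fin ler_nat; case: (n) (H 0%N) => [|n'] /=; first by case.
  by rewrite ltnn.
exists K => N KN; apply/eqP; rewrite eqn_leq Sle.
exact: leq_trans HK (Smono _ _ KN).
Qed.

Lemma eventually_nat_eseries (x : nat -> nat) (n K : nat) :
  (forall N, (K <= N)%N -> (\sum_(0 <= k < N) x k)%N = n) ->
  (\sum_(0 <= k <oo) (x k)%:R%:E)%E = n%:R%:E :> \bar R.
Proof.
move=> xn; apply/cvg_lim => //; apply: cvg_near_cst.
exists K => // N /= KN; rewrite sumEFin -natr_sum.
by rewrite xn.
Qed.

End nat_series.

Lemma prod_indic {R : realType} {T : Type} (n : nat) (B : nat -> set T) (w : T) :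
  \prod_(k < n) \1_(B k) w =
  \1_(\bigcap_(k in [set k | (k < n)%N]) B k) w :> R.
Proof.
rewrite [X in \1_X](bigcap_mkord n B).
elim: n => [|n IH]; first by rewrite !big_ord0 indicT.
by rewrite !big_ord_recr indicI /= IH.
Qed.

Definition ffun_ext {n : nat} {C : Type} (c0 : C) (c : 'I_n -> C) (k : nat) : C :=
  odflt c0 (omap c (insub k)).

Lemma ffun_extE n C (c0 : C) (c : 'I_n -> C) (i : 'I_n) : ffun_ext c0 c i = c i.
Proof. by rewrite /ffun_ext valK. Qed.

(** * Law of the total score of a marked Poisson process *)

Section marked_ppp.
Context {R : realType} {d : measure_display} {T : measurableType d}.
Variables (P : probability T R) (X : nat -> T -> R * R) (H : nat -> T -> R).
Variables (lam : R) (q : R -> R).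
Hypothesis lam_gt0 : 0 < lam.
Hypothesis mX : forall k, measurable_fun setT (X k).
Hypothesis mH : forall k, measurable_fun setT (H k).
Hypothesis ppp : is_PPP P X lam.
Hypothesis iid : iid_marks_indep P X H q.
Variables (u : R * R -> nat) (v : R -> nat) (V : nat).
Hypothesis mu_u : forall j, measurable (u @^-1` [set j]).
Hypothesis mv : forall l, measurable (v @^-1` [set l]).
Hypothesis uV : forall x, (u x <= V)%N.
Hypothesis vV : forall h, (v h <= V)%N.
Hypothesis u_bounded : forall j, bounded2 (u @^-1` [set j.+1]).

Let PT : P setT = 1%E. Proof. exact: probability_setT. Qed.

Lemma dens_probE B : measurable B -> dens_prob q B = P (H 0%N @^-1` B).
Proof.
move=> mB; have := @iid 1%N (fun=> setT) (fun=> B) (fun=> measurableT) (fun=> mB).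
rewrite big_ord1 => E.
rewrite (_ : [set k | (k < 1)%N] = [set 0%N]) in E; last first.
  by apply/seteqP; split => k /=; rewrite ltnS leqn0 => /eqP.
move: E; rewrite !bigcap_set1 (_ : [set w | setT (X 0%N w)] = setT) // PT mul1e => <-.
by congr (P _); apply/seteqP; split => w //= [].
Qed.

Let mXj k j : measurable (X k @^-1` (u @^-1` [set j])).
Proof. by rewrite -[X in measurable X]setTI; exact: mX. Qed.
Let mHl k l : measurable (H k @^-1` (v @^-1` [set l])).
Proof. by rewrite -[X in measurable X]setTI; exact: mH. Qed.

Definition mark_prob l : R := fine (dens_prob q (v @^-1` [set l])).

Lemma mark_prob_ge0 l : 0 <= mark_prob l.
Proof. by rewrite /mark_prob dens_probE // fine_ge0. Qed.

Let dens_fin l : dens_prob q (v @^-1` [set l]) = (mark_prob l)%:E.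
Proof. by rewrite /mark_prob dens_probE // fineK // fin_num_measure. Qed.

Lemma preimage_bool (S : Type) (f : S -> nat) (j : nat) w :
  \1_(f @^-1` [set j]) w = (f w == j)%:R :> R.
Proof. by rewrite indicE; congr (_%:R); congr nat_of_bool; apply/idP/eqP; rewrite inE. Qed.

Let indX k j w : \1_(X k @^-1` (u @^-1` [set j])) w = (u (X k w) == j)%:R :> R.
Proof. exact: (@preimage_bool _ (u \o X k)). Qed.
Let indH k l w : \1_(H k @^-1` (v @^-1` [set l])) w = (v (H k w) == l)%:R :> R.
Proof. exact: (@preimage_bool _ (v \o H k)). Qed.

Lemma mark_prob_sum1 : \sum_(l < V.+1) mark_prob l = 1.
Proof.
have bl (l : 'I_V.+1) := @bounded_rv_indic R _ _ _ (mHl 0%N l).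
rewrite -[RHS](expect_cst P 1).
under eq_bigr => l _ do rewrite /mark_prob dens_probE // -(expect_indic P (mHl 0%N l)).
rewrite -expect_sum //; congr expect; apply/funext => w.
have h : (v (H 0%N w) < V.+1)%N by rewrite ltnS.
rewrite (bigD1 (Ordinal h)) //= indH eqxx big1 ?addr0 // => l ne.
by rewrite indH; case: eqP => // e; case/eqP: ne; apply/val_inj.
Qed.

(** Generating function of the score of one point in ring [j], its mark integrated out. *)
Definition mark_pgf (s : R) (j : nat) : R := \sum_(l < V.+1) mark_prob l * s ^+ (j * l).

Definition score k w : nat := (u (X k w) * v (H k w))%N.

Section fixed_s.
Variable s : R.
Hypothesis s01 : 0 < s <= 1.
Let s0 : 0 <= s. Proof. by case/andP: s01 => /ltW. Qed.
Let s1 : s <= 1. Proof. by case/andP: s01. Qed.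

Lemma mark_pgf01 j : 0 <= mark_pgf s j <= 1.
Proof.
apply/andP; split.
  by apply: sumr_ge0 => l _; rewrite mulr_ge0 ?mark_prob_ge0 // exprn_ge0.
rewrite -mark_prob_sum1; apply: ler_sum => l _.
by rewrite ler_piMr ?mark_prob_ge0 // exprn_ile1.
Qed.

Lemma mark_pgf0 : mark_pgf s 0 = 1.
Proof. by rewrite -mark_prob_sum1; apply: eq_bigr => l _; rewrite mul0n expr0 mulr1. Qed.

Let cell := ('I_V.+1 * 'I_V.+1)%type.
Let cell0 : cell := (ord0, ord0).
Let bX k j := @bounded_rv_indic R _ _ _ (mXj k j).
Let bH k l := @bounded_rv_indic R _ _ _ (mHl k l).

(** The marks of the first [n] points, independent of the locations, are integrated out cell by
    cell, a cell fixing the ring and the mark level of every point. *)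
Lemma expect_score_thinning n :
  expect P (fun w => \prod_(k < n) s ^+ score k w) =
  expect P (fun w => \prod_(k < n) mark_pgf s (u (X k w))).
Proof.
pose f (k : 'I_n) (c : cell) (w : T) : R :=
  s ^+ (c.1 * c.2) * (\1_(X k @^-1` (u @^-1` [set c.1 : nat])) w *
                     \1_(H k @^-1` (v @^-1` [set c.2 : nat])) w).
pose g (k : 'I_n) (c : cell) (w : T) : R :=
  s ^+ (c.1 * c.2) * mark_prob c.2 * \1_(X k @^-1` (u @^-1` [set c.1 : nat])) w.
have bf k c : bounded_rv (f k c).
  by apply: bounded_rvM; [exact: bounded_rv_cst|exact: bounded_rvM].
have bg k c : bounded_rv (g k c) by apply: bounded_rvM => //; exact: bounded_rv_cst.
have fE k w : \sum_c f k c w = s ^+ score k w.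
  have h1 : (u (X k w) < V.+1)%N by rewrite ltnS.
  have h2 : (v (H k w) < V.+1)%N by rewrite ltnS.
  rewrite (bigD1 (Ordinal h1, Ordinal h2)) //= /f indX indH !eqxx !mulr1 big1 ?addr0 //.
  move=> [c1 c2] /= ne; rewrite indX indH; case: eqP => e1; case: eqP => e2; rewrite ?mulr0 ?mul0r ?mulr0 //.
  case/negP: ne; apply/eqP; congr pair; exact: val_inj.
have gE k w : \sum_c g k c w = mark_pgf s (u (X k w)).
  have h1 : (u (X k w) < V.+1)%N by rewrite ltnS.
  rewrite -(pair_bigA _ (fun c1 c2 => g k (c1, c2) w)) /=.
  rewrite (bigD1 (Ordinal h1)) //= [X in _ + X]big1 ?addr0 => [|c1 ne].
    by apply: eq_bigr => l _; rewrite /g indX eqxx /= mulr1 mulrC.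
  apply: big1 => l _; rewrite /g indX; case: eqP => e; last by rewrite mulr0.
  by case/eqP: ne; apply/val_inj.
under [in LHS]eq_fun do under eq_bigr do rewrite -fE.
under [in RHS]eq_fun do under eq_bigr do rewrite -gE.
apply: eq_expect_prod_sum => // c.
pose c' := ffun_ext cell0 c.
pose A k := u @^-1` [set ((c' k).1 : nat)].
pose B k := v @^-1` [set ((c' k).2 : nat)].
have mA k : measurable (A k) by exact: mu_u.
have mB k : measurable (B k) by exact: mv.
have mAB : measurable (\bigcap_(k in [set k | (k < n)%N]) [set w | A k (X k w) /\ B k (H k w)]).
  by apply: bigcap_measurableType => k _; apply: measurableI; [exact: mXj|exact: mHl].
have mA' : measurable (\bigcap_(k in [set k | (k < n)%N]) [set w | A k (X k w)]).
  by apply: bigcap_measurableType => k _; exact: mXj.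
have -> : (fun w => \prod_k f k (c k) w) = fun w => (\prod_k s ^+ ((c k).1 * (c k).2)) *
    \1_(\bigcap_(k in [set k | (k < n)%N]) [set w | A k (X k w) /\ B k (H k w)]) w.
  apply/funext => w; rewrite -prod_indic -big_split /=; apply: eq_bigr => k _.
  rewrite /f; congr (_ * _).
  rewrite (_ : [set w | _] = X k @^-1` (A k) `&` H k @^-1` (B k)) // indicI /=.
  by rewrite /A /B /c' ffun_extE.
have -> : (fun w => \prod_k g k (c k) w) = fun w =>
    (\prod_k (s ^+ ((c k).1 * (c k).2) * mark_prob (c k).2)) *
    \1_(\bigcap_(k in [set k | (k < n)%N]) [set w | A k (X k w)]) w.
  apply/funext => w; rewrite -prod_indic -big_split /=; apply: eq_bigr => k _.
  rewrite /g; congr (_ * _).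
  rewrite (_ : [set w | _] = X k @^-1` (A k)) //.
  by rewrite /A /c' ffun_extE.
rewrite !expectZ; [|exact: bounded_rv_indic..].
rewrite !expect_indic // iid // big_split /= -mulrA; congr (_ * _).
rewrite (_ : (\prod_(k < n) _)%E = (\prod_(k < n) mark_prob (c k).2)%:E); last first.
  rewrite -prodEFin; apply: eq_bigr => k _.
  by rewrite /B /c' ffun_extE dens_fin.
by rewrite fineM // 1?mulrC // fin_num_measure.
Qed.

Lemma prod_mark_pgf n w : \prod_(k < n) mark_pgf s (u (X k w)) =
  \prod_(j < V) mark_pgf s j.+1 ^+ (\sum_(0 <= k < n) (u (X k w) == j.+1))%N.
Proof.
under [RHS]eq_bigr do rewrite big_mkord -prodrXr.
rewrite exchange_big /=; apply: eq_bigr => k _.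
case ux : (u (X k w)) => [|j].
  by rewrite mark_pgf0 big1 // => j _; rewrite expr0.
have h : (j < V)%N by have := uV (X k w); rewrite ux.
rewrite (bigD1 (Ordinal h)) //= eqxx expr1 big1 ?mulr1 // => i ne.
case: eqP => [[e]|_]; last by rewrite expr0.
by case/eqP: ne; apply/val_inj.
Qed.

End fixed_s.

Definition ring_mass j : R := lam * fine (area (u @^-1` [set j.+1])).

Let ring_mass_ge0 j : 0 <= ring_mass j.
Proof. by rewrite mulr_ge0 ?fine_ge0 ?measure_ge0 // ltW. Qed.

Definition count_event j n : set T :=
  [set w | count_pts X (u @^-1` [set j.+1]) w = n%:R%:E].

Let mcount j : measurable_fun setT (count_pts X (u @^-1` [set j.+1])).
Proof.
apply: ge0_emeasurable_sum => // k _.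
apply/measurable_EFinP.
rewrite (_ : (fun w => _) = \1_(X k @^-1` (u @^-1` [set j.+1]))).
  exact: (@bounded_rv_indic R _ _ _ (mXj k j.+1)).1.
by apply/funext => w; rewrite indX preimage_bool.
Qed.

Let mcount_event j n : measurable (count_event j n).
Proof.
rewrite -[X in measurable X]setTI.
exact: (mcount j measurableT (emeasurable_set1 n%:R%:E)).
Qed.

Let count_event_inj j n n' w : count_event j n w -> count_event j n' w -> n = n'.
Proof.
rewrite /count_event /= => -> [] e; apply/eqP.
by rewrite -(@eqr_nat R) e.
Qed.

Let count_sum j w (t : nat -> R) N n : count_event j n w -> (n < N)%N ->
  \sum_(k < N) t k * \1_(count_event j k) w = t n.
Proof.
move=> jn nN; rewrite (bigD1 (Ordinal nN)) //= big1 => [|k ne].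
  by rewrite addr0 indicE mem_set // mulr1.
rewrite indicE memNset ?mulr0 // => /count_event_inj /(_ jn) e.
by case/eqP: ne; apply/val_inj.
Qed.

Let poisson_sum (x : R) j : 0 <= x ->
  \sum_(n < N) x ^+ n * poisson_mass (ring_mass j) n @[N --> \oo] -->
  expR (- (ring_mass j * (1 - x))).
Proof.
move=> x0; rewrite (_ : - _ = ring_mass j * x + - ring_mass j); last by ring.
rewrite expRD (_ : (fun N => _) = fun N =>
   series (exp_coeff (ring_mass j * x)) N * expR (- ring_mass j)).
  by apply: cvgMr_tmp; exact: is_cvg_series_exp_coeff.
apply/funext => N; rewrite /series /= big_mkord mulr_suml; apply: eq_bigr => n _.
by rewrite /poisson_mass /exp_coeff /= (exprMn n (ring_mass j)); ring.
Qed.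

(** Truncating at [N] keeps to finite counts, whose joint law [is_PPP] prescribes. *)
Let expect_counts (x : nat -> R) N : (forall j, 0 <= x j) ->
  expect P (fun w => \prod_(j < V) \sum_(n < N) x j ^+ n * \1_(count_event j n) w) =
  \prod_(j < V) \sum_(n < N) x j ^+ n * poisson_mass (ring_mass j) n.
Proof.
move=> x0.
rewrite -[RHS](expect_cst P).
have bI j n := @bounded_rv_indic R _ _ _ (mcount_event j n).
apply: (@eq_expect_prod_sum _ _ _ P 'I_V 'I_N
  (fun j n w => x j ^+ n * \1_(count_event j n) w)
  (fun j n w => x j ^+ n * poisson_mass (ring_mass j) n)).
- by move=> j n; apply: bounded_rvM => //; exact: bounded_rv_cst.
- by move=> j n; exact: bounded_rv_cst.
move=> c; rewrite expect_cst.
pose c' k := ffun_ext 0%N (fun j => c j : nat) k.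
have mE : measurable (\bigcap_(j in [set j | (j < V)%N]) count_event j (c' j)).
  by apply: bigcap_measurableType => k _; exact: mcount_event.
have -> : (fun w => \prod_(j < V) (x j ^+ c j * \1_(count_event j (c j)) w)) = fun w =>
    (\prod_(j < V) x j ^+ c j) * \1_(\bigcap_(j in [set j | (j < V)%N]) count_event j (c' j)) w.
  apply/funext => w; rewrite -prod_indic -big_split /=; apply: eq_bigr => j _.
  by rewrite /c' ffun_extE.
rewrite expectZ; last exact: bounded_rv_indic.
rewrite expect_indic // big_split /=; congr (_ * _).
have := @ppp V (fun j => u @^-1` [set j.+1]) c'.
rewrite /count_event => ->.
- rewrite prodEFin /=; apply: eq_bigr => j _; rewrite /c' ffun_extE //.
- by move=> i _; split; [exact: mu_u|exact: u_bounded].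
move=> i j _ _ ij; apply/seteqP; split => // y [] /= -> [] e.
exact: ij.
Qed.

Definition finite_counts : set T := \bigcap_(j in [set j | (j < V)%N]) \bigcup_n count_event j n.

Let mfinite : measurable finite_counts.
Proof. by apply: bigcap_measurableType => j _; exact: bigcup_measurable. Qed.

(** A count might a priori be infinite. The probability that all counts lie below [N] is a product
    of truncated Poisson sums and tends to 1. *)
Lemma finite_counts_ae : {ae P, forall w, finite_counts w}.
Proof.
have P1 : P finite_counts = 1%E.
  apply/eqP; rewrite eq_le probability_le1 //=.
  rewrite -(@fineK _ (P finite_counts)) ?fin_num_measure // lee_fin.
  have lim : \prod_(j < V) \sum_(n < N) 1 ^+ n * poisson_mass (ring_mass j) n @[N --> \oo] -->
      \prod_(j < V) expR (- (ring_mass j * (1 - 1))).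
    apply: cvg_big => [|j _]; first exact: mul_continuous.
    exact: poisson_sum.
  rewrite (_ : \prod_(j < V) _ = 1 :> R) in lim; last first.
    by apply: big1 => j _; rewrite subrr mulr0 oppr0 expR0.
  rewrite -(cvg_lim _ lim) //; apply: limr_le; first exact: cvgP lim.
  apply: nearW => N; rewrite -(expect_counts (x := fun=> 1)) // -expect_indic //.
  apply: ler_expect.
  - apply: bounded_rv_prod => j; apply: bounded_rv_sum => n.
    by apply: bounded_rvM; [exact: bounded_rv_cst|exact: bounded_rv_indic].
  - exact: bounded_rv_indic.
  move=> w; have [fw|fw] := pselect (finite_counts w).
    rewrite [leRHS]indicE mem_set //.
    apply: prodr_ile1 => j _; have [n _ jn] := fw j (ltn_ord j).
    have [nN|Nn] := ltnP n N.
      by rewrite (count_sum _ jn nN) expr1n ler01 lexx.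
    rewrite big1 ?ler01 ?lexx // => k _; rewrite indicE memNset ?mulr0 //.
    by move=> /count_event_inj /(_ jn) e; have := ltn_ord k; rewrite e ltnNge Nn.
  rewrite [leRHS]indicE memNset //.
  have [j [jV nj]] : exists j, (j < V)%N /\ forall n, ~ count_event j n w.
    apply: contrapT => /forallNP h; apply: fw => j jV; apply: contrapT => hj.
    by apply: (h j); split => // n jn; apply: hj; exists n.
  rewrite (bigD1 (Ordinal jV)) //= big1 ?mul0r // => n _.
  by rewrite indicE memNset ?mulr0.
rewrite /almost_everywhere.
exists (~` finite_counts); split => //; first exact: measurableC.
by rewrite (@probability_setC _ _ _ P) // P1 subee.
Qed.

Definition total_score w : \bar R := (\sum_(0 <= k <oo) (score k w)%:R%:E)%E.

Definition score_event n : set T := [set w | total_score w = n%:R%:E].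

Let bscore k : measurable_fun setT (fun w => (score k w)%:R : R).
Proof.
rewrite (_ : (fun w => _) = fun w => \sum_(i < V.+1) \sum_(l < V.+1)
  (i * l)%:R * (\1_(X k @^-1` (u @^-1` [set i : nat])) w *
                \1_(H k @^-1` (v @^-1` [set l : nat])) w)).
  apply: (@bounded_rv_sum _ _ _ 'I_V.+1 _ (fun i w => \sum_(l < V.+1)
   (i * l)%:R * (\1_(X k @^-1` (u @^-1` [set i : nat])) w *
                \1_(H k @^-1` (v @^-1` [set l : nat])) w)) _).1 => i.
  apply: bounded_rv_sum => l; apply: bounded_rvM; first exact: bounded_rv_cst.
  by apply: bounded_rvM; exact: bounded_rv_indic.
apply/funext => w.
have h1 : (u (X k w) < V.+1)%N by rewrite ltnS.
have h2 : (v (H k w) < V.+1)%N by rewrite ltnS.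
rewrite (bigD1 (Ordinal h1)) //= (bigD1 (Ordinal h2)) //= indX indH !eqxx !mulr1.
rewrite big1 ?addr0 => [|l ne]; last first.
  by rewrite indH; case: eqP => e; rewrite ?mulr0 //; case/eqP: ne; exact: val_inj.
rewrite big1 ?addr0 // => i ne; apply: big1 => l _.
by rewrite indX; case: eqP => e; rewrite ?mul0r ?mulr0 //; case/eqP: ne; exact: val_inj.
Qed.

Lemma measurable_total_score : measurable_fun setT total_score.
Proof. by apply: ge0_emeasurable_sum => // k _; apply/measurable_EFinP; exact: bscore. Qed.

Let mscore_event n : measurable (score_event n).
Proof.
rewrite -[X in measurable X]setTI.
exact: (measurable_total_score measurableT (emeasurable_set1 n%:R%:E)).
Qed.

(** Only finitely many points lie in a ring of nonzero score, so all partial sums are final from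
    some index on; limits in the next lemma thus become eventual equalities. *)
Lemma finite_counts_score w : finite_counts w -> exists K n (c : 'I_V -> nat),
  [/\ forall N, (K <= N)%N -> (\sum_(0 <= k < N) score k w)%N = n,
      score_event n w, forall j : 'I_V, count_event j (c j) w &
      forall N (j : 'I_V), (K <= N)%N -> (\sum_(0 <= k < N) (u (X k w) == j.+1))%N = c j].
Proof.
move=> fw.
have cex (j : 'I_V) : exists n K, count_event j n w /\
    forall N, (K <= N)%N -> (\sum_(0 <= k < N) (u (X k w) == j.+1))%N = n.
  have [n _ jn] := fw j (ltn_ord j).
  have [|K HK] := @nat_eseries_eventually R (fun k => (u (X k w) == j.+1) : nat) n.
    rewrite -[RHS]jn /count_pts; apply: eq_eseriesr => k _.
    by rewrite -(@preimage_bool _ u j.+1).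
  by exists n, K.
pose c j := sval (cid (cex j)).
have cK (j : 'I_V) : exists K, count_event j (c j) w /\
    forall N, (K <= N)%N -> (\sum_(0 <= k < N) (u (X k w) == j.+1))%N = c j.
  by rewrite /c; case: (cid (cex j)) => n.
pose Kj j := sval (cid (cK j)).
pose K := \max_(j < V) Kj j.
have KN (j : 'I_V) N : (K <= N)%N -> (\sum_(0 <= k < N) (u (X k w) == j.+1))%N = c j.
  move=> h; have := svalP (cid (cK j)); rewrite -/(Kj j) => -[_]; apply.
  exact: leq_trans (leq_bigmax_cond _ isT) h.
have u0 k : (K <= k)%N -> u (X k w) = 0%N.
  move=> Kk; case ux : (u (X k w)) => [//|j].
  have jV : (j < V)%N by have := uV (X k w); rewrite ux.
  have := KN (Ordinal jV) k.+1 (leqW Kk).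
  rewrite big_nat_recr //= (KN (Ordinal jV) k Kk) ux eqxx /=.
  by move=> /eqP; rewrite -[X in _ == X]addn0 eqn_add2l.
have SN N : (K <= N)%N -> (\sum_(0 <= k < N) score k w)%N = (\sum_(0 <= k < K) score k w)%N.
  move=> h; rewrite (big_cat_nat _ h) //= [X in (_ + X)%N](_ : _ = 0)%N ?addn0 //.
  by rewrite big_nat; apply: big1 => k /andP[Kk _]; rewrite /score u0.
exists K, (\sum_(0 <= k < K) score k w)%N, c; split => //.
- exact: (eventually_nat_eseries SN).
- by move=> j; have [] := svalP (cid (cK j)).
- by move=> N j; exact: KN.
Qed.

Definition score_law n : R := fine (P (score_event n)).

Let score_event_inj n n' w : score_event n w -> score_event n' w -> n = n'.
Proof.
rewrite /score_event /= => -> [] e; apply/eqP.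
by rewrite -(@eqr_nat R) e.
Qed.

(** [F1] truncates the generating function of the total score, [F2] computes it from the first [N]
    points, [F3] has the marks integrated out, and [F4] uses truncated ring counts. On finite counts
    [F1 = F2] and [F3 = F4] eventually, so these pairs have the same limiting means by dominated
    convergence; [F2] and [F3] have equal means, and that of [F4] is explicit. *)
Lemma score_law_pgf s : 0 < s <= 1 ->
  series (fun n => score_law n * s ^+ n) @ \oo -->
  expR (- \sum_(j < V) ring_mass j * (1 - mark_pgf s j.+1)).
Proof.
move=> s01; have /andP[s0 s1] := s01.
have t01 := mark_pgf01 s01.
have bI n := @bounded_rv_indic R _ _ _ (mscore_event n).
have bC j n := @bounded_rv_indic R _ _ _ (mcount_event j n).
have bX k j := @bounded_rv_indic R _ _ _ (mXj k j).
pose F1 N w := \sum_(n < N) s ^+ n * \1_(score_event n) w.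
pose F2 N w := \prod_(k < N) s ^+ score k w.
pose F3 N w := \prod_(k < N) mark_pgf s (u (X k w)).
pose F4 N w := \prod_(j < V) \sum_(n < N) mark_pgf s j.+1 ^+ n * \1_(count_event j n) w.
have b1 N : bounded_rv (F1 N).
  by apply: bounded_rv_sum => n; apply: bounded_rvM => //; exact: bounded_rv_cst.
have b3 N : bounded_rv (F3 N).
  apply: bounded_rv_prod => k.
  rewrite (_ : (fun w => _) = fun w => \sum_(j < V.+1) mark_pgf s j * \1_(X k @^-1` (u @^-1` [set j : nat])) w).
    by apply: bounded_rv_sum => j; apply: bounded_rvM => //; exact: bounded_rv_cst.
  apply/funext => w; have h1 : (u (X k w) < V.+1)%N by rewrite ltnS.
  rewrite (bigD1 (Ordinal h1)) //= indX eqxx mulr1 big1 ?addr0 // => j ne.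
  by rewrite indX; case: eqP => e; rewrite ?mulr0 //; case/eqP: ne; exact: val_inj.
have b4 N : bounded_rv (F4 N).
  apply: bounded_rv_prod => j; apply: bounded_rv_sum => n.
  by apply: bounded_rvM => //; exact: bounded_rv_cst.
have b2 N : bounded_rv (F2 N).
  apply: bounded_rv_prod => k; split; last first.
    by exists 1 => w; rewrite ger0_norm ?exprn_ge0 ?exprn_ile1 // ltW.
  rewrite (_ : (fun w => _) = fun w => \sum_(i < V.+1) \sum_(l < V.+1)
    s ^+ (i * l) * (\1_(X k @^-1` (u @^-1` [set i : nat])) w *
                \1_(H k @^-1` (v @^-1` [set l : nat])) w)).
    apply: (@bounded_rv_sum _ _ _ 'I_V.+1 _ (fun i w => \sum_(l < V.+1)
     s ^+ (i * l) * (\1_(X k @^-1` (u @^-1` [set i : nat])) w *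
                  \1_(H k @^-1` (v @^-1` [set l : nat])) w)) _).1 => i.
    apply: bounded_rv_sum => l; apply: bounded_rvM; first exact: bounded_rv_cst.
    by apply: bounded_rvM => //; exact: bounded_rv_indic.
  apply/funext => w.
  have h1 : (u (X k w) < V.+1)%N by rewrite ltnS.
  have h2 : (v (H k w) < V.+1)%N by rewrite ltnS.
  rewrite (bigD1 (Ordinal h1)) //= (bigD1 (Ordinal h2)) //= indX indH !eqxx !mulr1.
  rewrite big1 ?addr0 => [|l ne]; last first.
    by rewrite indH; case: eqP => e; rewrite ?mulr0 //; case/eqP: ne; exact: val_inj.
  rewrite big1 ?addr0 // => i ne; apply: big1 => l _.
  by rewrite indX; case: eqP => e; rewrite ?mul0r ?mulr0 //; case/eqP: ne; exact: val_inj.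
have E1 N : expect P (F1 N) = series (fun n => score_law n * s ^+ n) N.
  rewrite expect_sum; last by move=> n; apply: bounded_rvM => //; exact: bounded_rv_cst.
  rewrite /series /= big_mkord; apply: eq_bigr => n _.
  by rewrite expectZ // expect_indic // mulrC.
have E23 N : expect P (F2 N) = expect P (F3 N) by exact: expect_score_thinning.
have E4 N : expect P (F4 N) = \prod_(j < V) \sum_(n < N) mark_pgf s j.+1 ^+ n * poisson_mass (ring_mass j) n.
  by rewrite -(expect_counts (x := fun j => mark_pgf s j.+1)) // => j; case/andP: (t01 j.+1).
have sumI (E : nat -> set T) (x : nat -> R) N w :
    (forall n, 0 <= x n <= 1) -> (forall n n', E n w -> E n' w -> n = n') ->
    0 <= \sum_(n < N) x n * \1_(E n) w <= 1.
  move=> x01 Einj; apply/andP; split.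
    by apply: sumr_ge0 => n _; rewrite mulr_ge0 //; case/andP: (x01 n).
  have [[n En]|nE] := pselect (exists n : 'I_N, E n w); last first.
    rewrite big1 ?ler01 // => n _; rewrite indicE memNset ?mulr0 // => h.
    by apply: nE; exists n.
  rewrite (bigD1 n) //= big1 ?addr0 => [|k ne].
    by rewrite indicE mem_set // mulr1; case/andP: (x01 n).
  rewrite indicE memNset ?mulr0 // => h; case/eqP: ne; apply/val_inj; exact: Einj h En.
have c1 N w : 0 <= F1 N w <= 1.
  apply: sumI; last by move=> n n'; exact: score_event_inj.
  by move=> n; rewrite exprn_ge0 ?exprn_ile1 // ltW.
have c2 N w : 0 <= F2 N w <= 1.
  apply/andP; split; first by apply: prodr_ge0 => k _; rewrite exprn_ge0 // ltW.
  by apply: prodr_ile1 => k _; rewrite exprn_ge0 ?exprn_ile1 // ltW.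
have c3 N w : 0 <= F3 N w <= 1.
  apply/andP; split; first by apply: prodr_ge0 => k _; case/andP: (t01 (u (X k w))).
  by apply: prodr_ile1 => k _.
have c4 N w : 0 <= F4 N w <= 1.
  have h (j : 'I_V) : 0 <= \sum_(n < N) mark_pgf s j.+1 ^+ n * \1_(count_event j n) w <= 1.
    apply: sumI; last by move=> n n'; exact: count_event_inj.
    by move=> n; case/andP: (t01 j.+1) => h1 h2; rewrite exprn_ge0 ?exprn_ile1.
  apply/andP; split; first by apply: prodr_ge0 => j _; case/andP: (h j).
  exact: prodr_ile1.
have diff (F F' : nat -> T -> R) : (forall N, bounded_rv (F N)) -> (forall N, bounded_rv (F' N)) ->
    (forall N w, 0 <= F N w <= 1) -> (forall N w, 0 <= F' N w <= 1) ->
    (forall w, finite_counts w -> \forall N \near \oo, F N w = F' N w) ->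
    expect P (F N) - expect P (F' N) @[N --> \oo] --> (0 : R).
  move=> bF bF' cF cF' FF'.
  have bD N : bounded_rv (fun w => F N w + (-1) * F' N w).
    by apply: bounded_rvD => //; apply: bounded_rvM => //; exact: bounded_rv_cst.
  have := @expect_cvg _ _ _ P (fun N w => F N w + (-1) * F' N w) (fun=> 0) 1 _ _ (bounded_rv_cst 0) _.
  rewrite expect_cst => h.
  rewrite (_ : (fun N => _) = fun N => expect P (fun w => F N w + (-1) * F' N w)).
    apply: h.
    - by move=> N; case: (bD N).
    - move=> N w; rewrite ler_norml; have /andP[a1 a2] := cF N w.
      by have /andP[a3 a4] := cF' N w; apply/andP; split; lra.
    apply: filterS finite_counts_ae => w /FF' h'.
    apply: cvg_near_cst; apply: filterS h' => N ->; ring.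
  apply/funext => N; rewrite expectD //; last by apply: bounded_rvM => //; exact: bounded_rv_cst.
  by rewrite expectZ // mulN1r.
have d12 := diff F1 F2 b1 b2 c1 c2.
have d34 := diff F3 F4 b3 b4 c3 c4.
have lim12 : expect P (F1 N) - expect P (F2 N) @[N --> \oo] --> (0 : R).
  apply: d12 => w /finite_counts_score [K [n [c [Kn en _ _]]]].
  near=> N; have nN : (n < N)%N by near: N; exact: nbhs_infty_gt.
  have KN : (K <= N)%N by near: N; exact: nbhs_infty_ge.
  rewrite /F1 /F2 (bigD1 (Ordinal nN)) //= big1 => [|k ne].
    by rewrite indicE mem_set // mulr1 addr0 prodrXr -(Kn N KN) big_mkord.
  rewrite indicE memNset ?mulr0 // => /score_event_inj /(_ en) e.
  by case/eqP: ne; apply/val_inj.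
have lim34 : expect P (F3 N) - expect P (F4 N) @[N --> \oo] --> (0 : R).
  apply: d34 => w /finite_counts_score [K [n [c [_ _ jc KN]]]].
  near=> N; rewrite /F3 /F4 prod_mark_pgf //; apply: eq_bigr => j _.
  have cN : (c j < N)%N.
    apply: (@leq_ltn_trans (\max_(i < V) c i)); first exact: leq_bigmax_cond.
    by near: N; exact: nbhs_infty_gt.
  rewrite (@count_sum j w (fun n => mark_pgf s j.+1 ^+ n) N _ (jc j) cN) KN //.
  by near: N; exact: nbhs_infty_ge.
have lim4 : expect P (F4 N) @[N --> \oo] --> \prod_(j < V) expR (- (ring_mass j * (1 - mark_pgf s j.+1))).
  under eq_fun do rewrite E4.
  apply: cvg_big => [|j _]; first exact: mul_continuous.
  by apply: poisson_sum; case/andP: (t01 j.+1).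
have := cvgD (cvgD lim12 lim34) lim4; rewrite !add0r.
rewrite (_ : \prod_(j < V) _ = expR (- \sum_(j < V) ring_mass j * (1 - mark_pgf s j.+1))); last first.
  rewrite -sumrN; apply/esym; apply: (big_morph _ (@expRD R)); exact: expR0.
move=> h; rewrite (_ : series _ = fun N => (expect P (F1 N) - expect P (F2 N)) +
  (expect P (F3 N) - expect P (F4 N)) + expect P (F4 N)); first exact: h.
by apply/funext => N; rewrite -E1 E23; ring.
Unshelve. all: by end_near. Qed.

(** Only nonzero scores are jumps: class [(j, l)] stands for ring [j.+1] and mark level [l.+1]. *)
Definition score_class := ('I_V * 'I_V)%type.
Definition class_size (c : score_class) : nat := (c.1.+1 * c.2.+1)%N.
Definition class_mass (c : score_class) : R := ring_mass c.1 * mark_prob c.2.+1.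

Lemma score_law_panjer : panjer_law score_law class_mass class_size.
Proof.
have pgfE s : 0 < s <= 1 ->
   series (fun n => score_law n * s ^+ n) @ \oo -->
   expR (- \sum_c class_mass c * (1 - s ^+ class_size c)).
  move=> s01; have := score_law_pgf s01.
  congr (_ --> expR (- _)).
  rewrite -(pair_bigA _ (fun j l => class_mass (j, l) * (1 - s ^+ class_size (j, l)))) /=.
  apply: eq_bigr => j _; rewrite -[X in _ * (X - _)]mark_prob_sum1 -sumrB.
  rewrite big_ord_recl muln0 expr0 mulr1 subrr add0r mulr_sumr.
  apply: eq_bigr => l _; rewrite /class_mass /class_size /=.
  by rewrite /bump leq0n add1n; ring.
apply: pgf_panjer.
- by move=> n; rewrite fine_ge0 // measure_ge0.
(* At [s = 1] the generating function gives the total mass. *)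
- have := pgfE 1; rewrite ltr01 lexx => /(_ isT).
  rewrite big1 => [|c _]; last by rewrite expr1n subrr mulr0.
  rewrite oppr0 expR0 (_ : (fun n => score_law n * 1 ^+ n) = score_law) //.
  by apply/funext => n; rewrite expr1n mulr1.
- by move=> c; rewrite mulr_ge0 ?mark_prob_ge0.
- by move=> c; rewrite muln_gt0.
- by move=> s /andP[s0 s1]; apply: pgfE; rewrite s0 ltW.
Qed.

End marked_ppp.

(** * Radial integrals and dyadic rounding *)

Section disc_area.
Context {R : realType}.
Implicit Types (a b r : R) (xo : R * R).
Local Notation leb := (@lebesgue_measure R).

(** Length of the section at abscissa [x] of a disc; the square root of a negative real is 0, which
    covers [x] outside the disc. *)
Let chord a r x : R := 2 * Num.sqrt (r ^+ 2 - (x - a) ^+ 2).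

Lemma continuous_chord a r : continuous (chord a r).
Proof.
move=> x; rewrite /chord; apply: cvgM; first exact: cvg_cst.
apply: (cvg_comp (fun x => r ^+ 2 - (x - a) ^+ 2) Num.sqrt); last exact: sqrt_continuous.
apply: cvgB; first exact: cvg_cst.
apply: (cvg_comp (fun x => x - a) (fun y => y ^+ 2)); last exact: sqr_continuous.
by apply: cvgB; [exact: cvg_id|exact: cvg_cst].
Qed.

(** Substituting x = a + r sin t gives the integrand 2 r^2 cos^2 t, with primitive r^2 (t + sin t
    cos t). *)
Lemma integral_chord a r : 0 < r ->
  (\int[leb]_(x in `[(a - r)%R, (a + r)%R]) (chord a r x)%:E)%E = (pi * r ^+ 2)%:E.
Proof.
move=> r0; pose F t : R := a + r * sin t.
have dF t : deriv_at F t (r * cos t).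
  apply: deriv_at_eq.
    apply: deriv_atD; first exact: deriv_at_const.
    by apply: deriv_atM; [exact: deriv_at_const|exact: is_derive_sin].
  by rewrite mul0r !add0r.
have F'E : derive1 F = fun t => r * cos t.
  by apply/funext => t; rewrite derive1E; case: (dF t).
have cF t : F x @[x --> t] --> F t.
  by apply/differentiable_continuous; rewrite -derivable1_diffP; case: (dF t).
have cF' : continuous (fun t => r * cos t : R).
  by move=> t; apply: cvgM; [exact: cvg_cst|exact: continuous_cos].
have pi2 : - (pi / 2) < pi / 2 :> R by have := @pi_gt0 R; lra.
have Fl : F (- (pi / 2)) = a - r by rewrite /F sinN sin_pihalf mulrN1.
have Fr : F (pi / 2) = a + r by rewrite /F sin_pihalf mulr1.
rewrite -Fl -Fr integration_by_substitution_increasing; first last.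
- by apply: continuous_subspaceT; exact: continuous_chord.
- split; first by move=> t _; case: (dF t).
  + exact/cvg_at_right_filter/cF.
  + exact/cvg_at_left_filter/cF.
- by rewrite F'E; apply: cvgP; exact/cvg_at_left_filter/cF'.
- by rewrite F'E; apply: cvgP; exact/cvg_at_right_filter/cF'.
- by rewrite F'E => t _; exact: cF'.
- by move=> x y xi yi xy; rewrite /F ltrD2l ltr_pM2l // ltr_sin.
- exact: ltW.
pose g t : R := 2 * r ^+ 2 * cos t ^+ 2.
pose Gf t : R := r ^+ 2 * (t + sin t * cos t).
have dG t : deriv_at Gf t (g t).
  apply: deriv_at_eq.
    apply: deriv_atM; first exact: deriv_at_const.
    apply: deriv_atD; first exact: deriv_at_var.
    by apply: deriv_atM; [exact: is_derive_sin|exact: is_derive_cos].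
  rewrite /g /=; have := cos2Dsin2 t => e.
  have -> : 0 * (t + sin t * cos t) + r ^+ 2 * (1 + (cos t * cos t + sin t * - sin t)) =
    r ^+ 2 * (1 + cos t ^+ 2 - sin t ^+ 2) by ring.
  rewrite (_ : sin t ^+ 2 = 1 - cos t ^+ 2); [by ring|by rewrite -e; ring].
transitivity (\int[leb]_(t in `[(- (pi / 2))%R, (pi / 2)%R]) (g t)%:E)%E.
  apply: eq_integral.
  move=> t; rewrite inE /= in_itv /= => tpi; congr EFin.
  rewrite F'E (_ : (_ * _) t = chord a r (F t) * (r * cos t)) // /chord /F.
  rewrite (_ : r ^+ 2 - _ = (r * cos t) ^+ 2); last first.
    by have := cos2Dsin2 t => e; rewrite -[r ^+ 2]mulr1 -e; ring.
  rewrite sqrtr_sqr ger0_norm; first by rewrite /g; ring.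
  by rewrite mulr_ge0 ?(ltW r0) // cos_ge0_pihalf.
have cg : continuous g.
  move=> t; apply: cvgM; first exact: cvg_cst.
  by apply: (cvg_comp cos (fun y => y ^+ 2)); [exact: continuous_cos|exact: sqr_continuous].
have cG t : Gf x @[x --> t] --> Gf t.
  by apply/differentiable_continuous; rewrite -derivable1_diffP; case: (dG t).
rewrite (@continuous_FTC2 R g Gf) //.
- by rewrite -EFinB /Gf; congr EFin; rewrite cosN cos_pihalf !mulr0; field.
- by apply: continuous_subspaceT; exact: cg.
- split; first by move=> t _; case: (dG t).
  + exact/cvg_at_right_filter/cG.
  + exact/cvg_at_left_filter/cG.
- by move=> t _; rewrite derive1E; case: (dG t).
Qed.

Lemma area_xsection xo r (S : set (R * R)) : 0 < r ->
  (forall x, leb (xsection S x) = (chord xo.1 r x)%:E) ->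
  area S = (pi * r ^+ 2)%:E.
Proof.
move=> r0 HS; rewrite /area /product_measure1 /=.
transitivity (\int[leb]_x (chord xo.1 r x)%:E)%E.
  by apply: eq_integral => x _ /=; rewrite HS.
rewrite -(integral_chord xo.1 r0) [RHS]integral_mkcond; apply: eq_integral => x _.
rewrite patchE; case: ifPn => // /negP xr; rewrite /chord ler0_sqrtr ?mulr0 //.
rewrite subr_le0 leNgt; apply/negP => h; apply: xr; rewrite inE /= in_itv /=.
have : `|x - xo.1| <= r.
  by rewrite -(ler_sqr (normr_nneg _) (ltW r0)) /= real_normK ?num_real // ltW.
by rewrite ler_norml => /andP[h1 h2]; apply/andP; split; lra.
Qed.

Let sqr_norm_le (y s : R) : 0 <= s -> (y ^+ 2 <= s ^+ 2) = (`|y| <= s).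
Proof.
by move=> s0; rewrite -[y ^+ 2]real_normK ?num_real // ler_sqr ?nnegrE.
Qed.

Let sqr_norm_lt (y s : R) : 0 <= s -> (y ^+ 2 < s ^+ 2) = (`|y| < s).
Proof.
by move=> s0; rewrite -[y ^+ 2]real_normK ?num_real // ltr_sqr ?nnegrE.
Qed.

Lemma dist2_le xo x r : 0 <= r ->
  (dist2 xo x <= r) = ((x.1 - xo.1) ^+ 2 + (x.2 - xo.2) ^+ 2 <= r ^+ 2).
Proof.
move=> r0; rewrite /dist2 -{1}[r]ger0_norm // -sqrtr_sqr ler_sqrt ?sqr_ge0 //.
Qed.

Lemma dist2_lt xo x r : 0 <= r ->
  (dist2 xo x < r) = ((x.1 - xo.1) ^+ 2 + (x.2 - xo.2) ^+ 2 < r ^+ 2).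
Proof.
move=> r0; rewrite /dist2 -{1}[r]ger0_norm // -sqrtr_sqr.
by have [r0'|r0'] := eqVneq r 0;
  [rewrite r0' expr0n /= sqrtr0 !ltNge sqrtr_ge0 addr_ge0 ?sqr_ge0|rewrite ltr_sqrt // exprn_even_gt0].
Qed.

Lemma area_closed_disc xo r : 0 < r ->
  area [set x | dist2 xo x <= r] = (pi * r ^+ 2)%:E.
Proof.
move=> r0; apply: (@area_xsection xo) => // x; rewrite /chord.
have [D0|D0] := ltP (r ^+ 2 - (x - xo.1) ^+ 2) 0.
  rewrite ler0_sqrtr ?(ltW D0) // mulr0 (_ : xsection _ _ = set0) ?measure0 //.
  apply/seteqP; split => // y; rewrite /xsection /= inE /= dist2_le ?(ltW r0) //=.
  by move=> h; have := sqr_ge0 (y - xo.2); lra.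
set s := Num.sqrt _; have s0 : 0 <= s by exact: sqrtr_ge0.
have ss : s ^+ 2 = r ^+ 2 - (x - xo.1) ^+ 2 by rewrite sqr_sqrtr.
rewrite (_ : xsection _ _ = `[xo.2 - s, xo.2 + s]%classic).
  rewrite lebesgue_measure_itv /= lte_fin; case: ifPn => [_|].
    by rewrite -EFinB; congr EFin; ring.
  by rewrite -leNgt => h; congr EFin; lra.
apply/seteqP; split => y; rewrite /xsection /= inE /= in_itv /= dist2_le ?(ltW r0) //=.
  move=> h; have : (y - xo.2) ^+ 2 <= s ^+ 2 by rewrite ss; lra.
  by rewrite sqr_norm_le // ler_norml => /andP[h1 h2]; apply/andP; split; lra.
move=> /andP[h1 h2]; have : (y - xo.2) ^+ 2 <= s ^+ 2.
  by rewrite sqr_norm_le // ler_norml; apply/andP; split; lra.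
by rewrite ss; lra.
Qed.

Lemma area_open_disc xo r : 0 < r ->
  area [set x | dist2 xo x < r] = (pi * r ^+ 2)%:E.
Proof.
move=> r0; apply: (@area_xsection xo) => // x; rewrite /chord.
have [D0|D0] := leP (r ^+ 2 - (x - xo.1) ^+ 2) 0.
  rewrite ler0_sqrtr // mulr0 (_ : xsection _ _ = set0) ?measure0 //.
  apply/seteqP; split => // y; rewrite /xsection /= inE /= dist2_lt ?(ltW r0) //=.
  by move=> h; have := sqr_ge0 (y - xo.2); lra.
set s := Num.sqrt _; have s0 : 0 < s by rewrite sqrtr_gt0.
have ss : s ^+ 2 = r ^+ 2 - (x - xo.1) ^+ 2 by rewrite sqr_sqrtr // ltW.
rewrite (_ : xsection _ _ = `]xo.2 - s, xo.2 + s[%classic).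
  rewrite lebesgue_measure_itv /= lte_fin; case: ifPn => [_|].
    by rewrite -EFinB; congr EFin; ring.
  by rewrite -leNgt => h; congr EFin; lra.
apply/seteqP; split => y; rewrite /xsection /= inE /= in_itv /= dist2_lt ?(ltW r0) //=.
  move=> h; have : (y - xo.2) ^+ 2 < s ^+ 2 by rewrite ss; lra.
  by rewrite sqr_norm_lt ?(ltW s0) // ltr_norml => /andP[h1 h2]; apply/andP; split; lra.
move=> /andP[h1 h2]; have : (y - xo.2) ^+ 2 < s ^+ 2.
  by rewrite sqr_norm_lt ?(ltW s0) // ltr_norml; apply/andP; split; lra.
by rewrite ss; lra.
Qed.

Definition radial_weight (S : set R) : \bar R := (\int[leb]_(t in S) (2 * pi * t)%:E)%E.

Lemma radial_weight_itv (b1 b2 : bool) r : 0 < r ->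
  radial_weight [set` Interval (BSide b1 0) (BSide b2 r)] = (pi * r ^+ 2)%:E.
Proof.
move=> r0.
have E : (\int[leb]_(t in `[0%R, r]) (2 * pi * t)%:E)%E = (pi * r ^+ 2)%:E.
  pose F t : R := pi * (t * t).
  have dF t : deriv_at F t (2 * pi * t).
    apply: deriv_at_eq.
      apply: deriv_atM; first exact: deriv_at_const.
      by apply: deriv_atM; exact: deriv_at_var.
    by rewrite /=; ring.
  have cF t : F x @[x --> t] --> F t.
    by apply/differentiable_continuous; rewrite -derivable1_diffP; case: (dF t).
  rewrite (@continuous_FTC2 R (fun t => 2 * pi * t) F) //.
  - by rewrite -EFinB /F; congr EFin; ring.
  - apply: continuous_subspaceT => t.
    by apply: cvgM; [exact: cvg_cst|exact: cvg_id].
  - split; first by move=> t _; case: (dF t).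
    + exact/cvg_at_right_filter/cF.
    + exact/cvg_at_left_filter/cF.
  - by move=> t _; rewrite derive1E; case: (dF t).
have mf (S : set R) : measurable_fun S (fun t => (2 * pi * t)%:E).
  by apply/measurable_EFinP; exact: measurable_funTS.
rewrite -E /radial_weight; case: b1 b2 => [] [].
- by rewrite integral_itv_bndo_bndc.
- by [].
- by rewrite integral_itv_bndo_bndc // integral_itv_obnd_cbnd.
- by rewrite integral_itv_obnd_cbnd.
Qed.

End disc_area.

(** * Rounding down to capped dyadic numbers *)

Section dyadic.
Context {R : realType}.
Implicit Types (y : R) (n : nat).

(** The cap leaves finitely many values and recedes to infinity with [n]; negative reals are sent to
    0. *)
Definition dyad n y : nat := minn (Num.truncn (2 ^+ n * y)) (n * 2 ^ n).
Definition dyadR n y : R := (dyad n y)%:R / 2 ^+ n.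

Let p2 n : 0 < 2 ^+ n :> R. Proof. by rewrite exprn_gt0. Qed.

Lemma dyad_le n y : (dyad n y <= n * 2 ^ n)%N.
Proof. exact: geq_minr. Qed.

Lemma dyad_mono n y y' : y <= y' -> (dyad n y <= dyad n y')%N.
Proof.
move=> yy; rewrite /dyad leq_min geq_minr andbT geq_min.
by rewrite le_truncn // ler_wpM2l // ltW.
Qed.

Lemma dyad_gt n y j : (j < dyad n y)%N = (j.+1%:R <= 2 ^+ n * y) && (j < n * 2 ^ n)%N.
Proof. by rewrite /dyad leq_min truncn_gt_nat. Qed.

Lemma dyadR_ge0 n y : 0 <= dyadR n y.
Proof. by rewrite divr_ge0 // ltW. Qed.

Lemma dyadR_mono n y y' : y <= y' -> dyadR n y <= dyadR n y'.
Proof. by move=> yy; rewrite ler_wpM2r ?invr_ge0 ?(ltW (p2 _)) // ler_nat dyad_mono. Qed.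

Lemma dyadR_le n y : dyadR n y <= Num.max y 0.
Proof.
rewrite ler_pdivrMr //; case dy : (dyad n y) => [|j].
  by rewrite mulr_ge0 ?(ltW (p2 _)) // le_max lexx orbT.
have : (j < dyad n y)%N by rewrite dy.
rewrite dyad_gt => /andP[h _]; apply: le_trans h _.
by rewrite mulrC ler_wpM2r ?(ltW (p2 _)) // le_max lexx.
Qed.

(** Halving the mesh at least doubles both the integer part and the cap. This monotonicity in [n] is
    what monotone convergence uses later. *)
Lemma dyadR_nd n n' y : (n <= n')%N -> dyadR n y <= dyadR n' y.
Proof.
move=> nn; rewrite -(subnK nn); elim: (n' - n)%N => [//|k IH].
apply: le_trans IH _; rewrite addSn; move: (k + n)%N => {nn}m.
rewrite ler_pdivrMr // /dyadR exprS invfM mulrA divfK ?gt_eqF //.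
rewrite ler_pdivlMr // -natrM ler_nat.
case dy : (dyad m y) => [//|j].
have : (j < dyad m y)%N by rewrite dy.
rewrite dyad_gt => /andP[h1 h2].
rewrite muln2 doubleS dyad_gt; apply/andP; split.
  by rewrite -doubleS -muln2 natrM exprS mulrC -mulrA ler_pM2l.
rewrite expnS mulnCA mul2n (@leq_trans (m * 2 ^ m).*2) //.
  by rewrite -doubleS leq_double.
by rewrite leq_double leq_mul2r leqnSn orbT.
Qed.

Lemma dyadR_cvg y : dyadR n y @[n --> \oo] --> Num.max y 0.
Proof.
have [y0|y0] := leP y 0.
  rewrite (_ : (fun n => _) = fun=> 0); first exact: cvg_cst.
  by apply/funext => n; apply/eqP; rewrite eq_le dyadR_ge0 andbT (le_trans (dyadR_le n y)) // max_r.
have low : y - (2 ^+ n)^-1 @[n --> \oo] --> y.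
  rewrite -[X in _ --> X]subr0; apply: cvgB; first exact: cvg_cst.
  have := @cvg_geometric R 1 2^-1; rewrite ger0_norm ?invr_ge0 // => /(_ _).
  rewrite invf_lt1 // ltr1n => /(_ isT).
  rewrite (_ : geometric 1 2^-1 = fun n => (2 ^+ n)^-1) //.
  by apply/funext => n; rewrite /= mul1r exprVn.
apply: (@squeeze_cvgr _ _ _ _ (fun n => y - (2 ^+ n)^-1) (fun=> y)) => //; last exact: cvg_cst.
near=> n; apply/andP; split; last by rewrite (le_trans (dyadR_le n y)) // max_l // ltW.
have yn : y <= n%:R by near: n; exact: nbhs_infty_ger.
rewrite ler_pdivlMr // mulrBl mulVf ?gt_eqF // mulrC lerBlDr natr1.
rewrite /dyad; case: leqP => _; first exact/ltW/truncnS_gt.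
rewrite (@le_trans _ _ (2 ^+ n * n%:R)) ?ler_pM2l // mulrC -natrX -natrM ler_nat.
exact: leqnSn.
Unshelve. all: by end_near. Qed.

Lemma measurable_dyad_preim n j : measurable (dyad n @^-1` [set j]).
Proof.
apply: is_interval_measurable => s t /= sj tj w /andP[sw wt].
apply/eqP; rewrite eqn_leq -{1}tj -sj.
by rewrite !dyad_mono.
Qed.

Lemma measurable_dyadR n D : measurable D -> measurable_fun D (dyadR n).
Proof. by move=> mD; apply: nondecreasing_measurable => // y y'; exact: dyadR_mono. Qed.

Variables (D : set R) (y rho : R -> R).
Hypotheses (mD : measurable D) (my : measurable_fun setT y).
Hypotheses (mrho : measurable_fun D rho) (rho0 : forall t, D t -> 0 <= rho t).
Local Notation leb := (@lebesgue_measure R).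

Definition dyad_cell n j : set R := [set t | D t /\ dyad n (y t) = j].

Let mpre n j : measurable (y @^-1` (dyad n @^-1` [set j])).
Proof. by rewrite -[X in measurable X]setTI; apply: my => //; exact: measurable_dyad_preim. Qed.

(** Integral of a simple function; for [0 < i] the value 0 contributes nothing, so the cells start
    at [j.+1]. *)
Lemma dyadic_sum n i : (0 < i)%N ->
  (\sum_(j < n * 2 ^ n) ((j.+1%:R / 2 ^+ n) ^+ i)%:E *
    \int[leb]_(t in dyad_cell n j.+1) (rho t)%:E)%E =
  (\int[leb]_(t in D) (dyadR n (y t) ^+ i * rho t)%:E)%E.
Proof.
move=> i0.
pose C j := y @^-1` (dyad n @^-1` [set j]).
have mC j : measurable_fun D (fun t => (\1_(C j) t)%:E : \bar R).
  by apply/measurable_EFinP; apply: measurable_indic; exact: mpre.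
have E j : (\int[leb]_(t in dyad_cell n j) (rho t)%:E)%E =
   (\int[leb]_(t in D) ((rho t)%:E * (\1_(C j) t)%:E))%E.
  rewrite (_ : dyad_cell n j = D `&` C j) // integral_mkcondr.
  apply: eq_integral => t _; rewrite patchE indicE.
  by case: ifPn => _; rewrite ?mule1 ?mule0.
have mf j : measurable_fun D (fun t => ((rho t)%:E * (\1_(C j) t)%:E)%E).
  by apply: emeasurable_funM => //; exact/measurable_EFinP.
have f0 j t : D t -> (0 <= (rho t)%:E * (\1_(C j) t)%:E)%E.
  by move=> Dt; rewrite mule_ge0 ?lee_fin ?rho0.
have c0 j : 0 <= (j.+1%:R / 2 ^+ n) ^+ i :> R by rewrite exprn_ge0 // divr_ge0 // ltW.
have Z (k : R) j : 0 <= k ->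
    (k%:E * \int[leb]_(t in D) ((rho t)%:E * (\1_(C j) t)%:E) =
     \int[leb]_(t in D) (k%:E * ((rho t)%:E * (\1_(C j) t)%:E)))%E.
  move=> k0; rewrite ge0_integralZl_EFin //; first (by move=> t Dt; rewrite mule_ge0 ?lee_fin ?rho0). exact: mf.
under eq_bigr => j _ do rewrite E Z ?c0 //.
rewrite -ge0_integral_sum //; last 2 first.
- by move=> j; apply: emeasurable_funM => //; first [exact: mf | exact: measurable_cst].
- by move=> j t Dt; rewrite !mule_ge0 ?lee_fin ?rho0.
apply: eq_integral => t _.
case dy : (dyad n (y t)) => [|j].
  rewrite /dyadR dy mul0r expr0n gtn_eqF // mul0r big1 // => j _.
  by rewrite indicE memNset ?mule0 //= => e; move: dy; rewrite e.
have jn : (j < n * 2 ^ n)%N by rewrite -ltnS -dy ltnS dyad_le.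
rewrite (bigD1 (Ordinal jn)) //= big1 ?adde0 => [|k ne].
  by rewrite indicE mem_set //= mule1 -EFinM /dyadR dy.
rewrite indicE memNset ?mule0 //= => e; case/eqP: ne; apply/val_inj => /=.
by move: dy; rewrite e => -[].
Qed.

Lemma dyadic_cvg i :
  (\int[leb]_(t in D) (dyadR n (y t) ^+ i * rho t)%:E)%E @[n --> \oo] -->
  (\int[leb]_(t in D) (Num.max (y t) 0 ^+ i * rho t)%:E)%E.
Proof.
have mdy n : measurable_fun setT (fun t => dyadR n (y t)).
  by apply: (measurableT_comp (measurable_dyadR n measurableT)).
pose f n t := (dyadR n (y t) ^+ i * rho t)%:E.
have L t : D t -> f n t @[n --> \oo] --> (Num.max (y t) 0 ^+ i * rho t)%:E.
  move=> Dt; apply: cvg_EFin; first exact: nearW.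
  apply: cvgM; last exact: cvg_cst.
  by apply: (cvg_comp (fun n => dyadR n (y t)) (fun x => x ^+ i)); [exact: dyadR_cvg | exact: exprn_continuous].
have := @cvg_monotone_convergence _ _ R leb D mD f _ _ _.
have -> : (\int[leb]_(t in D) (fun t => limn (f ^~ t)) t)%E =
   (\int[leb]_(t in D) (Num.max (y t) 0 ^+ i * rho t)%:E)%E.
  by apply: eq_integral => t; rewrite inE => Dt; apply/cvg_lim => //; exact: L.
apply.
- move=> n; apply/measurable_EFinP; apply: measurable_funM => //.
  by apply: measurable_funTS; apply: (measurable_funX i (mdy n)).
- by move=> n t Dt; rewrite lee_fin mulr_ge0 ?exprn_ge0 ?dyadR_ge0 ?rho0.
- move=> t Dt n n' nn; rewrite lee_fin ler_wpM2r ?rho0 //.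
  by rewrite lerXn2r ?nnegrE ?dyadR_ge0 // dyadR_nd.
Qed.

End dyadic.

(** * Areas of rings around the receiver *)

Section radial.
Context {R : realType}.
Variable xo : R * R.
Local Notation leb := (@lebesgue_measure R).

Lemma dist2_ge0 x : 0 <= dist2 xo x.
Proof. exact: sqrtr_ge0. Qed.

Lemma measurable_dist2 : measurable_fun setT (dist2 xo : R * R -> R).
Proof.
have ms : measurable_fun setT (@Num.sqrt R) by apply: continuous_measurable_fun; exact: sqrt_continuous.
rewrite /dist2; apply: (measurableT_comp ms).
by apply: measurable_funD; apply: measurable_funX; apply: measurable_funB.
Qed.

(** The shape of the superlevel sets of a nonincreasing gain on the half-line: empty, or an interval
    from 0 whose right end may or may not belong to it. *)
Definition down_closed (S : set R) :=
  (forall t, S t -> 0 <= t) /\ (forall s t, S t -> 0 <= s -> s <= t -> S s).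

Lemma down_closed_measurable S : down_closed S -> measurable S.
Proof.
move=> [S0 Sd]; apply: is_interval_measurable => s t Ss St w /andP[sw wt].
by apply: Sd St _ wt; rewrite (le_trans (S0 _ Ss)).
Qed.

Lemma measurable_dist2_preim S : measurable S -> measurable (dist2 xo @^-1` S).
Proof. by move=> mS; rewrite -[X in measurable X]setTI; exact: measurable_dist2. Qed.

Lemma area_radial_down S r : down_closed S -> (forall t, S t -> t <= r) ->
  area (dist2 xo @^-1` S) = radial_weight S /\ radial_weight S \is a fin_num.
Proof.
move=> Sdown Sr; have [S0 Sd] := Sdown.
have [[t0 St0]|Se] := pselect (exists t, S t); last first.
  have -> : S = set0 by apply/seteqP; split => // t St; apply: Se; exists t.
  by rewrite preimage_set0 /radial_weight integral_set0 /area measure0.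
have supS : has_sup S by split; [exists t0|exists r].
pose s := sup S.
have Ss t : S t -> t <= s by move=> St; apply: ub_le_sup => //; exact: supS.2.
have sS t : 0 <= t -> t < s -> S t.
  move=> t0' ts; have [u Su tu] := sup_gt supS.1 ts.
  by apply: Sd Su t0' _; exact: ltW.
have s0 : 0 <= s by apply: le_trans (S0 _ St0) (Ss _ St0).
have [s00|sp] := eqVneq s 0.
  have SE : S = [set 0].
    apply/seteqP; split => t /=.
      by move=> St; apply/eqP; rewrite eq_le S0 // andbT -s00 Ss.
    by move=> ->; apply: Sd St0 _ (S0 _ St0).
  rewrite SE /radial_weight integral_set1; split => //.
  apply/eqP; rewrite eq_le measure_ge0 andbT.
  apply/lee_addgt0Pr => e e0; rewrite add0e.
  (* The preimage of 0 lies in a disc of radius [rr], and [pi * rr ^+ 2 <= 4 * rr <= e]. *)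
  pose rr := Num.min 1 (e / 4); have rr0 : 0 < rr by rewrite lt_min ltr01 divr_gt0.
  apply: (@le_trans _ _ (area [set x | dist2 xo x <= rr])).
    apply: le_measure; rewrite ?inE.
    - by apply: measurable_dist2_preim.
    - by apply: (measurable_dist2_preim (S := [set t | t <= rr])); rewrite -set_itvNyc.
    by move=> x /= ->; exact: ltW.
  rewrite area_closed_disc // lee_fin.
  have h1 : rr <= 1 by rewrite ge_min lexx.
  have h2 : rr <= e / 4 by rewrite ge_min lexx orbT.
  have : pi * rr ^+ 2 <= 4 * rr.
    have /andP[p0 p4] := pihalf_02 R.
    have : pi * rr ^+ 2 <= 4 * rr ^+ 2 by rewrite ler_wpM2r ?sqr_ge0 //; lra.
    by move=> h; apply: le_trans h _; rewrite ler_pM2l // expr2 ger_pMl.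
  by lra.
have {sp}s0 : 0 < s by rewrite lt_neqAle eq_sym sp.
have [Sss|Sns] := pselect (S s).
  have SE : S = [set` Interval (BSide true 0) (BSide false s)].
    apply/seteqP; split => t /=; rewrite in_itv /=.
      by move=> St; rewrite S0 // Ss.
    by move=> /andP[h1 h2]; exact: Sd Sss h1 h2.
  rewrite [X in radial_weight X]SE radial_weight_itv //; split => //.
  rewrite -(area_closed_disc xo s0); congr area; apply/seteqP; split => x /=.
    by move=> /Ss.
  by move=> h; apply: Sd Sss _ h; exact: dist2_ge0.
have SE : S = [set` Interval (BSide true 0) (BSide true s)].
  apply/seteqP; split => t /=; rewrite in_itv /=.
    move=> St; rewrite S0 //= lt_neqAle Ss // andbT; apply/eqP => e.
    by apply: Sns; rewrite -e.
  by move=> /andP[h1 h2]; exact: sS.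
rewrite [X in radial_weight X]SE radial_weight_itv //; split => //.
rewrite -(area_open_disc xo s0); congr area; apply/seteqP; split => x /=.
  by rewrite [X in X _]SE /= in_itv /= => /andP[].
by move=> h; apply: sS => //; exact: dist2_ge0.
Qed.

(** A ring is a difference of two discs; boundedness makes both measures finite, so that they can be
    subtracted. *)
Lemma area_radial_diff S S' r : down_closed S -> down_closed S' -> S' `<=` S ->
  (forall t, S t -> t <= r) ->
  area (dist2 xo @^-1` (S `\` S')) = radial_weight (S `\` S') /\
  radial_weight (S `\` S') \is a fin_num.
Proof.
move=> dS dS' S'S Sr.
have [aS fS] := area_radial_down dS Sr.
have [aS' fS'] := area_radial_down dS' (fun t S't => Sr t (S'S t S't)).
have mS := down_closed_measurable dS; have mS' := down_closed_measurable dS'.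
have mSS : measurable (S `\` S') by exact: measurableD.
have rE : radial_weight S = (radial_weight S' + radial_weight (S `\` S'))%E.
  rewrite /radial_weight -ge0_integral_setU //.
  - by rewrite setDUK.
  - by apply/measurable_EFinP; exact: measurable_funTS.
  - rewrite setDUK // => t /(proj1 dS) t0; rewrite lee_fin mulr_ge0 //.
    by rewrite mulr_ge0 // pi_ge0.
  - by rewrite disj_set2E setDIK.
have aE : area (dist2 xo @^-1` S) =
    (area (dist2 xo @^-1` S') + area (dist2 xo @^-1` (S `\` S')))%E.
  rewrite -measureU; last 3 first.
  - exact: measurable_dist2_preim.
  - exact: measurable_dist2_preim.
  - by rewrite -preimage_setI setDIK preimage_set0.
  by rewrite -preimage_setU setDUK.
have f : radial_weight (S `\` S') \is a fin_num.
  by move: fS; rewrite rE fin_numD => /andP[].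
split => //; move: aE; rewrite aS aS' rE.
by move=> /(congr1 (fun z => z - radial_weight S')%E); rewrite ![(radial_weight S' + _)%E]addeC !addeK.
Qed.

End radial.

(** * Integrals of power tails *)

Section power_tail.
Context {R : realType}.
Local Notation leb := (@lebesgue_measure R).

Lemma powRN_cvg0 (b : R) : 0 < b -> t `^ (- b) @[t --> +oo] --> (0 : R).
Proof.
move=> b0; apply/cvgr0Pnorm_lt => e e0; near=> t.
have K0 : 0 < e `^ (- b^-1) by exact: powR_gt0.
have t0 : e `^ (- b^-1) < t by near: t; exact: nbhs_pinfty_gt.
rewrite ger0_norm ?powR_ge0 // powRN invf_plt ?posrE ?powR_gt0 ?(lt_trans K0 t0) //.
have -> : e^-1 = (e `^ (- b^-1)) `^ b.
  by rewrite -powRrM mulNr mulVf ?gt_eqF // powRN powRr1 // ltW.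
by rewrite gt0_ltr_powR // nnegrE ltW // (lt_trans K0).
Unshelve. all: by end_near. Qed.

Lemma integral_powR_tail (a r : R) : 2 < a -> 0 < r ->
  (\int[leb]_(t in `[r, +oo[) (t `^ (1 - a))%:E)%E = (r `^ (2 - a) / (a - 2))%:E.
Proof.
move=> a2 r0.
have d (t : R) : 0 < t -> is_derive t (1 : R) (fun t : R => - (a - 2)^-1 * t `^ (2 - a)) (t `^ (1 - a)).
  move=> t0.
  rewrite [X in is_derive _ _ _ X](_ : _ = - (a - 2)^-1 * ((2 - a) * t `^ (2 - a - 1))); last first.
    rewrite mulrA mulNr -mulrN opprB mulVf ?mul1r; last by rewrite subr_eq0 gt_eqF.
    by congr (_ `^ _); lra.
  have h := is_derive1_powR (2 - a) t0.
  exact: (is_deriveZ (- (a - 2)^-1) h).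
have c (t : R) : 0 < t -> {for t, continuous (fun t : R => t `^ (1 - a))}.
  move=> t0; apply: differentiable_continuous; apply/derivable1_diffP.
  by apply: derivable_powR; rewrite in_itv /= andbT.
have cF (t : R) : 0 < t -> {for t, continuous (fun t : R => - (a - 2)^-1 * t `^ (2 - a))}.
  by move=> t0; apply: differentiable_continuous; apply/derivable1_diffP; apply: ex_derive; exact: d.
rewrite (@ge0_continuous_FTC2y _ (fun t => t `^ (1 - a)) (fun t => - (a - 2)^-1 * t `^ (2 - a)) r 0).
- by rewrite sub0e -EFinN mulNr opprK mulrC.
- by move=> x _; exact: powR_ge0.
- apply/continuous_within_itvcyP; split.
    by move=> x; rewrite in_itv /= andbT => rx; apply: c; exact: lt_trans rx.
  by apply: cvg_at_right_filter; exact: c.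
- rewrite -[X in _ --> X](mulr0 (- (a - 2)^-1)); apply: cvgM; first exact: cvg_cst.
  rewrite (_ : 2 - a = - (a - 2)); last by rewrite opprB.
  by apply: powRN_cvg0; rewrite subr_gt0.
- by move=> x rx; apply: ex_derive; apply: d; exact: lt_trans rx.
- by apply: cvg_at_right_filter; exact: cF.
- move=> x; rewrite in_itv /= andbT => rx; rewrite derive1E.
  by have := d _ (lt_trans r0 rx) => dx; rewrite derive_val.
Qed.

End power_tail.

(** * Ring areas and moments of the rounded path gain *)

Section path_loss.
Context {R : realType}.
Variables (G : R -> R) (xo : R * R).
Hypothesis G_ge0 : forall t, 0 <= t -> 0 <= G t.
Hypothesis G_bounded : exists M : R, forall t, 0 <= t -> G t <= M.
Hypothesis G_noninc : forall s t, 0 <= s -> s <= t -> G t <= G s.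
Hypothesis G_decay : exists alpha : R, 2 < alpha /\
  exists C t0 : R, 0 < t0 /\ forall t, t0 <= t -> G t <= C * t `^ (- alpha).
Local Notation leb := (@lebesgue_measure R).

(** Extends [G] by [G 0] to negative arguments, to be nonincreasing, hence measurable, on the whole
    line. *)
Definition path_gain t := G (Num.max t 0).

Lemma path_gain_ge0 t : 0 <= path_gain t.
Proof. by apply: G_ge0; rewrite le_max lexx orbT. Qed.

Lemma path_gain_noninc s t : s <= t -> path_gain t <= path_gain s.
Proof.
move=> st; apply: G_noninc; first by rewrite le_max lexx orbT.
by rewrite ge_max !le_max st lexx orbT.
Qed.

Lemma path_gainE t : 0 <= t -> path_gain t = G t.
Proof. by move=> t0; rewrite /path_gain max_l. Qed.

Lemma measurable_path_gain D : measurable D -> measurable_fun D path_gain.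
Proof. by move=> mD; apply: nonincreasing_measurable => // s t; exact: path_gain_noninc. Qed.

Lemma path_gain_vanish (e : R) : 0 < e -> exists r : R, forall t, r < t -> path_gain t < e.
Proof.
move=> e0; have [a [a2 [C [t0 [t00 GC]]]]] := G_decay.
have /cvgr0Pnorm_lt/(_ (e / (`|C| + 1))) : t `^ (- a) @[t --> +oo] --> (0 : R).
  by apply: powRN_cvg0; lra.
move=> /(_ _)[]; first by rewrite divr_gt0 // ltr_pwDr.
move=> r [rreal hr]; exists (Num.max r t0) => t; rewrite gt_max => /andP[rt t0t].
have tp : 0 < t by exact: lt_trans t0t.
rewrite path_gainE ?(ltW tp) //; apply: le_lt_trans (GC _ (ltW t0t)) _.
have := hr _ rt; rewrite /= ger0_norm ?powR_ge0 // ltr_pdivlMr ?ltr_pwDr // => h.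
apply: le_lt_trans h; rewrite mulrC ler_wpM2l ?powR_ge0 //.
by rewrite (le_trans (ler_norm C)) // lerDl.
Qed.

(** The gain is bounded before [t0]; beyond, the integrand is at most a multiple of [t^(1 - alpha)],
    integrable because [alpha > 2]. *)
Lemma path_moment_fin i :
  (\int[leb]_(t in `[0%R, +oo[) ((path_gain t) ^+ i.+1 * (2 * pi * t))%:E)%E \is a fin_num.
Proof.
have [M0 GM] := G_bounded; have [a [a2 [C [t0 [t00 GC]]]]] := G_decay.
pose M := Num.max M0 1.
have M1 : 1 <= M by rewrite le_max lexx orbT.
have gM t : path_gain t <= M.
  by rewrite (@le_trans _ _ M0) ?le_max ?lexx // GM // le_max lexx orbT.
have pi20 : 0 <= 2 * pi :> R by rewrite mulr_ge0 // pi_ge0.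
have gi t : path_gain t ^+ i.+1 <= M ^+ i * path_gain t.
  rewrite exprSr ler_wpM2r ?path_gain_ge0 // lerXn2r ?nnegrE ?path_gain_ge0 //.
  exact: le_trans ler01 M1.
pose f t := (path_gain t) ^+ i.+1 * (2 * pi * t).
have mf D : measurable D -> measurable_fun D (fun t => (f t)%:E).
  move=> mD; apply/measurable_EFinP; apply: measurable_funM; last exact: measurable_funM.
  by apply: measurable_funX; exact: measurable_path_gain.
have f0 t : 0 <= t -> (0 <= (f t)%:E)%E.
  by move=> h; rewrite lee_fin mulr_ge0 ?exprn_ge0 ?path_gain_ge0 // mulr_ge0.
have split : `[0%R, +oo[%classic = `[0%R, t0[%classic `|` `[t0, +oo[%classic :> set R.
  by rewrite -itv_bndbnd_setU // bnd_simp // ltW.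
rewrite ge0_fin_numE; last by apply: integral_ge0 => t /=; rewrite in_itv /= andbT => h; exact: f0.
rewrite split ge0_integral_setU //=; last 3 first.
- by rewrite -split; exact: mf.
- by move=> t; rewrite !in_itv /= andbT => -[/andP[h _]|h]; apply: f0 => //; exact: le_trans (ltW t00) h.
- by rewrite disj_set2E; apply/eqP; rewrite -subset0 => t /=; rewrite !in_itv /= andbT => -[/andP[_ h1] h2]; move: (lt_le_trans h1 h2); rewrite ltxx.
apply: lte_add_pinfty.
  apply: (@le_lt_trans _ _ (\int[leb]_(t in `[0%R, t0[) (M ^+ i.+1 * (2 * pi * t0))%:E)%E).
    apply: ge0_le_integral => //=.
    - by move=> t; rewrite in_itv /= => /andP[h _]; exact: f0.
    - exact: mf.
    - move=> t; rewrite in_itv /= => /andP[h1 h2]; rewrite lee_fin ler_pM ?exprn_ge0 ?path_gain_ge0 //.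
      + by rewrite mulr_ge0.
      + by rewrite lerXn2r ?nnegrE ?path_gain_ge0 // (le_trans ler01).
      + by rewrite ler_wpM2l // ltW.
  by rewrite integral_cst //= lebesgue_measure_itv /= lte_fin t00 -EFinD ltry.
apply: (@le_lt_trans _ _ (\int[leb]_(t in `[t0, +oo[) ((M ^+ i * `|C| * (2 * pi))%:E * (t `^ (1 - a))%:E))%E).
  apply: ge0_le_integral => //=.
  - by move=> t; rewrite in_itv /= andbT => h; apply: f0; exact: le_trans (ltW t00) h.
  - exact: mf.
  - apply/measurable_EFinP; apply: measurable_funM => //.
    by apply: measurable_funTS; exact: measurable_powR.
  move=> t; rewrite in_itv /= andbT => h; rewrite lee_fin.
  have tp : 0 < t by exact: lt_le_trans h.
  have -> : t `^ (1 - a) = t * t `^ (- a).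
    by rewrite powRD; [rewrite powRr1 ?(ltW tp)|rewrite (gt_eqF tp) implybT].
  have h1 : path_gain t <= `|C| * t `^ (- a).
    rewrite path_gainE ?(ltW tp) //; apply: le_trans (GC _ h) _.
    by rewrite ler_wpM2r ?powR_ge0 // ler_norm.
  apply: (@le_trans _ _ (M ^+ i * (`|C| * t `^ (- a)) * (2 * pi * t))).
    apply: ler_wpM2r; first by rewrite !mulr_ge0 ?pi_ge0 // ltW.
    apply: le_trans (gi t) _.
    by rewrite ler_wpM2l // exprn_ge0 // (le_trans ler01).
  by rewrite le_eqVlt; apply/orP; left; apply/eqP; ring.
rewrite ge0_integralZl_EFin //.
- by rewrite integral_powR_tail // -EFinM ltry.
- by move=> t _; rewrite lee_fin powR_ge0.
- by apply/measurable_EFinP; apply: measurable_funTS; exact: measurable_powR.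
- by rewrite !mulr_ge0 ?exprn_ge0 ?pi_ge0 // (le_trans ler01).
Qed.

Definition ring_score n x := dyad n (path_gain (dist2 xo x)).

Lemma ring_score_le n x : (ring_score n x <= n * 2 ^ n)%N.
Proof. exact: dyad_le. Qed.

Lemma measurable_ring_score n j : measurable (ring_score n @^-1` [set j]).
Proof.
apply: (@measurable_dist2_preim _ xo (path_gain @^-1` (dyad n @^-1` [set j]))).
rewrite -[X in measurable X]setTI; apply: measurable_path_gain => //.
exact: measurable_dyad_preim.
Qed.

Let level n j : set R := [set t | 0 <= t /\ (j < dyad n (path_gain t))%N].

Let level_down n j : down_closed (level n j).
Proof.
split => [t []//|s t [t0 jt] s0 st]; split => //.
by apply: leq_trans jt _; apply: dyad_mono; exact: path_gain_noninc.
Qed.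

(** Beyond some radius the gain falls below the mesh [2 ^- n] and rounds to 0. *)
Let level_bounded n j : exists r, forall t, level n j t -> t <= r.
Proof.
have [|r hr] := @path_gain_vanish (2 ^- n); first by rewrite invr_gt0 exprn_gt0.
exists r => t [t0]; rewrite dyad_gt => /andP[h _]; rewrite leNgt; apply/negP => /hr.
rewrite -[ltRHS]mul1r ltr_pdivlMr ?exprn_gt0 // mulrC ltNge => /negP; apply.
by apply: le_trans h; rewrite ler1n.
Qed.

Let level_cell n j : dyad_cell `[0%R, +oo[ path_gain n j.+1 = level n j `\` level n j.+1.
Proof.
apply/seteqP; split => t /=; rewrite /dyad_cell /level /= in_itv /= andbT.
  by move=> [t0 ->]; split => // -[]; rewrite ltnn.
move=> [[t0 h1] h2]; split => //; apply/eqP; rewrite eqn_leq h1 andbT leqNgt.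
by apply/negP => h; exact: h2.
Qed.

Let ring_cell n j : ring_score n @^-1` [set j] = dist2 xo @^-1` (dyad_cell `[0%R, +oo[ path_gain n j).
Proof.
apply/seteqP; split => x /=; rewrite /dyad_cell /= in_itv /= andbT; last by case.
by split => //; exact: dist2_ge0.
Qed.

Lemma area_ring n j :
  area (ring_score n @^-1` [set j.+1]) =
    radial_weight (dyad_cell `[0%R, +oo[ path_gain n j.+1) /\
  radial_weight (dyad_cell `[0%R, +oo[ path_gain n j.+1) \is a fin_num.
Proof.
have [r hr] := level_bounded n j; rewrite ring_cell level_cell.
apply: (@area_radial_diff _ _ _ _ r) => //.
by move=> t [t0 h]; split => //; exact: ltnW.
Qed.

Lemma ring_score_bounded n j : bounded2 (ring_score n @^-1` [set j.+1]).
Proof.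
have [r hr] := level_bounded n j.
exists (`|xo.1| + `|xo.2| + r) => x; rewrite ring_cell level_cell => -[/hr xr _] /=.
have c (a b : R) : `|a| <= Num.sqrt (a ^+ 2 + b ^+ 2).
  by rewrite -sqrtr_sqr ler_sqrt ?addr_ge0 ?sqr_ge0 // lerDl sqr_ge0.
have h1 := c (x.1 - xo.1) (x.2 - xo.2).
have h2 := c (x.2 - xo.2) (x.1 - xo.1); rewrite [X in Num.sqrt X]addrC in h2.
have t1 : `|x.1| <= `|x.1 - xo.1| + `|xo.1| by rewrite -{1}(subrK xo.1 x.1) ler_normD.
have t2 : `|x.2| <= `|x.2 - xo.2| + `|xo.2| by rewrite -{1}(subrK xo.2 x.2) ler_normD.
move: xr; rewrite /dist2 => xr.
have n1 := normr_ge0 xo.1; have n2 := normr_ge0 xo.2.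
by split; lra.
Qed.

Definition ring_moment n i : R :=
  \sum_(j < n * 2 ^ n) fine (area (ring_score n @^-1` [set j.+1])) * (j.+1%:R / 2 ^+ n) ^+ i.

Lemma ring_momentE n i : (0 < i)%N -> (ring_moment n i)%:E =
  (\int[leb]_(t in `[0%R, +oo[) (dyadR n (path_gain t) ^+ i * (2 * pi * t))%:E)%E.
Proof.
move=> i0; rewrite -dyadic_sum //; last 2 first.
- exact: measurable_path_gain.
- by move=> t /=; rewrite in_itv /= andbT => t0; rewrite !mulr_ge0 // pi_ge0.
rewrite /ring_moment -sumEFin; apply: eq_bigr => j _.
by have [-> f] := area_ring n j; rewrite EFinM fineK // muleC.
Qed.

Lemma ring_moment_cvg i : ring_moment n i.+1 @[n --> \oo] --> 2 * pi * Gmoment G i.+1.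
Proof.
have mr : measurable_fun (`[0%R, +oo[%classic : set R) (fun t : R => 2 * pi * t) by exact: measurable_funM.
have r0 (t : R) : (`[0%R, +oo[%classic : set R) t -> 0 <= 2 * pi * t.
  by rewrite /= in_itv /= andbT => t0; rewrite !mulr_ge0 // pi_ge0.
have /(_ i.+1) := dyadic_cvg (measurable_itv _) (measurable_path_gain measurableT) mr r0.
rewrite (_ : (fun n => _) = fun n => (ring_moment n i.+1)%:E); last first.
  by apply/funext => n; rewrite ring_momentE.
have -> : (\int[leb]_(t in `[0%R, +oo[) (Num.max (path_gain t) 0 ^+ i.+1 * (2 * pi * t))%:E)%E =
    (2 * pi * Gmoment G i.+1)%:E.
  rewrite /Gmoment.
  have pi20 : 0 <= 2 * pi :> R by rewrite mulr_ge0 // pi_ge0.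
  have E : (\int[leb]_(t in `[0%R, +oo[) ((path_gain t) ^+ i.+1 * (2 * pi * t))%:E =
    (2 * pi)%:E * \int[leb]_(t in `[0%R, +oo[) ((G t) ^+ i.+1 * t)%:E)%E.
    rewrite -ge0_integralZl_EFin //.
    - apply: eq_integral => t; rewrite inE /= in_itv /= andbT => t0.
      by rewrite -EFinM path_gainE //; congr (_%:E); ring.
    - by move=> t /=; rewrite in_itv /= andbT => t0; rewrite lee_fin mulr_ge0 ?exprn_ge0 ?G_ge0.
    - apply/measurable_EFinP; apply: measurable_funM => //; apply: measurable_funX.
      apply: (@eq_measurable_fun _ _ _ _ _ path_gain); last exact: measurable_path_gain.
      by move=> t; rewrite inE /= in_itv /= andbT => t0; rewrite path_gainE.
  have f := path_moment_fin i.
  transitivity (\int[leb]_(t in `[0%R, +oo[) ((path_gain t) ^+ i.+1 * (2 * pi * t))%:E)%E.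
    by apply: eq_integral => t _; rewrite max_l // path_gain_ge0.
  have g : (\int[leb]_(t in `[0%R, +oo[) ((G t) ^+ i.+1 * t)%:E)%E \is a fin_num.
    have p0 : (2 * pi)^-1 * (2 * pi) = 1 :> R.
      by rewrite mulVf // gt_eqF // mulr_gt0 // pi_gt0.
    by rewrite -[X in X \is a _]mul1e -p0 EFinM -muleA -E fin_numM.
  by rewrite E -{1}(fineK g) -EFinM.
move=> h; apply: (fine_cvg h).
Qed.

End path_loss.

(** * Moments of the rounded fading coefficients *)

Section marks.
Context {R : realType} {d : measure_display} {T : measurableType d}.
Variables (P : probability T R) (X : nat -> T -> R * R) (H : nat -> T -> R) (q : R -> R).
Hypothesis mH : forall k, measurable_fun setT (H k).
Hypothesis H_ge0 : forall k w, 0 <= H k w.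
Hypothesis mq : measurable_fun setT q.
Hypothesis q_ge0 : forall h, 0 <= q h.
Hypothesis iid : iid_marks_indep P X H q.
Hypothesis moments : forall j, (1 <= j <= 3)%N ->
  (@lebesgue_measure R).-integrable [set: R] (fun h => (h ^+ j * q h)%:E).
Local Notation leb := (@lebesgue_measure R).

Lemma measurable_mark_score n l : measurable (dyad n @^-1` [set l] : set R).
Proof. exact: measurable_dyad_preim. Qed.

Definition dyad_mark_moment n i : R :=
  \sum_(l < n * 2 ^ n) mark_prob q (dyad n) l.+1 * (l.+1%:R / 2 ^+ n) ^+ i.

Lemma dyad_mark_momentE n i : (0 < i)%N -> (dyad_mark_moment n i)%:E =
  (\int[leb]_(h in setT) (dyadR n h ^+ i * q h)%:E)%E.
Proof.
move=> i0; rewrite -(@dyadic_sum _ setT id) //.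
rewrite /dyad_mark_moment -sumEFin; apply: eq_bigr => l _.
have -> : dyad_cell setT id n l.+1 = dyad n @^-1` [set l.+1] :> set R.
  by apply/seteqP; split => t //= [].
rewrite EFinM muleC; congr (_ * _)%E; rewrite /mark_prob fineK //.
rewrite (dens_probE iid (measurable_mark_score _ _)) fin_num_measure //.
by rewrite -[X in measurable X]setTI; apply: mH => //; exact: measurable_mark_score.
Qed.

(* The density may be nonzero on a null set of negative marks. *)
Lemma mark_moment_max i : (1 <= i <= 3)%N ->
  (\int[leb]_(h in setT) (Num.max h 0 ^+ i * q h)%:E)%E = (mark_moment q i)%:E.
Proof.
move=> i13; have int := moments i13.
rewrite /mark_moment fineK; last exact: integrable_fin_num.
have q0 : (\int[leb]_(h in `]-oo, 0%R[) (q h)%:E = 0)%E.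
  have -> : (\int[leb]_(h in `]-oo, 0%R[) (q h)%:E)%E = dens_prob q `]-oo, 0%R[%classic by [].
  rewrite (dens_probE iid) // (_ : _ @^-1` _ = set0) ?measure0 //.
  by apply/seteqP; split => w //=; rewrite in_itv /= ltNge H_ge0.
have : {ae leb, forall h, `]-oo, 0%R[%classic h -> (q h)%:E = 0%E}.
  apply/(ae_eq_integral_abs leb) => //; first by apply/measurable_EFinP; exact: measurable_funTS.
  rewrite -[RHS]q0; apply: eq_integral => h _; rewrite gee0_abs //.
  by rewrite lee_fin.
move=> ae; apply: ae_eq_integral => //.
- apply/measurable_EFinP; apply: measurable_funM => //; apply: measurable_funX.
  exact: measurable_maxr.
- exact: measurable_int int.
have F := ae_filter_ringOfSetsType (@lebesgue_measure R); apply: filterS ae => h hh _; have [h0|h0] := leP 0 h; first by [].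
have q0h : q h = 0 by apply/EFin_inj; apply: hh; rewrite /= in_itv.
by rewrite q0h !mulr0.
Qed.

Lemma dyad_mark_moment_cvg i : (1 <= i <= 3)%N ->
  dyad_mark_moment n i @[n --> \oo] --> mark_moment q i.
Proof.
move=> i13; have i0 : (0 < i)%N by case/andP: i13.
have /(_ i) := @dyadic_cvg R setT id q measurableT (@measurable_id _ _ _) mq (fun t _ => q_ge0 t).
rewrite (_ : (fun n => _) = fun n => (dyad_mark_moment n i)%:E); last first.
  by apply/funext => n; rewrite dyad_mark_momentE.
by rewrite mark_moment_max // => h; apply: (fine_cvg h).
Qed.

End marks.

(** * The discretised interference *)

Section score_integrals.
Context {R : realType} {d : measure_display} {T : measurableType d}.
Variables (P : probability T R) (X : nat -> T -> R * R) (H : nat -> T -> R).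
Variables (lam : R) (q : R -> R).
Hypothesis lam_gt0 : 0 < lam.
Hypothesis mX : forall k, measurable_fun setT (X k).
Hypothesis mH : forall k, measurable_fun setT (H k).
Hypothesis ppp : is_PPP P X lam.
Hypothesis iid : iid_marks_indep P X H q.
Variables (u : R * R -> nat) (v : R -> nat) (V : nat).
Hypothesis mu_u : forall j, measurable (u @^-1` [set j]).
Hypothesis mv : forall l, measurable (v @^-1` [set l]).
Hypothesis uV : forall x, (u x <= V)%N.
Hypothesis vV : forall h, (v h <= V)%N.
Hypothesis u_bounded : forall j, bounded2 (u @^-1` [set j.+1]).

Let b := score_law P X H u v.
Let mu := class_mass lam q u v (V := V).
Let m := class_size (V := V).
Let total := total_score X H u v.
Let event := score_event X H u v.
Let law : panjer_law b mu m.
Proof. exact: score_law_panjer. Qed.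
Let mtotal : measurable_fun setT total.
Proof. exact: (measurable_total_score mX mH mu_u mv uV vV). Qed.
Let mevent n : measurable (event n).
Proof.
rewrite -[X in measurable X]setTI.
exact: (mtotal measurableT (emeasurable_set1 n%:R%:E)).
Qed.

Lemma score_event_ae : {ae P, forall w, exists n, event n w}.
Proof.
apply: filterS (@finite_counts_ae _ _ _ P X lam mX ppp u V mu_u u_bounded) => w fw.
by have [K [n [c [_ h _ _]]]] := @finite_counts_score _ _ _ X H u v V uV w fw; exists n.
Qed.

(** Carries expectations from the probability space to the lattice law: almost every [w] lies in
    exactly one score event, and nonnegativity lets the integral pass through the sum over
    events. *)
Lemma integral_score (f : nat -> R) (g : T -> \bar R) : quad_growth f ->
  (forall n, 0 <= f n) -> measurable_fun setT g -> (forall w, (0 <= g w)%E) ->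
  (forall n w, event n w -> g w = (f n)%:E) ->
  (\int[P]_w g w)%E = (lmean b f)%:E.
Proof.
move=> fq f0 mg g0 gE.
pose h n w := ((f n)%:E * (\1_(event n) w)%:E)%E : \bar R.
have h0 n w : (0 <= h n w)%E by rewrite mule_ge0 ?lee_fin.
have mh n : measurable_fun setT (h n).
  by apply: emeasurable_funM => //; apply/measurable_EFinP; exact: measurable_indic.
transitivity (\int[P]_w (\sum_(0 <= n <oo) h n w))%E.
  apply: ge0_ae_eq_integral => //.
  - exact: ge0_emeasurable_sum.
  - by move=> w _; apply: nneseries_ge0 => n _ _.
  apply: filterS score_event_ae => w [n nw] _.
  have hn k : k != n -> h k w = 0%E.
    move=> kn; rewrite /h indicE memNset ?mule0 // => kw; case/eqP: kn.
    move: kw; rewrite /event /score_event /= nw => -[] /eqP.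
    by rewrite eqr_nat => /eqP.
  rewrite (nneseries_split _ n.+1) // add0n big_nat_recr //= big_nat big1 => [|k /andP[_ kn]].
    rewrite eseries0 => [|k nk _]; last by rewrite hn // gtn_eqF.
    by rewrite adde0 add0e /h indicE mem_set // mule1 (gE _ _ nw).
  by rewrite hn // ltn_eqF.
rewrite integral_nneseries //.
have -> : (\sum_(0 <= n <oo) \int[P]_w h n w = \sum_(0 <= n <oo) (f n * b n)%:E)%E.
  apply: eq_eseriesr => n _; rewrite ge0_integralZl_EFin //.
  - rewrite integral_indic // setIT EFinM; congr (_ * _)%E.
    by rewrite /b /score_law fineK // fin_num_measure.
  - by apply/measurable_EFinP; exact: measurable_indic.
rewrite /lmean -EFin_lim; last exact: (lmean_cvg law fq).
congr (limn _); apply/funext => n /=.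
by rewrite /series /= sumEFin.
Qed.

Variable delta : R.
Hypothesis delta_gt0 : 0 < delta.
Hypothesis var1 : \sum_c mu c * jump m delta c ^+ 2 = 1.
Let mean := \sum_c mu c * jump m delta c.

Let yposE n : delta * n%:R = ypos mu m delta n + mean.
Proof. by rewrite /ypos subrK. Qed.

Let yq : quad_growth (ypos mu m delta).
Proof. by apply: lin_growth_quad; exact: ypos_lin_growth. Qed.
Let cq (c : R) : quad_growth (fun=> c).
Proof. by apply: bounded_quad_growth; exists `|c|. Qed.

Lemma integral_total_score : (\int[P]_w (delta%:E * total w))%E = mean%:E.
Proof.
rewrite (@integral_score (fun n => ypos mu m delta n + mean)).
- by rewrite (lmeanD law) // (lmean_ypos _ law) (lmean_cst law) add0r.
- exact: quad_growthD.
- by move=> n; rewrite -yposE mulr_ge0 // ltW.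
- by apply: emeasurable_funM.
- move=> w; rewrite mule_ge0 ?lee_fin ?(ltW delta_gt0) //.
  by apply: nneseries_ge0 => n _ _; rewrite lee_fin.
- by move=> n w nw; rewrite /total nw -EFinM yposE.
Qed.

Lemma integral_total_score2 :
  (\int[P]_w ((delta%:E * total w) ^+ 2))%E = (1 + mean ^+ 2)%:E.
Proof.
have y2 := quad_growth_ypos2 mu m delta.
rewrite (@integral_score (fun n => (ypos mu m delta n ^+ 2 + (2 * mean) * ypos mu m delta n) + mean ^+ 2)).
- have yz : quad_growth (fun n => 2 * mean * ypos mu m delta n) by exact: quad_growthZ.
  rewrite (lmeanD law) //; last exact: quad_growthD.
  rewrite (lmeanD law) // (lmeanZ law) // (lmean_ypos _ law) (lmean_ypos2 law var1).
  by rewrite (lmean_cst law) mulr0 addr0.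
- by apply: quad_growthD => //; apply: quad_growthD => //; exact: quad_growthZ.
- move=> n; rewrite (_ : _ + _ = (ypos mu m delta n + mean) ^+ 2) ?sqr_ge0 //; ring.
- by under eq_fun do rewrite expe2; apply: emeasurable_funM; exact: emeasurable_funM.
- by move=> w; rewrite expe2 sqre_ge0.
- move=> n w nw; rewrite /total nw -EFinM yposE -EFin_expe; congr (_%:E); ring.
Qed.

Lemma total_score_cdf z :
  P [set w | (delta * fine (total w) - mean <= z)%R] = (ldist b mu m delta z)%:E.
Proof.
set A := [set w | _].
have mA : measurable A.
  have mf : measurable_fun setT (fun w => delta * fine (total w) - mean).
    apply: measurable_funB => //; apply: measurable_funM => //.
    exact: measurableT_comp.
  by rewrite -[A]setTI; exact: (mf measurableT _ (measurable_itv `]-oo, z])).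
rewrite -[A]setIT -integral_indic //; apply: integral_score.
- by apply: bounded_quad_growth; exact: bounded_bool.
- by [].
- by apply/measurable_EFinP; exact: measurable_indic.
- by move=> w; rewrite lee_fin.
- move=> n w nw; rewrite indicE; congr (_%:R%:E); congr nat_of_bool.
  by apply/idP/idP; rewrite inE /A /= /total nw /= yposE addrK.
Qed.

End score_integrals.

(** * Passage to the limit *)

Section limit_in_law.
Context {R : realType} {d : measure_display} {T : measurableType d}.
Variable P : probability T R.

(** For [a < b]: 1 up to [a], 0 from [b] on, affine between. It is the clamp of [(b - t) / (b - a)]
    to [0, 1], written with absolute values to make continuity immediate. *)
Definition ramp (a b t : R) : R :=
  (1 + `|(b - t) / (b - a)| - `|(b - t) / (b - a) - 1|) / 2.

Lemma ramp01 a b t : 0 <= ramp a b t <= 1.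
Proof.
rewrite /ramp; set s := (b - t) / (b - a); apply/andP; split.
  rewrite divr_ge0 // subr_ge0.
  by have := ler_normB s 1; rewrite normr1 => h; lra.
rewrite ler_pdivrMr // mul1r lerBlDr.
have := ler_normD (s - 1) 1; rewrite subrK normr1; lra.
Qed.

Lemma ramp_le a b t : a < b -> (t <= a)%R%:R <= ramp a b t.
Proof.
move=> ab; have /andP[r0 r1] := ramp01 a b t.
case: (leP t a) => ta /=; last exact: r0.
have s1 : 1 <= (b - t) / (b - a) by rewrite ler_pdivlMr ?subr_gt0 // mul1r lerD2l lerN2.
rewrite /ramp; move: s1; set s := (b - t) / (b - a) => s1.
by rewrite (ger0_norm (le_trans ler01 s1)) ger0_norm ?subr_ge0 //=; lra.
Qed.

Lemma ramp_ge a b t : a < b -> ramp a b t <= (t <= b)%R%:R.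
Proof.
move=> ab; have /andP[r0 r1] := ramp01 a b t.
case: (leP t b) => tb /=; first exact: r1.
have s0 : (b - t) / (b - a) <= 0 by rewrite ler_pdivrMr ?subr_gt0 // mul0r subr_le0 ltW.
rewrite /ramp; move: s0; set s := (b - t) / (b - a) => s0.
by rewrite (ler0_norm s0) ler0_norm /=; lra.
Qed.

Lemma ramp_continuous a b : continuous (ramp a b).
Proof.
have c1 : continuous (fun t : R => (b - t) / (b - a)).
  move=> t; apply: cvgM; last exact: cvg_cst.
  by apply: cvgB; [exact: cvg_cst|exact: cvg_id].
move=> t; apply: cvgM; last exact: cvg_cst.
apply: cvgB.
  by apply: cvgD; [exact: cvg_cst|apply: cvg_norm; exact: c1].
by apply: cvg_norm; apply: cvgB; [exact: c1|exact: cvg_cst].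
Qed.

Lemma bounded_rv_ramp a b (Y : T -> R) : measurable_fun setT Y ->
  bounded_rv (fun w => ramp a b (Y w)).
Proof.
move=> mY; split.
  by apply: measurableT_comp mY; apply: continuous_measurable_fun; exact: ramp_continuous.
by exists 1 => w; case/andP: (ramp01 a b (Y w)) => h1 h2; rewrite ger0_norm.
Qed.

Definition cdf_at (Y : T -> R) (z : R) : R := fine (P [set w | Y w <= z]).

Lemma measurable_le_event (Y : T -> R) z : measurable_fun setT Y ->
  measurable [set w | Y w <= z].
Proof.
move=> mY; rewrite -[X in measurable X]setTI.
rewrite (_ : [set w | Y w <= z] = Y @^-1` `]-oo, z]); first exact: mY.
by apply/seteqP; split => w; rewrite /= in_itv.
Qed.

Let indE (Y : T -> R) z w : \1_[set w | Y w <= z] w = (Y w <= z)%R%:R :> R.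
Proof. by rewrite indicE; congr (_%:R); congr nat_of_bool; apply/idP/idP; rewrite inE. Qed.

Lemma cdf_at_ramp a b (Y : T -> R) : measurable_fun setT Y -> a < b ->
  cdf_at Y a <= expect P (fun w => ramp a b (Y w)) <= cdf_at Y b.
Proof.
move=> mY ab; rewrite /cdf_at -!expect_indic; [|exact: measurable_le_event..].
have br := bounded_rv_ramp a b mY.
have bi z : bounded_rv (\1_[set w | Y w <= z] : T -> R).
  by apply: bounded_rv_indic; exact: measurable_le_event.
by apply/andP; split; apply: ler_expect => // w; rewrite indE; [exact: ramp_le|exact: ramp_ge].
Qed.

Variables (Yn : nat -> T -> R) (Y : T -> R).
Hypothesis mYn : forall n, measurable_fun setT (Yn n).
Hypothesis mY : measurable_fun setT Y.
Hypothesis Y_cvg : {ae P, forall w, Yn n w @[n --> \oo] --> Y w}.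

Lemma expect_ramp_cvg a b :
  expect P (fun w => ramp a b (Yn n w)) @[n --> \oo] --> expect P (fun w => ramp a b (Y w)).
Proof.
apply: (@expect_cvg _ _ _ P (fun n w => ramp a b (Yn n w)) _ 1).
- by move=> n; case: (bounded_rv_ramp a b (mYn n)).
- by move=> n w; case/andP: (ramp01 a b (Yn n w)) => h1 h2; rewrite ger0_norm.
- exact: bounded_rv_ramp.
- apply: filterS Y_cvg => w h.
  by apply: (cvg_comp (fun n => Yn n w) (ramp a b)); [exact: h|exact: ramp_continuous].
Qed.

(** A ramp lies between the indicators at its two ends, so the bounds at scale [n] pass to the limit
    at the price of a shift of [x] by [e]; continuity of [F] and [C] then removes the shift. *)
Lemma berry_esseen_limit (F C : R -> R) (Ln : nat -> R) (L : R) :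
  continuous F -> continuous C -> Ln n @[n --> \oo] --> L ->
  (\forall n \near \oo, forall z, `|cdf_at (Yn n) z - F z| <= Ln n * C z) ->
  forall x, `|cdf_at Y x - F x| <= L * C x.
Proof.
move=> cF cC LnL BE x.
have sides e : 0 < e -> cdf_at Y x <= F (x + e) + L * C (x + e) /\
    F (x - e) - L * C (x - e) <= cdf_at Y x.
  move=> e0; have xe : x < x + e by rewrite ltrDl.
  have ex : x - e < x by rewrite ltrBlDr ltrDl.
  split.
    have /andP[h _] := cdf_at_ramp mY xe.
    apply: le_trans h _.
    have hl : F (x + e) + Ln n * C (x + e) @[n --> \oo] --> F (x + e) + L * C (x + e).
      by apply: cvgD; [exact: cvg_cst|apply: cvgM => //; exact: cvg_cst].
    apply: (ler_cvg_to (@expect_ramp_cvg x (x + e)) hl).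
    near=> n; have /andP[_ h2] := cdf_at_ramp (mYn n) xe.
    apply: le_trans h2 _.
    have : `|cdf_at (Yn n) (x + e) - F (x + e)| <= Ln n * C (x + e).
      by move: (x + e); near: n; exact: BE.
    by rewrite ler_norml => /andP[_]; lra.
  have /andP[_ h] := cdf_at_ramp mY ex.
  apply: le_trans _ h.
  have hl : F (x - e) - Ln n * C (x - e) @[n --> \oo] --> F (x - e) - L * C (x - e).
    by apply: cvgB; [exact: cvg_cst|apply: cvgM => //; exact: cvg_cst].
  apply: (ler_cvg_to hl (@expect_ramp_cvg (x - e) x)).
  near=> n; have /andP[h2 _] := cdf_at_ramp (mYn n) ex.
  apply: le_trans _ h2.
  have : `|cdf_at (Yn n) (x - e) - F (x - e)| <= Ln n * C (x - e).
    by move: (x - e); near: n; exact: BE.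
  by rewrite ler_norml => /andP[+ _]; lra.
have inv0 : (n.+1%:R)^-1 @[n --> \oo] --> (0 : R) by exact: cvg_harmonic.
have shift (s : R) (f : R -> R) : continuous f ->
    f (x + s * n.+1%:R^-1) @[n --> \oo] --> f x.
  move=> cf.
  have h : x + s * n.+1%:R^-1 @[n --> \oo] --> x + s * 0.
    by apply: cvgD; [exact: cvg_cst|apply: cvgM => //; exact: cvg_cst].
  rewrite mulr0 addr0 in h.
  by apply: (cvg_comp (fun n => x + s * n.+1%:R^-1) f); [exact: h|exact: cf].
have cst : cdf_at Y x @[_ --> \oo] --> cdf_at Y x by exact: cvg_cst.
have inv_gt0 n : 0 < n.+1%:R^-1 :> R by rewrite invr_gt0.
have lower : F (x + -1 * n.+1%:R^-1) - L * C (x + -1 * n.+1%:R^-1) @[n --> \oo] --> F x - L * C x.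
  by apply: cvgB; [exact: shift|apply: cvgM; [exact: cvg_cst|exact: shift]].
have upper : F (x + 1 * n.+1%:R^-1) + L * C (x + 1 * n.+1%:R^-1) @[n --> \oo] --> F x + L * C x.
  by apply: cvgD; [exact: shift|apply: cvgM; [exact: cvg_cst|exact: shift]].
have le1 : F x - L * C x <= cdf_at Y x.
  apply: (ler_cvg_to lower cst); apply: nearW => n.
  by rewrite mulN1r; case: (sides _ (inv_gt0 n)).
have le2 : cdf_at Y x <= F x + L * C x.
  apply: (ler_cvg_to cst upper); apply: nearW => n.
  by rewrite mul1r; case: (sides _ (inv_gt0 n)).
by rewrite ler_distl; apply/andP.
Unshelve. all: by end_near. Qed.

End limit_in_law.

(** * From the discretised interference to the interference *)

Section interference_limit.
Context {R : realType} {d : measure_display} {T : measurableType d}.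
Variables (P : probability T R) (lam Pw : R) (X : nat -> T -> R * R) (H : nat -> T -> R).
Variables (q G : R -> R) (xo : R * R).
Hypothesis lam_gt0 : 0 < lam.
Hypothesis Pw_gt0 : 0 < Pw.
Hypothesis mX : forall k, measurable_fun setT (X k).
Hypothesis ppp : is_PPP P X lam.
Hypothesis mH : forall k, measurable_fun setT (H k).
Hypothesis H_ge0 : forall k w, 0 <= H k w.
Hypothesis mq : measurable_fun setT q.
Hypothesis q_ge0 : forall h, 0 <= q h.
Hypothesis iid : iid_marks_indep P X H q.
Hypothesis moments : forall j, (1 <= j <= 3)%N ->
  (@lebesgue_measure R).-integrable [set: R] (fun h => (h ^+ j * q h)%:E).
Hypothesis G_ge0 : forall t, 0 <= t -> 0 <= G t.
Hypothesis G_bounded : exists M : R, forall t, 0 <= t -> G t <= M.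
Hypothesis G_noninc : forall s t, 0 <= s -> s <= t -> G t <= G s.
Hypothesis G_decay : exists alpha : R, 2 < alpha /\
  exists C t0 : R, 0 < t0 /\ forall t, t0 <= t -> G t <= C * t `^ (- alpha).
Hypothesis mark2_gt0 : 0 < mark_moment q 2.
Hypothesis G2_gt0 : 0 < Gmoment G 2.

Let p2 n : 0 < 2 ^+ n :> R. Proof. by rewrite exprn_gt0. Qed.

Let total n := total_score X H (ring_score G xo n) (@dyad R n).
Let mass n := @class_mass R lam q (ring_score G xo n) (@dyad R n) (n * 2 ^ n).
Let size n := @class_size (n * 2 ^ n).
Let law n := score_law P X H (ring_score G xo n) (@dyad R n).
Let mring n j := measurable_ring_score xo G_noninc n j.
Let mmark n l := @measurable_mark_score R n l.

(** The interference contributed by a unit of score: mark and gain are both multiples of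
    [2 ^- n]. *)
Definition quantum n : R := Pw * (2 ^+ n)^-1 ^+ 2.
Let quantum_gt0 n : 0 < quantum n.
Proof. by rewrite mulr_gt0 // exprn_gt0 // invr_gt0. Qed.

(** A compound Poisson sum has as its i-th cumulant the sum of rates times i-th powers of the jumps,
    which here factors over rings and marks. *)
Definition cumulant n i : R := lam * Pw ^+ i * ring_moment G xo n i * dyad_mark_moment q n i.
Definition limit_cumulant i : R := lam * Pw ^+ i * (2 * pi * Gmoment G i) * mark_moment q i.

Lemma class_moment n (s : R) i :
  \sum_(c : score_class (n * 2 ^ n)) mass c * jump (@size n) (quantum n / s) c ^+ i = cumulant n i / s ^+ i.
Proof.
rewrite /cumulant /ring_moment /dyad_mark_moment.
rewrite -[lam * _ * _ * _]mulrA big_distrlr /= pair_bigA /= mulr_sumr mulr_suml.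
apply: eq_bigr => c _; rewrite /mass /class_mass /ring_mass /jump /size /class_size /quantum.
by rewrite natrM !exprMn !exprVn; ring.
Qed.

Lemma cumulant_cvg i : (1 <= i <= 3)%N -> cumulant n i @[n --> \oo] --> limit_cumulant i.
Proof.
move=> i13; apply: cvgM; last exact: (dyad_mark_moment_cvg mH H_ge0 mq q_ge0 iid moments i13).
apply: cvgM; first exact: cvg_cst.
by case: i i13 => // i _; exact: ring_moment_cvg.
Qed.

Let signal n k w : R := Pw * dyadR n (H k w) * dyadR n (path_gain G (dist2 xo (X k w))).
Let signal0 k w : R := Pw * H k w * G (dist2 xo (X k w)).

Let signal_ge0 n k w : 0 <= signal n k w.
Proof. by rewrite !mulr_ge0 ?dyadR_ge0 ?(ltW Pw_gt0). Qed.
Let signal0_ge0 k w : 0 <= signal0 k w.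
Proof. by rewrite !mulr_ge0 ?H_ge0 ?G_ge0 ?dist2_ge0 ?(ltW Pw_gt0). Qed.

Definition discretised n w : \bar R := ((quantum n)%:E * total n w)%E.
Local Notation I := (interference Pw G xo X H).

Let discretisedE n w : discretised n w = (\sum_(0 <= k <oo) (signal n k w)%:E)%E.
Proof.
rewrite /discretised -nneseriesZl; last by move=> k _; rewrite lee_fin.
apply: eq_eseriesr => k _; rewrite -EFinM; congr (_%:E).
rewrite /signal /dyadR /quantum /score /ring_score natrM; ring.
Qed.

Let signal_nd n n' k w : (n <= n')%N -> signal n k w <= signal n' k w.
Proof.
move=> nn; rewrite /signal ler_pM ?mulr_ge0 ?dyadR_ge0 ?dyadR_nd ?(ltW Pw_gt0) //.
by rewrite ler_wpM2l ?(ltW Pw_gt0) // dyadR_nd.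
Qed.

Let signal_cvg k w : signal n k w @[n --> \oo] --> signal0 k w.
Proof.
have h0 := H_ge0 k w; have t0 := dist2_ge0 xo (X k w).
apply: cvgM; first apply: cvgM; first exact: cvg_cst.
  by have := @dyadR_cvg R (H k w); rewrite max_l.
by have := @dyadR_cvg R (path_gain G (dist2 xo (X k w))); rewrite max_l path_gainE // G_ge0.
Qed.

Lemma discretised_ge0 n w : (0 <= discretised n w)%E.
Proof. by rewrite discretisedE; apply: nneseries_ge0 => k _ _; rewrite lee_fin. Qed.

Lemma interference_ge0 w : (0 <= I w)%E.
Proof. by apply: nneseries_ge0 => k _ _; rewrite lee_fin signal0_ge0. Qed.

Lemma discretised_nd w : {homo (fun n => discretised n w) : n n' / (n <= n')%N >-> (n <= n')%E}.
Proof.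
move=> n n' nn; rewrite !discretisedE; apply: lee_nneseries => k *; rewrite lee_fin //.
exact: signal_nd.
Qed.

(** Exchange of two monotone limits, in the scale and in the number of transmitters: each finite
    partial sum converges term by term. *)
Lemma discretised_cvg w : discretised n w @[n --> \oo] --> I w.
Proof.
have cv := ereal_nondecreasing_is_cvgn (@discretised_nd w).
suff -> : I w = limn (fun n => discretised n w) by exact: cv.
apply/eqP; rewrite eq_le; apply/andP; split; last first.
  apply: lime_le => //; apply: nearW => n; rewrite discretisedE.
  apply: lee_nneseries => k *; rewrite lee_fin //.
  rewrite -[leRHS](cvg_lim (@Rhausdorff R) (@signal_cvg k w)).
  apply: (@nondecreasing_cvgn_le _ (fun n => signal n k w)).
    by move=> m m' mm; exact: signal_nd.
  by apply/cvg_ex; exists (signal0 k w); exact: signal_cvg.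
apply: lime_le; first by apply: is_cvg_nneseries => k _ _; rewrite lee_fin signal0_ge0.
apply: nearW => K.
have h : (\sum_(0 <= k < K) (signal n k w)%:E)%E @[n --> \oo] --> (\sum_(0 <= k < K) (signal0 k w)%:E)%E.
  apply: cvg_nnesum => k _; first by apply: nearW => n; rewrite lee_fin.
  by apply: cvg_EFin; [exact: nearW|exact: signal_cvg].
apply: (lee_cvg_to h cv); apply: nearW => n; rewrite discretisedE.
by apply: nneseries_lim_ge => k *; rewrite lee_fin.
Qed.

Lemma measurable_discretised n : measurable_fun setT (discretised n).
Proof.
apply: emeasurable_funM => //; apply: (measurable_total_score mX mH (mring n) (mmark n)) => //.
- exact: ring_score_le.
- exact: dyad_le.
Qed.

Lemma measurable_interference : measurable_fun setT I.
Proof.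
apply: ge0_emeasurable_sum => [k w _|k _]; first by rewrite lee_fin signal0_ge0.
apply/measurable_EFinP; apply: measurable_funM; first exact: measurable_funM.
rewrite (_ : (fun w => _) = path_gain G \o (dist2 xo \o X k)).
  apply: measurableT_comp; first exact: measurable_path_gain.
  by apply: measurableT_comp => //; exact: measurable_dist2.
by apply/funext => w /=; rewrite path_gainE // dist2_ge0.
Qed.


Let sd n := Num.sqrt (cumulant n 2).
Let sigma := Num.sqrt (limit_cumulant 2).

Lemma limit_cumulant2_gt0 : 0 < limit_cumulant 2.
Proof. by rewrite !mulr_gt0 ?exprn_gt0 ?pi_gt0. Qed.

(** At coarse scales everything may round to 0, so the normalisation makes sense only from some
    scale on. *)
Lemma cumulant2_near : \forall n \near \oo, 0 < cumulant n 2.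
Proof. exact: (cvgr_gt _ (cumulant_cvg (i := 2) isT) _ limit_cumulant2_gt0). Qed.

Section at_scale.
Variable n : nat.
Hypothesis var_gt0 : 0 < cumulant n 2.

Let sd_gt0 : 0 < sd n. Proof. by rewrite sqrtr_gt0. Qed.
Let step : R := quantum n / sd n.
Let step_gt0 : 0 < step. Proof. exact: divr_gt0. Qed.

Let step_var1 : \sum_(c : score_class (n * 2 ^ n)) mass c * jump (@size n) step c ^+ 2 = 1.
Proof. by rewrite class_moment sqr_sqrtr ?(ltW var_gt0) // divff // gt_eqF. Qed.

Let step_mean : \sum_(c : score_class (n * 2 ^ n)) mass c * jump (@size n) step c =
  cumulant n 1 / sd n.
Proof. by have := class_moment n (sd n) 1; rewrite expr1. Qed.

Let discretised_step w : discretised n w = ((sd n)%:E * (step%:E * total n w))%E.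
Proof. by rewrite muleA -EFinM /step mulrC divfK // gt_eqF. Qed.

Let mstep : measurable_fun setT (fun w => (step%:E * total n w)%E).
Proof.
apply: emeasurable_funM => //; apply: (measurable_total_score mX mH (mring n) (mmark n)) => //.
- exact: ring_score_le.
- exact: dyad_le.
Qed.

Let step_ge0 w : (0 <= step%:E * total n w)%E.
Proof.
by rewrite mule_ge0 ?lee_fin ?(ltW step_gt0) //; apply: nneseries_ge0 => k _ _; rewrite lee_fin.
Qed.

Let ring_bounded := @ring_score_bounded R G xo G_decay n.

Let score_law_n : panjer_law (law n) (@mass n) (@size n).
Proof.
exact: (score_law_panjer lam_gt0 mX mH ppp iid (mring n) (mmark n)
  (ring_score_le G xo n) (dyad_le n) ring_bounded).
Qed.

Lemma integral_discretised : (\int[P]_w discretised n w)%E = (cumulant n 1)%:E.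
Proof.
transitivity (\int[P]_w ((sd n)%:E * (step%:E * total n w)))%E.
  by apply: eq_integral => w _; exact: discretised_step.
rewrite ge0_integralZl_EFin //; last exact: ltW.
rewrite (integral_total_score lam_gt0 mX mH ppp iid (mring n) (mmark n)
  (ring_score_le G xo n) (dyad_le n) ring_bounded step_gt0).
by rewrite step_mean -EFinM mulrC divfK // gt_eqF.
Qed.

Lemma integral_discretised2 :
  (\int[P]_w (discretised n w ^+ 2))%E = (cumulant n 2 + cumulant n 1 ^+ 2)%:E.
Proof.
transitivity (\int[P]_w ((sd n ^+ 2)%:E * (step%:E * total n w) ^+ 2))%E.
  by apply: eq_integral => w _; rewrite discretised_step !expe2 muleACA.
rewrite ge0_integralZl_EFin ?sqr_ge0 //; last 2 first.
- by move=> w _; rewrite expe2 sqre_ge0.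
- by under eq_fun do rewrite expe2; exact: emeasurable_funM.
rewrite (integral_total_score2 lam_gt0 mX mH ppp iid (mring n) (mmark n)
  (ring_score_le G xo n) (dyad_le n) ring_bounded step_var1).
rewrite step_mean -EFinM mulrDr mulr1 -exprMn [sd n * _]mulrC divfK ?gt_eqF //.
by rewrite sqr_sqrtr // ltW.
Qed.

Lemma discretised_berry_esseen z :
  `|cdf_at P (fun w => (fine (discretised n w) - cumulant n 1) / sd n) z - Psi z| <=
  cumulant n 3 / sd n ^+ 3 *
    Num.min ((47 * 100 + 85) / (100 * 100)) ((319 * 100 + 35) / (10 * 100) / (1 + `|z| ^+ 3)).
Proof.
rewrite -class_moment.
have yE w : (fine (discretised n w) - cumulant n 1) / sd n =
    step * fine (total n w) - \sum_(c : score_class (n * 2 ^ n)) mass c * jump (@size n) step c.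
  rewrite step_mean mulrBl /discretised; congr (_ - _).
  rewrite /step mulrAC; congr (_ / _).
  (* On an infinite total score [fine] is 0 on both sides. *)
  case: (total n w) => [r||] //=.
    by rewrite gt0_muley ?lte_fin //= mulr0.
  by rewrite gt0_muleNy ?lte_fin //= mulr0.
have := berry_esseen score_law_n step_gt0 step_var1 z.
have := total_score_cdf lam_gt0 mX mH ppp iid (mring n) (mmark n)
  (ring_score_le G xo n) (dyad_le n) ring_bounded step z.
move=> /(congr1 fine) /= <-; rewrite /cdf_at /lyapunov.
by under [in X in _ -> X]eq_set do rewrite yE.
Qed.

End at_scale.

Lemma integral_interference : (\int[P]_w I w)%E = (limit_cumulant 1)%:E.
Proof.
have := @cvg_monotone_convergence _ _ R P setT measurableT discretised measurable_discretised
  (fun n w _ => discretised_ge0 n w) (fun w _ => @discretised_nd w).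
have -> : (\int[P]_w limn (discretised ^~ w))%E = (\int[P]_w I w)%E.
  by apply: eq_integral => w _; apply: cvg_lim => //; exact: discretised_cvg.
move=> h; apply: (cvg_unique _ h) => //.
have lim1 : (cumulant n 1)%:E @[n --> \oo] --> (limit_cumulant 1)%:E.
  by apply: cvg_EFin; [exact: nearW|exact: cumulant_cvg].
apply: cvg_trans lim1; apply: near_eq_cvg; apply: filterS cumulant2_near => n n0.
by rewrite integral_discretised.
Qed.

Lemma integral_interference2 :
  (\int[P]_w (I w ^+ 2))%E = (limit_cumulant 2 + limit_cumulant 1 ^+ 2)%:E.
Proof.
have m2 n : measurable_fun setT (fun w => discretised n w ^+ 2)%E.
  by under eq_fun do rewrite expe2; apply: emeasurable_funM; exact: measurable_discretised.
have nd2 w : {homo (fun n => discretised n w ^+ 2)%E : n n' / (n <= n')%N >-> (n <= n')%E}.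
  by move=> n n' nn; rewrite !expe2 lee_pmul ?discretised_ge0 // discretised_nd.
have ge2 n w : setT w -> (0 <= discretised n w ^+ 2)%E by rewrite expe2 sqre_ge0.
have := @cvg_monotone_convergence _ _ R P setT measurableT (fun n w => discretised n w ^+ 2)%E m2
  ge2 (fun w _ => @nd2 w).
have -> : (\int[P]_w limn (fun n => discretised n w ^+ 2))%E = (\int[P]_w (I w ^+ 2))%E.
  apply: eq_integral => w _; apply: cvg_lim => //.
  under eq_fun do rewrite expe2.
  rewrite expe2; apply: cvgeM; try exact: discretised_cvg.
  by have := interference_ge0 w; case: (I w) => // r _; exact: mule_def_fin.
move=> h; apply: (cvg_unique _ h) => //.
have lim2 : (cumulant n 2 + cumulant n 1 ^+ 2)%:E @[n --> \oo] -->
    (limit_cumulant 2 + limit_cumulant 1 ^+ 2)%:E.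
  apply: cvg_EFin; first exact: nearW.
  apply: cvgD; first exact: cumulant_cvg.
  by apply: cvgM; exact: (cumulant_cvg (i := 1)).
apply: cvg_trans lim2; apply: near_eq_cvg; apply: filterS cumulant2_near => n n0.
by rewrite integral_discretised2.
Qed.

Let J w := fine (I w).
Let mJ : measurable_fun setT J.
Proof. by apply: measurableT_comp => //; exact: measurable_interference. Qed.
Let J_ge0 w : 0 <= J w. Proof. by rewrite fine_ge0 // interference_ge0. Qed.

Lemma interference_fin_ae : {ae P, forall w, I w \is a fin_num}.
Proof.
have int : P.-integrable setT I.
  apply/integrableP; split; first exact: measurable_interference.
  under eq_integral do rewrite gee0_abs ?interference_ge0 //.
  by rewrite integral_interference ltry.
by apply: filterS (integrable_ae measurableT int) => w; apply.
Qed.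

Let limit_mean_ge0 : 0 <= limit_cumulant 1.
Proof.
by rewrite -lee_fin -integral_interference integral_ge0 // => w _; exact: interference_ge0.
Qed.

Lemma variance_interference :
  (\int[P]_w ((fine (I w) - limit_cumulant 1) ^+ 2)%:E)%E = (limit_cumulant 2)%:E.
Proof.
set m := limit_cumulant 1; have m0 : 0 <= m by exact: limit_mean_ge0.
have EJ : (\int[P]_w (J w)%:E)%E = m%:E.
  rewrite -integral_interference; apply: ge0_ae_eq_integral => //.
  - exact/measurable_EFinP.
  - exact: measurable_interference.
  - by move=> w _; rewrite lee_fin.
  - by move=> w _; exact: interference_ge0.
  - by apply: filterS interference_fin_ae => w Iw _; rewrite fineK.
have EJ2 : (\int[P]_w (J w ^+ 2)%:E)%E = (limit_cumulant 2 + m ^+ 2)%:E.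
  rewrite -integral_interference2; apply: ge0_ae_eq_integral => //.
  - by apply/measurable_EFinP; exact: measurable_funX.
  - by under eq_fun do rewrite expe2; apply: emeasurable_funM; exact: measurable_interference.
  - by move=> w _; rewrite lee_fin sqr_ge0.
  - by move=> w _; rewrite expe2 sqre_ge0.
  - by apply: filterS interference_fin_ae => w Iw _; rewrite EFin_expe /J fineK.
have mD : measurable_fun setT (fun w => (J w - m) ^+ 2).
  by apply: measurable_funX; exact: measurable_funB.
(* Arranged with nonnegative terms on both sides, so that the integrals add up before the variance
   is known to be finite. *)
have E : (\int[P]_w ((J w - m) ^+ 2)%:E + (2 * m)%:E * m%:E =
    (limit_cumulant 2 + m ^+ 2)%:E + (m ^+ 2)%:E)%E.
  rewrite -EJ -EJ2 -ge0_integralZl_EFin //; last 3 first.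
  - by move=> w _; rewrite lee_fin.
  - exact/measurable_EFinP.
  - by rewrite mulr_ge0.
  rewrite -ge0_integralD //; last 4 first.
  - by move=> w _; rewrite lee_fin sqr_ge0.
  - exact/measurable_EFinP.
  - move=> w _; apply: mule_ge0; rewrite lee_fin; [by rewrite mulr_ge0|exact: J_ge0].
  - by apply: emeasurable_funM => //; exact/measurable_EFinP.
  have -> : (m ^+ 2)%:E = (\int[P]_w (m ^+ 2)%:E)%E.
    have := @integral_cst _ _ R P setT measurableT (m ^+ 2)%:E.
    by rewrite (_ : _ setT = 1%E) ?mule1 => [->|]; last exact: probability_setT.
  rewrite -ge0_integralD //; last 3 first.
  - by move=> w _; rewrite lee_fin sqr_ge0.
  - by apply/measurable_EFinP; exact: measurable_funX.
  - by move=> w _; rewrite lee_fin sqr_ge0.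
  apply: eq_integral => w _; rewrite -!EFinM -!EFinD; congr (_%:E); ring.
move: E => /(congr1 (fun z => z - ((2 * m)%:E * m%:E))%E).
rewrite addeK //; rewrite /J /= => ->.
by rewrite -?EFinM -?EFinB -?EFinD; congr (_%:E); ring.
Qed.

Lemma cdf_interference_bound x :
  `|cdf_at P (fun w => (J w - limit_cumulant 1) / sigma) x - Psi x| <=
  limit_cumulant 3 / sigma ^+ 3 *
    Num.min ((47 * 100 + 85) / (100 * 100)) ((319 * 100 + 35) / (10 * 100) / (1 + `|x| ^+ 3)).
Proof.
have sd_cvg : sd n @[n --> \oo] --> sigma.
  apply: (cvg_comp (fun n => cumulant n 2) Num.sqrt).
    exact: (cumulant_cvg (i := 2)).
  exact: sqrt_continuous.
have sigma_gt0 : 0 < sigma by rewrite sqrtr_gt0; exact: limit_cumulant2_gt0.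
have sd_inv : (sd n)^-1 @[n --> \oo] --> sigma^-1 by apply: cvgV => //; rewrite gt_eqF.
apply: (@berry_esseen_limit _ _ _ P (fun n w => (fine (discretised n w) - cumulant n 1) / sd n)
  _ _ _ _ Psi
  (fun z => Num.min ((47 * 100 + 85) / (100 * 100)) ((319 * 100 + 35) / (10 * 100) / (1 + `|z| ^+ 3)))
  (fun n => cumulant n 3 / sd n ^+ 3)).
- move=> n; apply: measurable_funM => //; apply: measurable_funB => //.
  by apply: measurableT_comp => //; exact: measurable_discretised.
- by apply: measurable_funM => //; exact: measurable_funB.
- apply: filterS interference_fin_ae => w Iw.
  apply: cvgM => //; apply: cvgB; last exact: (cumulant_cvg (i := 1)).
  by apply: fine_cvg; rewrite fineK //; exact: discretised_cvg.
- move=> z; apply: differentiable_continuous; apply/derivable1_diffP.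
  exact: (@ex_derive _ _ _ _ _ _ _ (is_derive_Psi z)).
- move=> z.
  have c : {for z, continuous (fun z : R => (319 * 100 + 35) / (10 * 100) / (1 + `|z| ^+ 3))}.
    apply: cvgM; first exact: cvg_cst.
    apply: cvgV; first by rewrite gt_eqF // ltr_wpDr // exprn_ge0.
    apply: cvgD; first exact: cvg_cst.
    apply: (cvg_comp (fun z : R => `|z|) (fun y => y ^+ 3)); last exact: exprn_continuous.
    exact: norm_continuous.
  exact: (@continuous_min R R (fun=> (47 * 100 + 85) / (100 * 100)) _ z (cvg_cst _) c).
- apply: cvgM; first exact: (cumulant_cvg (i := 3)).
  under eq_fun do rewrite -exprVn; rewrite -exprVn.
  by apply: (cvg_comp (fun n => (sd n)^-1) (fun y => y ^+ 3)); last exact: exprn_continuous.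
- apply: filterS cumulant2_near => n n0 z; exact: discretised_berry_esseen.
Qed.

(** The transmit power cancels, while [lam] and [2 pi] occur once above and to the power 3/2
    below. *)
Lemma limit_skewness : limit_cumulant 3 / sigma ^+ 3 =
  (Num.sqrt (2 * pi))^-1 * (mark_moment q 3 / Num.sqrt (mark_moment q 2 ^+ 3)) *
  (Gmoment G 3 / Num.sqrt (Gmoment G 2 ^+ 3)) / Num.sqrt lam.
Proof.
have lam0 := ltW lam_gt0; have G20 := ltW G2_gt0; have m20 := ltW mark2_gt0.
have p0 : 0 <= 2 * pi :> R by rewrite mulr_ge0 // pi_ge0.
have cube (a : R) : 0 <= a -> Num.sqrt (a ^+ 3) = Num.sqrt a ^+ 3.
  by move=> a0; rewrite -{1}(sqr_sqrtr a0) exprAC sqrtr_sqr ger0_norm ?exprn_ge0 ?sqrtr_ge0.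
have sE : sigma = Num.sqrt lam * Pw * (Num.sqrt (2 * pi) * Num.sqrt (Gmoment G 2)) *
    Num.sqrt (mark_moment q 2).
  have Pw0 := ltW Pw_gt0.
  have lP0 : 0 <= lam * Pw ^+ 2 by rewrite mulr_ge0 ?sqr_ge0.
  have lPG0 : 0 <= lam * Pw ^+ 2 * (2 * pi * Gmoment G 2) by rewrite mulr_ge0 // mulr_ge0.
  rewrite /sigma /limit_cumulant (sqrtrM _ lPG0) (sqrtrM _ lP0) (sqrtrM _ lam0) (sqrtrM _ p0).
  by rewrite sqrtr_sqr gtr0_norm.
rewrite sE !cube //.
have l1 : Num.sqrt lam != 0 by rewrite gt_eqF // sqrtr_gt0.
have l2 : Num.sqrt (2 * pi) != 0 :> R by rewrite gt_eqF // sqrtr_gt0 mulr_gt0 // pi_gt0.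
have l3 : Num.sqrt (Gmoment G 2) != 0 by rewrite gt_eqF // sqrtr_gt0.
have l4 : Num.sqrt (mark_moment q 2) != 0 by rewrite gt_eqF // sqrtr_gt0.
have l5 : Pw != 0 by rewrite gt_eqF.
rewrite /limit_cumulant.
have {1}-> : lam = Num.sqrt lam ^+ 2 by rewrite sqr_sqrtr.
have -> : 2 * pi * Gmoment G 3 = Num.sqrt (2 * pi) ^+ 2 * Gmoment G 3 by rewrite sqr_sqrtr.
by field; rewrite l1 l2 l3 l4 l5.
Qed.

End interference_limit.

Unset Implicit Arguments.

Theorem theorem2 (R : realType) (d : measure_display) (Omega : measurableType d)
  (P : probability Omega R)
  (lam : R) (X : nat -> Omega -> R * R) (H : nat -> Omega -> R)
  (q : R -> R) (G : R -> R) (Pw : R) (xo : R * R) :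
  0 < lam ->
  0 < Pw ->
  (* transmitter locations: stationary Poisson point process of intensity lam *)
  (forall k, measurable_fun setT (X k)) ->
  is_PPP P X lam ->
  (* fading: H_k >= 0 i.i.d. with density q, independent of the locations *)
  (forall k, measurable_fun setT (H k)) ->
  (forall k w, 0 <= H k w) ->
  measurable_fun setT q ->
  (forall h, 0 <= q h) ->
  (\int[lebesgue_measure]_(h in [set: R]) (q h)%:E)%E = 1%E ->
  iid_marks_indep P X H q ->
  (* finite moments m_H, m_{H^2}, m_{H^3} *)
  (forall j, (1 <= j <= 3)%N ->
     lebesgue_measure.-integrable [set: R] (fun h => (h ^+ j * q h)%:E)) ->
  (* path loss G : [0,oo) -> [0,oo), bounded, non-increasing, O(t^-alpha) *)
  (forall t, 0 <= t -> 0 <= G t) ->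
  (exists M : R, forall t, 0 <= t -> G t <= M) ->
  (forall s t, 0 <= s -> s <= t -> G t <= G s) ->
  (exists alpha : R, 2 < alpha /\
     exists C t0 : R, 0 < t0 /\ forall t, t0 <= t -> G t <= C * t `^ (- alpha)) ->
  (* non-degeneracy (Var I > 0), implicit in the normalisation *)
  0 < mark_moment q 2 ->
  0 < Gmoment G 2 ->
  forall x : R,
    let I := interference Pw G xo X H in
    let EI := fine (\int[P]_w I w)%E in
    let VarI := fine (\int[P]_w ((fine (I w) - EI) ^+ 2)%:E)%E in
    (`| P [set w | ((fine (I w) - EI) / Num.sqrt VarI <= x)%R] - (Psi x)%:E |
       <= (cconst q G x / Num.sqrt lam)%:E)%E.
Proof.
move=> lam0 Pw0 mX ppp mH H0 mq q0 _ iid mom G0 Gb Gn Gd m2 G2 x; cbv zeta.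
set I := interference Pw G xo X H; set EI := fine _; set VarI := fine _.
have EIE : EI = limit_cumulant lam Pw q G 1.
  by rewrite /EI /I (integral_interference xo lam0 Pw0 mX ppp mH H0 mq q0 iid mom G0 Gb Gn Gd m2 G2).
have VarE : VarI = limit_cumulant lam Pw q G 2.
  by rewrite /VarI EIE /I (variance_interference xo lam0 Pw0 mX ppp mH H0 mq q0 iid mom G0 Gb Gn Gd m2 G2).
have mI : measurable [set w | (fine (I w) - EI) / Num.sqrt VarI <= x].
  apply: measurable_le_event; apply: measurable_funM => //; apply: measurable_funB => //.
  apply: measurableT_comp => //.
  exact: (measurable_interference xo Pw0 mX mH H0 G0 Gn).
have := cdf_interference_bound xo lam0 Pw0 mX ppp mH H0 mq q0 iid mom G0 Gb Gn Gd m2 G2 x.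
rewrite limit_skewness // -EIE -VarE /cdf_at => bound.
rewrite -(fineK (fin_num_measure P _ mI)) -EFinB lee_fin; apply: le_trans bound _.
by rewrite /cconst le_eqVlt; apply/orP; left; apply/eqP; ring.
Qed.
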